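(* Let $m\ge1$, let $h$ be a non-constant entire function in $\mathbb{C}^m$, and let $f=e^h$. Then $\rho(h)=\rho_1(f)$, i.e. the order of $h$ equals the hyper-order of $f$.
   Context: On $\mathbb{C}^m$ let $\tau_m(z)=\|z\|^2$ (Euclidean norm), $d=\partial+\bar\partial$, $d^c=\frac{\iota}{4\pi}(\bar\partial-\partial)$ with $\iota=\sqrt{-1}$, and on $\mathbb{C}^m\setminus\{0\}$ let $\omega_m=dd^c\log\tau_m$ and $\sigma_m=d^c\log\tau_m\wedge\omega_m^{m-1}$. For $r>0$ let $\mathbb{C}^m\langle r\rangle=\{z\in\mathbb{C}^m:\|z\|=r\}$. For an entire function $g$ in $\mathbb{C}^m$ the Nevanlinna characteristic function is $T(r,g)=m(r,g)=\int_{\mathbb{C}^m\langle r\rangle}\log^+|g|\,\sigma_m$ (the term $N(r,g)$ counting poles vanishes for entire $g$). The order and hyper-order of $g$ are $$\rho(g)=\limsup_{r\to\infty}\frac{\log T(r,g)}{\log r},\qquad \rho_1(g)=\limsup_{r\to\infty}\frac{\log\log T(r,g)}{\log r}.$$ *)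

(* Defs.v *)
From HB Require Import structures.
From mathcomp Require Import all_boot all_order all_algebra all_fingroup.
From mathcomp Require Import complex.
From mathcomp Require Import all_classical all_reals all_analysis.

Set Implicit Arguments.
Unset Strict Implicit.
Unset Printing Implicit Defensive.
Import Order.TTheory GRing.Theory Num.Theory.
Import numFieldNormedType.Exports.

Local Open Scope classical_set_scope.
Local Open Scope ring_scope.
Local Open Scope complex_scope.

(* The topology and normed-module structure of the complex field over itself;
   the library declares it for abstract number fields only. *)
HB.instance Definition _ (R : realType) :=
  NormedModule.copy R[i] (R[i] : numFieldType)^o.

Section Forms.
Variables (R : realType) (m : nat).
Notation C := R[i].
Notation V := 'rV[C]_m.

(* Real differential forms on C^m, seen as a 2m-dimensional real vector space:
   [a z v] is the value at the point z on the k tangent vectors v. *)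
Definition form (k : nat) := V -> ('I_k -> V) -> R.

Definition dirD (u : V -> R) (z v : V) : R :=
  derive1 (fun t : R => u (z + t%:C *: v)) 0.

(* The vectors v are constant vector fields, so the Lie bracket terms vanish. *)
Definition extd k (a : form k) : form k.+1 := fun z v =>
  \sum_(i < k.+1)
    (-1) ^+ i * dirD (fun w => a w (fun j => v (lift i j))) z (v i).

Definition wedge k l (a : form k) (b : form l) : form (k + l) := fun z v =>
  ((k`! * l`!)%:R)^-1 *
  \sum_(s : 'S_(k + l)) (-1) ^+ s *
    a z (fun i => v (s (lshift l i))) * b z (fun j => v (s (rshift k j))).

Fixpoint wedge_pow (b : form 2) (p : nat) : form (p * 2) :=
  match p with
  | 0 => fun _ _ => 1
  | q.+1 => wedge b (@wedge_pow b q)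
  end.

(* For real-valued u, (del u)(v) = (du(v) - i du(iv)) / 2 and delbar u is its
   conjugate, so (delbar u - del u)(v) = i du(iv) and
   d^c u = (i / 4 pi) (delbar u - del u) = - (4 pi)^-1 du(i v). *)
Definition dc (u : V -> R) : form 1 := fun z v =>
  - (4 * pi)^-1 * dirD u z ((0 +i* 1) *: v ord0).

Definition tau (z : V) : R := \sum_(j < m) Normc.normc (z ord0 j) ^+ 2.

Definition log_tau (z : V) : R := ln (tau z).

Definition omega : form 2 := extd (dc log_tau).

Definition entire (h : V -> C) : Prop := forall z : V, differentiable h z.

End Forms.

(* For nonnegative Borel functions this is, by Tonelli, the integral against
   the k-dimensional Lebesgue measure. *)
Fixpoint iter_integral (R : realType) (k : nat) :
    ('rV[R]_k -> \bar R) -> \bar R :=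
  match k with
  | 0 => fun F => F 0
  | l.+1 => fun F =>
      (\int[lebesgue_measure]_x
         iter_integral (fun v : 'rV[R]_l => F (row_mx x%:M v : 'rV_(1 + l))))%E
  end.

Section Nevanlinna.
Variables (R : realType) (n : nat).
Notation C := R[i].
Notation V := 'rV[C]_n.+1.

Definition sigma : form R n.+1 (1 + n * 2) :=
  wedge (dc (@log_tau R n.+1)) (@wedge_pow R n.+1 (@omega R n.+1) n).

(* Toric coordinates on the sphere: x = (t_0, s_1, t_1, ..., s_n, t_n) is sent
   to r (sqrt s_0 e^{i t_0}, ..., sqrt s_n e^{i t_n}), s_0 = 1 - s_1 - ... - s_n.
   On the open set sphere_dom this is a diffeomorphism onto the complement of a
   null set of the sphere of radius r. It preserves the orientation, the sphere
   being oriented as the boundary of the ball of C^(n+1): putting the outward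
   normal first, dr, dt_0, ds_1, dt_1, ..., ds_n, dt_n is positive. *)
Definition ang (x : 'rV[R]_(1 + n * 2)) (j : 'I_n.+1) : R :=
  x ord0 (inord (j * 2) : 'I_(n * 2).+1).

Definition wgt_pos (x : 'rV[R]_(1 + n * 2)) (j : 'I_n.+1) : R :=
  x ord0 (inord (j * 2).-1 : 'I_(n * 2).+1).

Definition wgt (x : 'rV[R]_(1 + n * 2)) (j : 'I_n.+1) : R :=
  if j == ord0 then 1 - \sum_(k < n.+1 | k != ord0) wgt_pos x k
  else wgt_pos x j.

Definition sphere_dom : set 'rV[R]_(1 + n * 2) :=
  [set x | forall j, 0 < wgt x j /\ 0 < ang x j < 2 * pi].

Definition sphere_chart (r : R) (x : 'rV[R]_(1 + n * 2)) : V :=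
  \row_j ((r * Num.sqrt (wgt x j))%:C * (cos (ang x j) +i* sin (ang x j))).

Definition sphere_frame (r : R) (x : 'rV[R]_(1 + n * 2))
    (i : 'I_(1 + n * 2)) : V :=
  \row_j
    (derive1 (fun t : R => complex.Re
       (sphere_chart r (x + t *: delta_mx ord0 i) ord0 j)) 0
     +i*
     derive1 (fun t : R => complex.Im
       (sphere_chart r (x + t *: delta_mx ord0 i) ord0 j)) 0).

(* Integral over the sphere of radius r of a form of top degree whose pullback
   by the chart is nonnegative. *)
Definition sphere_integral (r : R) (a : form R n.+1 (1 + n * 2)) : \bar R :=
  iter_integral ((fun x =>
    (a (sphere_chart r x) (sphere_frame r x))%:E) \_ sphere_dom).

Definition logp (x : R) : R := Num.max 0 (ln x).

(* The characteristic function of an entire g (no poles, so N(r, g) = 0). *)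
Definition charT (r : R) (g : V -> C) : \bar R :=
  sphere_integral r (fun z v => logp (Normc.normc (g z)) * sigma z v).

Definition order_of (g : V -> C) : \bar R :=
  limf_esup (fun r : R => lne (charT r g) * ((ln r)^-1)%:E)%E (pinfty_nbhs R).

Definition hyper_order_of (g : V -> C) : \bar R :=
  limf_esup (fun r : R => lne (lne (charT r g)) * ((ln r)^-1)%:E)%E
    (pinfty_nbhs R).

End Nevanlinna.

Definition cexp (R : realType) (w : R[i]) : R[i] :=
  (expR (complex.Re w))%:C * (cos (complex.Im w) +i* sin (complex.Im w)).

(* Main.v *)
Require Import Defs.
From mathcomp Require Import all_boot all_order all_algebra all_fingroup.
From mathcomp Require Import complex ring lra zify.
From mathcomp Require Import all_classical all_reals all_analysis.

(** Let T(r, g) be the characteristic function, f = exp h and t > 0. Both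
    inequalities between the two orders come from comparing T with pointwise
    values of log+|g| on polydiscs:

    - T(r, g) <= D max log+|g|, the maximum being over the polydisc of radius r
      ([char_upper_bound]);
    - c log+|g w| <= T(r, g) for all w in the polydisc of radius k r
      ([char_lower_bound]), with constants c, k, D > 0 that depend on the
      dimension only.

    If T(r / k, h) <= t then |h| <= exp (t / c) on the polydisc of radius r; since
    log+|exp h| <= |h|, this gives T(r, f) <= D exp (t / c) ([char_exp_le]). If
    T(2 r / k, f) <= t then Re h <= t / c on the polydisc of radius 2 r; the
    Borel-Caratheodory theorem on complex lines bounds |h| on the polydisc of
    radius r by 2 (t / c + 1 + |h 0|)^3, hence T(r, h) by a multiple of
    log t + const ([char_le_ln_exp]). By Liouville's theorem T(r, h), and with it
    T(r, f), tends to infinity with r, so that the constants are absorbed and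
    log log T(r, f) and log T(r, h) differ, up to a dilation of r, by a bounded
    quantity. Divided by log r they have the same limit superior
    ([limf_esup_log_le]).

    The two bounds for T rest on [sigma_chart]: in the toric chart of the sphere,
    with weights s_j and angles t_j, the form sigma is a positive constant times
    Lebesgue measure, independently of r. It is computed from d^c log tau and
    omega on vectors tangent to the sphere, with the wedge products rewritten as
    alternating sums and these as a determinant. The upper bound for T follows
    at once. For the lower one, the chart contains a box of weights for which all the
    radii r sqrt (s_j) are comparable to r; the Poisson inequality
    log+|G(rho b)| <= (1 + |b|) / (1 - |b|) times the mean of log+|G| over the circle
    of radius rho ([logp_poisson]), applied to one variable after another, bounds
    log+|g w| by integrals over the tori in this box.

    The one-variable theory starts from Goursat's theorem on rectangles, which
    gives the mean value property of holomorphic functions and the maximum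
    principle. Products over rotations give the sub-mean value property of log|G|
    ([sub_mean]), and a change of variable by a disc automorphism gives the Poisson
    inequality, from which the theorems of Liouville and Borel-Caratheodory follow. *)

Set Implicit Arguments.
Unset Strict Implicit.
Unset Printing Implicit Defensive.
Import Order.TTheory GRing.Theory Num.Theory.
Import numFieldNormedType.Exports.

Local Open Scope classical_set_scope.
Local Open Scope ring_scope.
Local Open Scope complex_scope.

(** * Integrals of continuous functions over intervals *)

Section IntervalIntegral.
Context {R : realType}.
Implicit Types (a b c r : R) (f g F : R -> R).

Definition ivl a b f : R := \int[@lebesgue_measure R]_(x in `[a, b]) f x.

Lemma cont_integrable a b f : {in `[a, b], continuous f} ->
  (@lebesgue_measure R).-integrable `[a, b] (EFin \o f).
Proof.
move=> cf; apply: continuous_compact_integrable; first exact: segment_compact.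
by apply: continuous_in_subspaceT => x; rewrite inE => /cf.
Qed.

Lemma ivlD a b f g : {in `[a, b], continuous f} -> {in `[a, b], continuous g} ->
  ivl a b (fun x => f x + g x) = ivl a b f + ivl a b g.
Proof. by move=> cf cg; rewrite /ivl RintegralD//; exact: cont_integrable. Qed.

Lemma ivlB a b f g : {in `[a, b], continuous f} -> {in `[a, b], continuous g} ->
  ivl a b (fun x => f x - g x) = ivl a b f - ivl a b g.
Proof. by move=> cf cg; rewrite /ivl RintegralB//; exact: cont_integrable. Qed.

Lemma ivlZ a b r f : {in `[a, b], continuous f} ->
  ivl a b (fun x => r * f x) = r * ivl a b f.
Proof. by move=> cf; rewrite /ivl RintegralZl//; exact: cont_integrable. Qed.

Lemma eq_ivl a b f g : {in `[a, b], f =1 g} -> ivl a b f = ivl a b g.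
Proof. by move=> fg; apply: eq_Rintegral => x; rewrite inE => /fg. Qed.

Lemma ivl_cst a b r : a <= b -> ivl a b (fun=> r) = r * (b - a).
Proof.
move=> ab; rewrite /ivl Rintegral_cst//= lebesgue_measure_itv/= lte_fin.
by move: ab; rewrite le_eqVlt => /predU1P[->|->//]; rewrite ltxx subrr.
Qed.

Lemma le_ivl a b f g : {in `[a, b], continuous f} -> {in `[a, b], continuous g} ->
  {in `[a, b], forall x, f x <= g x} -> ivl a b f <= ivl a b g.
Proof.
by move=> cf cg fg; apply: le_Rintegral => //; exact: cont_integrable.
Qed.

Lemma ivl_ge0 a b f : {in `[a, b], forall x, 0 <= f x} -> 0 <= ivl a b f.
Proof. by move=> f0; apply: Rintegral_ge0 => x /f0. Qed.

Lemma ivl_near_cst a b f r e : a <= b -> {in `[a, b], continuous f} ->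
  {in `[a, b], forall x, `|f x - r| <= e} -> `|ivl a b f - r * (b - a)| <= e * (b - a).
Proof.
move=> ab cf fe; have cc (z : R) : {in `[a, b], continuous (fun=> z)}.
  by move=> x _; exact: cvg_cst.
rewrite ler_distl -!mulrBl -mulrDl -!ivl_cst//; apply/andP; split;
  by apply: le_ivl => // x /fe; rewrite ler_distl => /andP[].
Qed.

Lemma ivl_split a c b f : a <= c -> c <= b -> {in `[a, b], continuous f} ->
  ivl a b f = ivl a c f + ivl c b f.
Proof.
move=> ac cb cf.
have icb : (@lebesgue_measure R).-integrable `]c, b] (EFin \o f).
  apply: (integrableS _ _ _ (cont_integrable cf)) => //.
  by apply: subset_itvr; rewrite bnd_simp.
rewrite /ivl -(@Rintegral_itv_obnd_cbnd _ c)//.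
have := @Rintegral_itvB _ f (BLeft a) (BRight b) c (cont_integrable cf).
by rewrite !bnd_simp => /(_ ac cb) <-; rewrite addrC subrK.
Qed.

Lemma ivl_FTC a b f F : a <= b -> {in `[a, b], continuous f} ->
  {in `[a, b], forall x : R, is_derive x 1 F (f x)} -> ivl a b f = F b - F a.
Proof.
rewrite le_eqVlt => /predU1P[<- cf dF|ab cf dF].
  by rewrite /ivl set_itv1 Rintegral_set1 subrr.
have cF : {in `[a, b], continuous F}.
  move=> x /dF dFx; apply: differentiable_continuous; apply/derivable1_diffP.
  by have [] := dFx.
rewrite /ivl /Rintegral (@continuous_FTC2 _ f F)//.
- by apply: continuous_in_subspaceT => x; rewrite inE => /cf.
- split.
  + by move=> x xab; have [] := dF x (subset_itv_oo_cc xab).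
  + by apply: cvg_at_right_filter; apply: cF; rewrite bound_itvE ltW.
  + by apply: cvg_at_left_filter; apply: cF; rewrite bound_itvE ltW.
- by move=> x xab; rewrite derive1E; have [] := dF x (subset_itv_oo_cc xab).
Qed.

(** The half-line avoids the end points of the intervals to which the primitive is
    applied, where only a one-sided derivative would be available. *)
Lemma primitive_exists f : continuous f ->
  forall a, exists F, forall x : R, a < x -> is_derive x 1 F (f x).
Proof.
move=> cf a; exists (fun x => ivl a x f) => x ax.
have [||d1 d2] := @continuous_FTC1_closed _ f a x (x + 1) _ _ ax (cf x).
- by rewrite ltrDl.
- by apply: cont_integrable => y _; exact: cf.
split; [exact: d1|by rewrite -derive1E; exact: d2].
Qed.

(** Stated for an arbitrary relation, so that it gives both the uniform continuity
    of one function and the equicontinuity of the slices of a function of two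
    variables. *)
Lemma segment_lebesgue_number a b (Q : R -> R -> Prop) :
  (forall x, a <= x <= b -> exists2 d, 0 < d &
    forall u v, `|u - x| < d -> `|v - x| < d -> Q u v) ->
  exists2 d, 0 < d & forall u v, a <= u <= b -> `|v - u| < d -> Q u v.
Proof.
move=> locQ; have := @segment_compact R a b; move/compact_near_coveringP.
move=> /(_ R (nbhs (0 : R)) (fun d u => forall v, `|v - u| < d -> Q u v)).
case=> [x|d /= d0 H].
  rewrite /= in_itv/= => /locQ[d d0 H].
  exists (ball x (d / 2), ball (0 : R) (d / 2)) => /=.
    by split; apply: nbhsx_ballx; rewrite divr_gt0.
  move=> [u e] /= [] xu ed v uv; rewrite /ball/= distrC in xu; rewrite /ball/= in ed.
  have e2 : e < d / 2.
    by rewrite sub0r normrN in ed; apply: le_lt_trans ed; exact: ler_norm.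
  apply: H; first by lra.
  rewrite -[v - x](subrKA u); apply: (le_lt_trans (ler_normD _ _)); lra.
exists (d / 2) => [|u v uab vu]; first exact: divr_gt0.
apply: (H (d / 2)) vu; first by rewrite /ball_/= sub0r normrN gtr0_norm ?divr_gt0//; lra.
by rewrite /= in_itv.
Qed.

Lemma unif_cont_segment a b f e : 0 < e -> {in `[a, b], continuous f} ->
  exists2 d, 0 < d &
    forall x y, a <= x <= b -> `|y - x| < d -> `|f y - f x| <= e.
Proof.
move=> e0 cf.
apply: (@segment_lebesgue_number a b (fun x y => `|f y - f x| <= e)) => x xab.
have := cf x; rewrite in_itv/= => /(_ xab)/cvgrPdist_lt/(_ (e / 2)).
rewrite divr_gt0// => /(_ isT)/nbhs_ballP[d /= d0 H].
exists d => // u v ux vx; rewrite -[f v - f u](subrKA (f x)).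
have h1 : `|f x - f u| < e / 2 by apply: H; rewrite /ball/= distrC.
have h2 : `|f x - f v| < e / 2 by apply: H; rewrite /ball/= distrC.
by apply: (le_trans (ler_normD _ _)); rewrite [`|f v - f x|]distrC; lra.
Qed.

End IntervalIntegral.

(** * Goursat's theorem on rectangles *)

Section Goursat.
Context {R : realType}.
Implicit Types (P Q : R -> R -> R).

(** Total differentiability of [P] and [Q] at one point together with
    dP/dx = dQ/dy, the closedness of the form Q dx + P dy. *)
Definition closed_form_at P Q (p q : R) := exists A B C : R, forall e, 0 < e ->
  exists2 d, 0 < d & forall x y, `|x - p| < d -> `|y - q| < d ->
    `|P x y - P p q - (A * (x - p) + B * (y - q))| <= e * (`|x - p| + `|y - q|) /\
    `|Q x y - Q p q - (C * (x - p) + A * (y - q))| <= e * (`|x - p| + `|y - q|).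

(** The integral of Q dx + P dy along the boundary of the rectangle with corner
    (x, y) and sides a, b, counterclockwise. *)
Definition circulation P Q (x a y b : R) : R :=
  ivl y (y + b) (fun t => P (x + a) t - P x t) -
  ivl x (x + a) (fun s => Q s (y + b) - Q s y).

Lemma eps_continuous (f : R -> R) (p A : R) :
  (exists2 d, 0 < d & forall x, `|x - p| < d ->
    `|f x - f p - A * (x - p)| <= `|x - p|) -> {for p, continuous f}.
Proof.
case=> d d0 H; apply/cvgrPdist_lt => e e0.
have A1 : 0 < `|A| + 1 by rewrite ltr_pwDr.
near=> x.
have xd : `|x - p| < d by rewrite distrC; near: x; exact: cvgr_dist_lt.
have xe : `|x - p| < e / (`|A| + 1).
  by rewrite distrC; near: x; apply: cvgr_dist_lt => //; exact: divr_gt0.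
rewrite distrC; have := H x xd; rewrite ltr_pdivlMr// in xe.
have := ler_normD (f x - f p - A * (x - p)) (A * (x - p)).
rewrite subrK normrM => h1 h2; apply: (le_lt_trans h1).
by rewrite mulrDr mulr1 mulrC in xe; lra.
Unshelve. all: by end_near. Qed.

Lemma closed_form_cont P Q p q : closed_form_at P Q p q ->
  {for q, continuous (P p)} /\ {for p, continuous (Q ^~ q)}.
Proof.
move=> [A [B [C H]]]; have [d d0 Hd] := H 1 ltr01.
have z0 (z : R) : `|z - z| < d by rewrite subrr normr0.
split; [apply: (@eps_continuous _ _ B)|apply: (@eps_continuous _ _ C)];
  exists d => // x xd.
  by have [+ _] := Hd p x (z0 p) xd; rewrite subrr normr0 mulr0 !add0r mul1r.
by have [_] := Hd x q xd (z0 q); rewrite subrr normr0 mulr0 !addr0 mul1r.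
Qed.

(** The affine parts of [P] and [Q] at (p, q) have circulation A a b - A b a = 0,
    so that only the error terms of the differentiability at (p, q) remain. *)
Lemma circulation_bound P Q (A e d p q x a y b : R) : 0 <= a -> 0 <= b -> 0 <= e ->
  (forall s t, x <= s <= x + a -> y <= t <= y + b -> closed_form_at P Q s t) ->
  x <= p <= x + a -> y <= q <= y + b -> a < d -> b < d ->
  (exists B C, forall x y, `|x - p| < d -> `|y - q| < d ->
    `|P x y - P p q - (A * (x - p) + B * (y - q))| <= e * (`|x - p| + `|y - q|) /\
    `|Q x y - Q p q - (C * (x - p) + A * (y - q))| <= e * (`|x - p| + `|y - q|)) ->
  `|circulation P Q x a y b| <= 2 * e * (a + b) ^+ 2.
Proof.
move=> a0 b0 e0 cl /andP[xp pa] /andP[yq qb] ad bd [B [C H]].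
have dist (u v l z : R) : v <= u <= v + l -> v <= z <= v + l -> `|z - u| <= l.
  by move=> /andP[? ?] /andP[? ?]; rewrite ler_norml; apply/andP; split; lra.
have hx : `|ivl y (y + b) (fun t => P (x + a) t - P x t) - A * a * b| <=
          2 * e * (a + b) * b.
  have := @ivl_near_cst R y (y + b) (fun t => P (x + a) t - P x t) (A * a) (2 * e * (a + b)).
  rewrite [y + b - y]addrC addKr; apply; first by rewrite lerDl.
    move=> t; rewrite in_itv/= => ty; apply: cvgB.
      by have [] := closed_form_cont (cl (x + a) t _ ty); rewrite ?lexx ?lerDl ?a0.
    by have [] := closed_form_cont (cl x t _ ty); rewrite ?lexx ?lerDl ?a0.
  move=> t; rewrite in_itv/= => ty.
  have tq : `|t - q| <= b by apply: (dist q y) => //; rewrite yq.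
  have x1 : `|x + a - p| <= a by apply: (dist p x); rewrite ?xp// lexx lerDl a0.
  have x0 : `|x - p| <= a by apply: (dist p x); rewrite ?xp// lexx lerDl a0.
  have [h1 _] := H (x + a) t (le_lt_trans x1 ad) (le_lt_trans tq bd).
  have [h0 _] := H x t (le_lt_trans x0 ad) (le_lt_trans tq bd).
  have -> : P (x + a) t - P x t - A * a =
    (P (x + a) t - P p q - (A * (x + a - p) + B * (t - q))) -
    (P x t - P p q - (A * (x - p) + B * (t - q))) by ring.
  apply: (le_trans (ler_normB _ _)).
  have k1 : e * (`|x + a - p| + `|t - q|) <= e * (a + b) by rewrite ler_wpM2l// lerD.
  have k0 : e * (`|x - p| + `|t - q|) <= e * (a + b) by rewrite ler_wpM2l// lerD.
  lra.
have hy : `|ivl x (x + a) (fun s => Q s (y + b) - Q s y) - A * b * a| <=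
          2 * e * (a + b) * a.
  have := @ivl_near_cst R x (x + a) (fun s => Q s (y + b) - Q s y) (A * b) (2 * e * (a + b)).
  rewrite [x + a - x]addrC addKr; apply; first by rewrite lerDl.
    move=> t; rewrite in_itv/= => ty; apply: cvgB.
      by have [] := closed_form_cont (cl t (y + b) ty _); rewrite ?lexx ?lerDl ?b0.
    by have [] := closed_form_cont (cl t y ty _); rewrite ?lexx ?lerDl ?b0.
  move=> s; rewrite in_itv/= => sx.
  have sp : `|s - p| <= a by apply: (dist p x) => //; rewrite xp.
  have y1 : `|y + b - q| <= b by apply: (dist q y); rewrite ?yq// lexx lerDl b0.
  have y0 : `|y - q| <= b by apply: (dist q y); rewrite ?yq// lexx lerDl b0.
  have [_ h1] := H s (y + b) (le_lt_trans sp ad) (le_lt_trans y1 bd).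
  have [_ h0] := H s y (le_lt_trans sp ad) (le_lt_trans y0 bd).
  have -> : Q s (y + b) - Q s y - A * b =
    (Q s (y + b) - Q p q - (C * (s - p) + A * (y + b - q))) -
    (Q s y - Q p q - (C * (s - p) + A * (y - q))) by ring.
  apply: (le_trans (ler_normB _ _)).
  have k1 : e * (`|s - p| + `|y + b - q|) <= e * (a + b) by rewrite ler_wpM2l// lerD.
  have k0 : e * (`|s - p| + `|y - q|) <= e * (a + b) by rewrite ler_wpM2l// lerD.
  lra.
have -> : circulation P Q x a y b =
  (ivl y (y + b) (fun t => P (x + a) t - P x t) - A * a * b) -
  (ivl x (x + a) (fun s => Q s (y + b) - Q s y) - A * b * a).
  by rewrite /circulation; ring.
apply: (le_trans (ler_normB _ _)); apply: (le_trans (lerD hx hy)).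
by rewrite expr2; lra.
Qed.

Lemma circulation_splitx P Q (x a1 a2 y b : R) : 0 <= a1 -> 0 <= a2 -> 0 <= b ->
  (forall s t, x <= s <= x + (a1 + a2) -> y <= t <= y + b -> closed_form_at P Q s t) ->
  circulation P Q x (a1 + a2) y b =
  circulation P Q x a1 y b + circulation P Q (x + a1) a2 y b.
Proof.
move=> a10 a20 b0 cl.
have cP s t : x <= s <= x + (a1 + a2) -> t \in `[y, y + b] -> {for t, continuous (P s)}.
  by rewrite in_itv/= => hs ht; have [] := closed_form_cont (cl s t hs ht).
have cQ s t : s \in `[x, x + (a1 + a2)] -> y <= t <= y + b -> {for s, continuous (Q ^~ t)}.
  by rewrite in_itv/= => hs ht; have [] := closed_form_cont (cl s t hs ht).
have i0 : x <= x <= x + (a1 + a2) by apply/andP; lra.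
have i1 : x <= x + a1 <= x + (a1 + a2) by apply/andP; lra.
have i2 : x <= x + (a1 + a2) <= x + (a1 + a2) by apply/andP; lra.
have j0 : y <= y <= y + b by apply/andP; lra.
have j1 : y <= y + b <= y + b by apply/andP; lra.
rewrite /circulation -!addrA.
rewrite (@ivl_split _ x (x + a1) (x + (a1 + a2))); [|lra|lra|]; last first.
  by move=> s hs; apply: cvgB; apply: cQ.
rewrite !ivlB; do ?[by move=> t ht; apply: cP];
  do ?[by move=> s; rewrite in_itv/= => hs; apply: cQ => //; rewrite in_itv/=; apply/andP; lra].
ring.
Qed.

Lemma closed_form_swap P Q p q : closed_form_at P Q p q ->
  closed_form_at (fun t s => Q s t) (fun t s => P s t) q p.
Proof.
move=> [A [B [C H]]]; exists A, C, B => e /H[d d0 Hd]; exists d => // t s tq sp.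
have [h1 h2] := Hd s t sp tq.
by split; rewrite [`|t - q| + _]addrC [A * _ + _]addrC [_ + A * _]addrC in h1 h2 *.
Qed.

Lemma circulation_swap P Q x a y b :
  circulation (fun t s => Q s t) (fun t s => P s t) y b x a = - circulation P Q x a y b.
Proof. by rewrite /circulation opprB. Qed.

(** Exchanging the two coordinates reverses the orientation of the boundary and
    keeps the form closed, which reduces this to the horizontal case. *)
Lemma circulation_splity P Q (x a y b1 b2 : R) : 0 <= a -> 0 <= b1 -> 0 <= b2 ->
  (forall s t, x <= s <= x + a -> y <= t <= y + (b1 + b2) -> closed_form_at P Q s t) ->
  circulation P Q x a y (b1 + b2) =
  circulation P Q x a y b1 + circulation P Q x a (y + b1) b2.
Proof.
move=> a0 b10 b20 cl.
have cl' t s : y <= t <= y + (b1 + b2) -> x <= s <= x + a ->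
    closed_form_at (fun t s => Q s t) (fun t s => P s t) t s.
  by move=> ht hs; apply: closed_form_swap; exact: cl.
have := circulation_splitx b10 b20 a0 cl'.
by rewrite !(circulation_swap P Q) -opprD => /oppr_inj.
Qed.

(** The circulations of the four quarters of a rectangle add up to its own. *)
Lemma circulation_quarter P Q (x a y b D : R) : 0 <= a -> 0 <= b ->
  (forall s t, x <= s <= x + a -> y <= t <= y + b -> closed_form_at P Q s t) ->
  D <= `|circulation P Q x a y b| ->
  exists x' y', [/\ x <= x' <= x + a / 2, y <= y' <= y + b / 2 &
    D / 4 <= `|circulation P Q x' (a / 2) y' (b / 2)|].
Proof.
move=> a0 b0 cl DC; apply: contrapT => nex.
have small x' y' : x <= x' <= x + a / 2 -> y <= y' <= y + b / 2 ->
    `|circulation P Q x' (a / 2) y' (b / 2)| < D / 4.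
  by move=> hx hy; rewrite ltNge; apply/negP => h; apply: nex; exists x', y'.
have aE : a = a / 2 + a / 2 by lra.
have bE : b = b / 2 + b / 2 by lra.
suff : `|circulation P Q x a y b| < D by rewrite ltNge DC.
have [a20 b20] : 0 <= a / 2 /\ 0 <= b / 2 by lra.
have -> : circulation P Q x a y b =
    circulation P Q x (a / 2) y (b / 2) + circulation P Q x (a / 2) (y + b / 2) (b / 2) +
    (circulation P Q (x + a / 2) (a / 2) y (b / 2) +
     circulation P Q (x + a / 2) (a / 2) (y + b / 2) (b / 2)).
  have cl1 s t : x <= s <= x + (a / 2 + a / 2) -> y <= t <= y + b ->
    closed_form_at P Q s t by rewrite -aE; exact: cl.
  have cl2 s t : x <= s <= x + a / 2 -> y <= t <= y + (b / 2 + b / 2) ->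
      closed_form_at P Q s t.
    by rewrite -bE => /andP[? ?] ht; apply: cl => //; apply/andP; lra.
  have cl3 s t : x + a / 2 <= s <= x + a / 2 + a / 2 ->
      y <= t <= y + (b / 2 + b / 2) -> closed_form_at P Q s t.
    by rewrite -bE => /andP[? ?] ht; apply: cl => //; apply/andP; lra.
  have := circulation_splitx a20 a20 b0 cl1; rewrite -aE => ->.
  have := circulation_splity a20 b20 b20 cl2; rewrite -bE => ->.
  by have := circulation_splity a20 b20 b20 cl3; rewrite -bE => ->.
have x0 : x <= x <= x + a / 2 by apply/andP; lra.
have x1 : x <= x + a / 2 <= x + a / 2 by apply/andP; lra.
have y0 : y <= y <= y + b / 2 by apply/andP; lra.
have y1 : y <= y + b / 2 <= y + b / 2 by apply/andP; lra.
have := small x y x0 y0; have := small x (y + b / 2) x0 y1.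
have := small (x + a / 2) y x1 y0; have := small (x + a / 2) (y + b / 2) x1 y1.
set c1 := circulation _ _ _ _ _ _; set c2 := circulation _ _ _ _ _ _.
set c3 := circulation _ _ _ _ _ _; set c4 := circulation _ _ _ _ _ _.
move=> h1 h2 h3 h4.
have k1 := ler_normD (c4 + c3) (c2 + c1); have k2 := ler_normD c4 c3.
have k3 := ler_normD c2 c1; lra.
Qed.

(** The supremum of the left end points lies in all the intervals. *)
Lemma nested_point (x : R^nat) (l : R^nat) :
  (forall n, x n <= x n.+1 /\ x n.+1 + l n.+1 <= x n + l n) -> (forall n, 0 <= l n) ->
  exists p, forall n, x n <= p <= x n + l n.
Proof.
move=> nest l0.
have up m n : x m <= x (m + n)%N.
  by elim: n => [|n]; rewrite ?addn0// addnS => /le_trans; apply; case: (nest (m + n)%N).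
have dn m n : x (m + n)%N + l (m + n)%N <= x m + l m.
  by elim: n => [|n]; rewrite ?addn0// addnS; apply: le_trans; case: (nest (m + n)%N).
have ub m n : x n <= x m + l m.
  have [mn|/ltnW nm] := leqP m n.
    by apply: (le_trans _ (dn m (n - m)%N)); rewrite subnKC// lerDl.
  by rewrite (@le_trans _ _ (x m))//; [rewrite -(subnKC nm)|rewrite lerDl].
have hs : has_sup (range x).
  by split; [exists (x 0%N); exists 0%N|exists (x 0%N + l 0%N) => _ [n _ <-]; exact: ub].
exists (sup (range x)) => n; apply/andP; split.
  by apply: sup_upper_bound => //; exists n.
by apply: ge_sup; [case: hs|move=> _ [k _ <-]; exact: ub].
Qed.

(** Repeated bisection yields nested rectangles of sides a / 2^n and b / 2^n whose
    circulation is at least D / 4^n in absolute value, where D belongs to the whole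
    rectangle. At their common point the form is closed, and [circulation_bound]
    makes the circulation at most 2 e (a + b)^2 / 4^n for every e > 0 and n large.
    Hence D = 0. *)
Lemma goursat P Q (x0 a y0 b : R) : 0 <= a -> 0 <= b ->
  (forall s t, x0 <= s <= x0 + a -> y0 <= t <= y0 + b -> closed_form_at P Q s t) ->
  circulation P Q x0 a y0 b = 0.
Proof.
move=> a0 b0 cl; pose D := `|circulation P Q x0 a y0 b|.
pose la n := a / 2 ^+ n; pose lb n := b / 2 ^+ n.
have laS n : la n.+1 = la n / 2 by rewrite /la exprS; field; rewrite expf_neq0.
have lbS n : lb n.+1 = lb n / 2 by rewrite /lb exprS; field; rewrite expf_neq0.
have la0 n : 0 <= la n by rewrite divr_ge0// exprn_ge0.
have lb0 n : 0 <= lb n by rewrite divr_ge0// exprn_ge0.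
pose sub n (p : R * R) := [/\ x0 <= p.1, p.1 + la n <= x0 + a, y0 <= p.2 &
  p.2 + lb n <= y0 + b].
pose Inv n (p : R * R) := sub n p /\ D / 4 ^+ n <= `|circulation P Q p.1 (la n) p.2 (lb n)|.
pose nxt n (p q : R * R) := [/\ Inv n.+1 q, p.1 <= q.1, q.1 + la n.+1 <= p.1 + la n,
  p.2 <= q.2 & q.2 + lb n.+1 <= p.2 + lb n].
have step (np : nat * (R * R)) : exists q, Inv np.1 np.2 -> nxt np.1 np.2 q.
  case: np => n [x y] /=.
  have [[]|] := pselect (Inv n (x, y)); last by move=> ?; exists (0, 0).
  move=> [/= h1 h2 h3 h4] hD.
  have [|x' [y' [/andP[x1 x2] /andP[y1 y2] h]]] := circulation_quarter (la0 n) (lb0 n) _ hD.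
    by move=> s t /andP[? ?] /andP[? ?]; apply: cl; apply/andP; lra.
  exists (x', y') => _; rewrite /nxt /Inv /sub/= laS lbS.
  split; [split|..]; [split|..]; [lra..| |lra|lra|lra|lra].
  by move: h; rewrite exprS invfM; congr (_ <= _); field; rewrite expf_neq0.
have [g gP] := choice step.
pose u := fix u n := if n is m.+1 then g (m, u m) else (x0, y0).
have uInv n : Inv n (u n).
  elim: n => [|n IH]; last by have [] := gP (n, u n) IH.
  by rewrite /Inv /sub/= /la /lb expr0 !divr1 !lexx; split.
have uS n : nxt n (u n) (u n.+1) by exact: (gP (n, u n) (uInv n)).
have [p pP] : exists p, forall n, (u n).1 <= p <= (u n).1 + la n.
  by apply: nested_point => // n; case: (uS n).
have [q qP] : exists q, forall n, (u n).2 <= q <= (u n).2 + lb n.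
  by apply: nested_point => // n; case: (uS n).
have clp : closed_form_at P Q p q.
  have := qP 0%N; have := pP 0%N; rewrite /la /lb /= expr0 !divr1; exact: cl.
suff De e : 0 < e -> D <= 2 * e * (a + b) ^+ 2.
  apply/eqP; rewrite -normr_le0 -/D; apply/ler_addgt0Pr => e e0; rewrite add0r.
  pose c := 2 * (a + b) ^+ 2 + 1.
  have c0 : 0 < c by rewrite ltr_wpDl// mulr_ge0// sqr_ge0.
  have := De (e / c) (divr_gt0 e0 c0); move/le_trans; apply.
  rewrite -{2}[e](divfK (lt0r_neq0 c0)) -mulrA mulrCA ler_wpM2l ?divr_ge0// ?ltW//.
  by rewrite /c mulrC; lra.
case: clp => A [B [C H]] e0; have [d d0 Hd] := H e e0.
have [n [an bn]] : exists n, la n < d /\ lb n < d.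
  exists (Num.bound ((a + b) / d)).
  have h : (a + b) / 2 ^+ Num.bound ((a + b) / d) < d.
    rewrite ltr_pdivrMr ?exprn_gt0// -ltr_pdivrMl// mulrC.
    apply: (lt_trans (archi_boundP _)); first by rewrite divr_ge0 ?addr_ge0// ltW.
    by rewrite -natrX ltr_nat ltn_expl.
  split; apply: le_lt_trans h; rewrite ler_wpM2r ?invr_ge0 ?exprn_ge0//; lra.
have [[h1 h2 h3 h4] hD] := uInv n.
have := circulation_bound (la0 n) (lb0 n) (ltW e0) _ (pP n) (qP n) an bn.
move=> /(_ P Q A); rewrite -/(D / 4 ^+ n).
move=> hb.
have : D / 4 ^+ n <= 2 * e * (la n + lb n) ^+ 2.
  apply: (le_trans hD); apply: hb; last by exists B, C.
  by move=> s t /andP[? ?] /andP[? ?]; apply: cl; apply/andP; lra.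
have -> : 2 * e * (la n + lb n) ^+ 2 = (2 * e * (a + b) ^+ 2) / 4 ^+ n.
  rewrite -mulrDl expr_div_n mulrA -exprM mulnC exprM.
  by have -> : (2 ^+ 2 : R) = 4 by ring.
by rewrite ler_pM2r// invr_gt0 exprn_gt0.
Qed.

End Goursat.

(** * Complex differentiability and the exponential *)

Section ComplexDiff.
Context {R : realType}.
Notation C := R[i].
Implicit Types (z w : C) (G : C -> C).
Import Normc.

Lemma normCE z : `|z| = (normc z)%:C.
Proof. by []. Qed.

Lemma normc_ge0 z : 0 <= normc z.
Proof. by case: z => a b; exact: sqrtr_ge0. Qed.

Lemma normcD z w : normc (z + w) <= normc z + normc w.
Proof. by have := ler_normD z w; rewrite !normCE -rmorphD lecR. Qed.

Lemma gt0_real_complex (e : C) : 0 < e -> exists2 r : R, 0 < r & e = r%:C.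
Proof.
by case: e => a b; rewrite ltcE/= => /andP[/eqP -> a0]; exists a.
Qed.

Lemma normc_real (r : R) : normc r%:C = `|r|.
Proof. by rewrite /= expr0n/= addr0 sqrtr_sqr. Qed.

(** The norm of the complex field takes its values in the complex numbers; this
    and [differentiableC_P] return to estimates between real numbers. *)
Lemma nearC_P (P : C -> Prop) z :
  (\forall w \near z, P w) <-> exists2 d : R, 0 < d & forall w, normc (w - z) < d -> P w.
Proof.
split=> [/nbhs_ballP[_ /gt0_real_complex[d d0 ->]] zP|[d d0 zP]].
  exists d => // w wz; apply: zP; rewrite /ball/= distrC normCE ltcR//.
apply/nbhs_ballP; exists d%:C; first by rewrite /= ltcR.
by move=> w; rewrite /ball/= distrC normCE ltcR; exact: zP.
Qed.

Lemma normcB z w : normc (z - w) = normc (w - z).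
Proof. by apply: complexI; rewrite -!normCE distrC. Qed.

Lemma normc_gt0 z : (0 < normc z) = (z != 0).
Proof. by rewrite -ltcR -normCE normr_gt0. Qed.

Lemma normc_quotient (h X L : C) : h != 0 ->
  normc (L - h^-1 *: X) * normc h = normc (X - L * h).
Proof.
move=> h0; rewrite -normcM normcB mulrBl -[h^-1 *: X]/(h^-1 * X).
by rewrite [h^-1 * X]mulrC divfK// normcB.
Qed.

Lemma differentiableC_P G z : differentiable G z <->
  exists L, forall e : R, 0 < e -> exists2 d : R, 0 < d & forall w, normc (w - z) < d ->
    normc (G w - G z - L * (w - z)) <= e * normc (w - z).
Proof.
rewrite -derivable1_diffP /derivable; split.
  move=> /cvg_ex[L /cvgrPdist_le HL]; exists L => e e0.
  have /HL : 0 < e%:C by rewrite ltcR.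
  move=> /nearC_P[d d0 H]; exists d => // w wd.
  have [->|wz] := eqVneq w z; first by rewrite !subrr mulr0 subr0 normc0 mulr0.
  have wz0 : w - z != 0 by rewrite subr_eq0.
  have := H (w - z); rewrite subr0 => /(_ wd wz0).
  rewrite /= -[(w - z) *: 1]/((w - z) * 1) mulr1 subrK normCE lecR => h.
  by rewrite -normc_quotient// ler_pM2r// normc_gt0.
move=> [L HL]; apply/cvg_ex; exists L; apply/cvgrPdist_le => _ /gt0_real_complex[e e0 ->].
have [d d0 H] := HL e e0; apply/nearC_P; exists d => // h; rewrite subr0 => hd h0.
have := H (h + z); rewrite addrK => /(_ hd).
rewrite normCE lecR /= -[h *: 1]/(h * 1) mulr1.
by rewrite -normc_quotient// ler_pM2r// normc_gt0.
Qed.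

Lemma Re_le_normc z : `|complex.Re z| <= normc z.
Proof.
case: z => a b /=; rewrite -sqrtr_sqr ler_sqrt ?addr_ge0 ?sqr_ge0//.
by rewrite lerDl sqr_ge0.
Qed.

Lemma Im_le_normc z : `|complex.Im z| <= normc z.
Proof.
case: z => a b /=; rewrite -sqrtr_sqr ler_sqrt ?addr_ge0 ?sqr_ge0//.
by rewrite lerDr sqr_ge0.
Qed.

Lemma normc_le z : normc z <= `|complex.Re z| + `|complex.Im z|.
Proof.
case: z => a b /=; rewrite -[leRHS]ger0_norm ?addr_ge0// -sqrtr_sqr.
rewrite ler_wsqrtr// sqrrD !real_normK ?num_real// addrAC lerDl.
by rewrite mulrn_wge0// mulr_ge0.
Qed.

Lemma is_derive_eps (f : R -> R) (x df : R) : is_derive x 1 f df ->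
  forall e, 0 < e -> exists2 d, 0 < d &
    forall y, `|y - x| < d -> `|f y - f x - df * (y - x)| <= e * `|y - x|.
Proof.
move=> [dfx dfE] e e0.
move: dfx => /cvg_ex[/= l fl].
have lE : l = df by rewrite -dfE; apply/esym/cvg_lim.
move: fl => /cvgrPdist_le/(_ _ e0)/nbhs_ballP[d /= d0 H].
exists d => // y yd; have [->|yx] := eqVneq y x.
  by rewrite !subrr mulr0 subr0 normr0 mulr0.
have yx0 : y - x != 0 by rewrite subr_eq0.
have := H (y - x); rewrite /ball/= sub0r normrN => /(_ yd yx0).
rewrite -[(y - x) *: 1]/((y - x) * 1) mulr1 subrK lE => h.
have -> : f y - f x - df * (y - x) = - ((df - (y - x)^-1 * (f y - f x)) * (y - x)).
  by field.
by rewrite normrN normrM ler_wpM2r.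
Qed.

Lemma cexpD z w : cexp (z + w) = cexp z * cexp w.
Proof.
case: z w => [a b] [c d]; rewrite /cexp /= expRD cosD sinD.
by simpc; congr (_ +i* _); ring.
Qed.

(** The derivative of the exponential at 0, from those of exp, cos and sin. *)
Lemma cexp_near0 (e : R) : 0 < e -> exists2 d : R, 0 < d & forall h : C, normc h < d ->
  normc (cexp h - 1 - h) <= e * normc h.
Proof.
(* 9 = 1 + 3 + 4 + 1, for the four remainders estimated below. *)
move=> e0; have [t [t0 t1 te]] : exists t : R, [/\ 0 < t, t <= 1 & 9 * t <= e].
  exists (Num.min 1 (e / 9)); split; first by rewrite lt_min ltr01 divr_gt0.
    by rewrite ge_min lexx.
  by rewrite mulrC -ler_pdivlMr// ge_min lexx orbT.
have [d1 d10 H1] := is_derive_eps (is_derive_expR 0) t0.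
have [d2 d20 H2] := is_derive_eps (is_derive_cos 0) t0.
have [d3 d30 H3] := is_derive_eps (is_derive_sin 0) t0.
exists (Num.min (Num.min d1 d2) (Num.min d3 t)).
  by rewrite !lt_min d10 d20 d30 t0.
move=> [x y]; set n := normc _; rewrite !lt_min => /andP[/andP[nd1 nd2] /andP[nd3 nt]].
have xn : `|x| <= n := Re_le_normc (x +i* y).
have yn : `|y| <= n := Im_le_normc (x +i* y).
have := H1 x; rewrite subr0 expR0 mul1r => /(_ (le_lt_trans xn nd1)) k1.
have := H2 y; rewrite subr0 sin0 cos0 oppr0 mul0r subr0 => /(_ (le_lt_trans yn nd2)) k2.
have := H3 y; rewrite subr0 sin0 cos0 subr0 mul1r => /(_ (le_lt_trans yn nd3)) k3.
have n0 : 0 <= n := normc_ge0 _.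
have tx : t * `|x| <= t * n by rewrite ler_wpM2l// ltW.
have ty : t * `|y| <= t * n by rewrite ler_wpM2l// ltW.
have tn : t * n <= n by rewrite -[leRHS]mul1r ler_wpM2r.
have ex1 : `|expR x - 1| <= 2 * n.
  rewrite -[_ - 1](subrK x); apply: (le_trans (ler_normD _ _)); lra.
have ex3 : `|expR x| <= 3.
  rewrite -[expR x](subrK 1); apply: (le_trans (ler_normD _ _)); rewrite normr1; lra.
have sy : `|sin y| <= 2 * n.
  rewrite -[sin y](subrK y); apply: (le_trans (ler_normD _ _)); lra.
apply: (le_trans (normc_le _)).
rewrite -[complex.Re _]/(expR x * cos y - 0 * sin y - 1 - x).
rewrite -[complex.Im _]/(expR x * sin y + 0 * cos y - 0 - y).
rewrite !mul0r addr0 !subr0.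
have -> : expR x * cos y - 1 - x = (expR x - 1 - x) + expR x * (cos y - 1) by ring.
have -> : expR x * sin y - y = (expR x - 1) * sin y + (sin y - y) by ring.
have m1 : `|expR x * (cos y - 1)| <= 3 * (t * n).
  by rewrite normrM ler_pM// (le_trans k2).
have m2 : `|(expR x - 1) * sin y| <= 4 * (t * n).
  rewrite normrM (le_trans (ler_pM _ _ ex1 sy))//.
  have : n * n <= t * n by rewrite ler_wpM2r// ltW.
  by lra.
have := ler_normD (expR x - 1 - x) (expR x * (cos y - 1)).
have := ler_normD ((expR x - 1) * sin y) (sin y - y).
have : 9 * t * n <= e * n by rewrite ler_wpM2r.
lra.
Qed.

Lemma differentiable_cexp z : differentiable (@cexp R) z.
Proof.
apply/differentiableC_P; exists (cexp z) => e e0.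
have c0 : 0 < normc (cexp z) + 1 by rewrite ltr_wpDl ?normc_ge0.
have [d d0 H] := cexp_near0 (divr_gt0 e0 c0).
exists d => // w /H {}H.
have -> : cexp w = cexp z * cexp (w - z) by rewrite -cexpD addrC subrK.
have -> : cexp z * cexp (w - z) - cexp z - cexp z * (w - z) =
  cexp z * (cexp (w - z) - 1 - (w - z)) by ring.
rewrite normcM; apply: (le_trans (ler_wpM2l (normc_ge0 _) H)).
rewrite mulrA ler_wpM2r ?normc_ge0// mulrCA ger_pMr// ler_pdivrMr// mul1r.
by rewrite lerDl.
Qed.

(** One of the two Cauchy-Riemann equations is the closedness of
    Im G dx + Re G dy = Im (G dz). *)
Lemma differentiable_closed_form G (p q : R) : differentiable G (p +i* q) ->
  closed_form_at (fun x y => complex.Re (G (x +i* y))) (fun x y => complex.Im (G (x +i* y))) p q.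
Proof.
move/differentiableC_P => [[A B] H]; exists A, (- B), B => e e0.
have [d d0 Hd] := H e e0; exists (d / 2) => [|x y xp yq]; first by rewrite divr_gt0.
have nle : normc ((x +i* y) - (p +i* q)) <= `|x - p| + `|y - q| by exact: normc_le.
have /Hd h : normc ((x +i* y) - (p +i* q)) < d by apply: (le_lt_trans nle); lra.
have {}h := le_trans h (ler_wpM2l (ltW e0) nle).
split.
  apply: le_trans h; rewrite (le_trans _ (Re_le_normc _))//.
  move: (G _) (G _) => [a b] [c c'] /=.
  by rewrite le_eqVlt; apply/orP; left; apply/eqP; congr `|_|; ring.
apply: le_trans h; rewrite (le_trans _ (Im_le_normc _))//.
move: (G _) (G _) => [a b] [c c'] /=.
by rewrite le_eqVlt; apply/orP; left; apply/eqP; congr `|_|; ring.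
Qed.

End ComplexDiff.

(** * The mean value property on the unit circle *)

Section MeanValue.
Context {R : realType}.
Notation C := R[i].
Implicit Types (z w : C) (G : C -> C).
Import Normc.

Lemma normc_sqr z : normc z ^+ 2 = complex.Re z ^+ 2 + complex.Im z ^+ 2.
Proof. by case: z => a b /=; rewrite sqr_sqrtr// addr_ge0 ?sqr_ge0. Qed.

Definition cis (t : R) : C := cexp (0 +i* t).

Lemma cisE t : cis t = cos t +i* sin t.
Proof. by rewrite /cis /cexp /= expR0 mul1r. Qed.

Lemma normc_cexp z : normc (cexp z) = expR (complex.Re z).
Proof.
rewrite /cexp normcM normc_real ger0_norm ?expR_ge0//=.
by rewrite cos2Dsin2 sqrtr1 mulr1.
Qed.

Lemma normc_cis t : normc (cis t) = 1.
Proof. by rewrite normc_cexp expR0. Qed.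

Lemma cisD s t : cis (s + t) = cis s * cis t.
Proof. by rewrite /cis -cexpD; congr cexp; simpc. Qed.

Lemma cis2pi : cis (2 * pi) = 1.
Proof. by rewrite cisE mulr_natl cos2pi sin2pi. Qed.

(** In the coordinate w with z = exp w the circles |z| = exp s become the vertical
    segments of length 2 pi over s. By Goursat's theorem on [s, 0] x [0, 2 pi],
    where the two horizontal sides cancel by periodicity, the mean of G over a
    circle is the same for all s <= 0, and it tends to G 0 as s decreases. *)
Lemma mean_value G : (forall z, normc z <= 1 -> differentiable G z) ->
  2 * pi * complex.Re (G 0) = ivl 0 (2 * pi) (fun t => complex.Re (G (cis t))).
Proof.
move=> dG; have pi0 : 0 <= 2 * pi :> R by rewrite mulr_ge0// pi_ge0.
pose F z := G (cexp z).
have cl (s t : R) : s <= 0 -> closed_form_at (fun x y => complex.Re (F (x +i* y)))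
    (fun x y => complex.Im (F (x +i* y))) s t.
  move=> s0; apply: differentiable_closed_form; apply: differentiable_comp.
    exact: differentiable_cexp.
  by apply: dG; rewrite normc_cexp/= -expR0 ler_expR.
have per s : F (s +i* (2 * pi)) = F (s +i* 0).
  rewrite /F; congr G.
  have -> : s +i* (2 * pi) = (s +i* 0) + (0 +i* (2 * pi)) :> C by simpc.
  by rewrite cexpD -[cexp (0 +i* _)]/(cis _) cis2pi mulr1.
have cP (s t : R) : s <= 0 -> {for t, continuous (fun t => complex.Re (F (s +i* t)))}.
  by move=> s0; have [] := closed_form_cont (cl s t s0).
have inv (s : R) : s <= 0 -> ivl 0 (2 * pi) (fun t => complex.Re (F (0 +i* t))) =
    ivl 0 (2 * pi) (fun t => complex.Re (F (s +i* t))).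
  move=> s0; have Ns0 : 0 <= - s by rewrite oppr_ge0.
  have := @goursat R (fun x y => complex.Re (F (x +i* y)))
    (fun x y => complex.Im (F (x +i* y))) s (- s) 0 (2 * pi) Ns0 pi0.
  rewrite /circulation addrN add0r.
  have -> : (fun s : R => complex.Im (F (s +i* (2 * pi))) - complex.Im (F (s +i* 0))) = (fun=> 0).
    by apply/funext => x; rewrite per subrr.
  rewrite (ivl_cst 0 s0) mul0r subr0 ivlB => [h|t _|t _]; last 2 first.
  - exact: cP.
  - exact: cP.
  by apply/eqP; rewrite -subr_eq0; apply/eqP; apply: h => x y /andP[_ +] _; exact: cl.
rewrite [RHS](_ : _ = ivl 0 (2 * pi) (fun t => complex.Re (F (0 +i* t))))//.
apply/eqP; rewrite -subr_eq0 -normr_le0; apply/ler_addgt0Pr => e e0; rewrite add0r.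
have e'0 : 0 < e / (2 * pi) by rewrite divr_gt0// mulr_gt0// pi_gt0.
have /differentiable_continuous/cvgrPdist_lt/(_ (e / (2 * pi))%:C) : differentiable G 0.
  by apply: dG; rewrite normc0.
rewrite ltcR => /(_ e'0)/nearC_P[d d0 H].
pose s := Num.min 0 (ln (d / 2)).
have s0 : s <= 0 by rewrite ge_min lexx.
have sd : expR s < d.
  apply: (@le_lt_trans _ _ (d / 2)); last by lra.
  have d20 : 0 < d / 2 by lra.
  by rewrite -[leRHS]lnK// ler_expR ge_min lexx orbT.
rewrite (inv s s0) distrC [2 * pi * _]mulrC.
have := @ivl_near_cst R 0 (2 * pi) (fun t => complex.Re (F (s +i* t)))
  (complex.Re (G 0)) (e / (2 * pi)) pi0.
rewrite subr0 divfK//; last by rewrite mulf_neq0// ?pnatr_eq0// gt_eqF// pi_gt0.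
apply => [t _|t _]; first exact: cP.
have : normc (G 0 - F (s +i* t)) < e / (2 * pi).
  by rewrite -ltcR -normCE; apply: H; rewrite subr0 normc_cexp.
rewrite normcB => /ltW; apply: le_trans.
apply: le_trans (Re_le_normc _).
by move: (F _) (G 0) => [a b] [c c'].
Qed.

(** The mean value property of Re (c G), where c is the number of modulus 1 that
    turns G 0 into its modulus. *)
Lemma max_modulus_center G M : (forall z, normc z <= 1 -> differentiable G z) ->
  (forall t, 0 <= t <= 2 * pi -> normc (G (cis t)) <= M) -> normc (G 0) <= M.
Proof.
move=> dG GM; have pi0 : 0 < 2 * pi :> R by rewrite mulr_gt0// pi_gt0.
have [->|G0] := eqVneq (G 0) 0.
  by rewrite normc0 (le_trans (normc_ge0 _) (GM 0 _))// lexx ltW.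
pose c : C := conjc (G 0) / (normc (G 0))%:C.
have nG0 : 0 < normc (G 0) by rewrite normc_gt0.
have c1 : normc c = 1.
  rewrite normcM normcV normc_real ger0_norm ?normc_ge0//.
  suff -> : normc (conjc (G 0)) = normc (G 0) by rewrite mulfV// gt_eqF.
  by case: (G 0) => a b; rewrite /= sqrrN.
have cG0 : c * G 0 = (normc (G 0))%:C.
  rewrite /c mulrAC; apply: (canLR (mulfK _)); first by rewrite (inj_eq (@complexI R) _ 0) gt_eqF.
  rewrite -rmorphM/= -expr2 normc_sqr; case: (G 0) => a b.
  by simpc; congr (_ +i* _); rewrite /=; ring.
have dcG z : normc z <= 1 -> differentiable (fun z => c * G z) z.
  by move=> /dG d; apply: differentiableM => //; exact: differentiable_cst.
have := mean_value dcG; rewrite cG0 /= => mv.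
have : 2 * pi * normc (G 0) <= 2 * pi * M.
  rewrite mv; have := ivl_cst M (ltW pi0); rewrite subr0 [M * _]mulrC => <-.
  apply: le_ivl => [t _|t _|t].
  - have dF : differentiable (fun z => c * G (cexp z)) (0 +i* t).
      apply: differentiableM; first exact: differentiable_cst.
      apply: differentiable_comp; first exact: differentiable_cexp.
      by apply: dG; rewrite normc_cexp expR0.
    by have [] := closed_form_cont (differentiable_closed_form dF).
  - exact: cvg_cst.
  - rewrite in_itv/= => /GM; apply: le_trans.
    rewrite -[leRHS]mul1r -c1 -normcM (le_trans _ (Re_le_normc _))//.
    exact: ler_norm.
by rewrite ler_pM2l.
Qed.

End MeanValue.

(** * The sub-mean value property of log|G| *)

Section SubMean.
Context {R : realType}.
Notation C := R[i].
Implicit Types (z w : C) (G : C -> C) (u U : R -> R).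
Import Normc.

Lemma ivl_shift u (s T : R) : continuous u -> (forall t, u (t + T) = u t) ->
  0 <= s -> 0 <= T -> ivl s (s + T) u = ivl 0 T u.
Proof.
move=> cu per s0 T0.
have [W WE] := primitive_exists cu (-1).
have dW : forall x : R, 0 <= x -> is_derive x 1 W (u x) by move=> x x0; apply: WE; lra.
have ftc a b : 0 <= a -> a <= b -> ivl a b u = W b - W a.
  move=> a0 ab; apply: ivl_FTC => // x.
  by rewrite in_itv/= => /andP[ax _]; apply: dW; lra.
have shift : ivl 0 s u = W (s + T) - W (0 + T).
  pose f := W \o (fun x => x + T).
  apply: (@ivl_FTC _ _ _ _ f) => // x.
  rewrite in_itv/= => /andP[x0 _].
  have := @is_derive1_comp R W (shift T) x (u (x + T)) 1.
  rewrite mulr1 per; apply; last exact: is_derive_shift.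
  by rewrite /= -per; apply: dW; lra.
rewrite !ftc ?lerDl//.
by move: shift; rewrite ftc// add0r; lra.
Qed.

Lemma ivl_riemann u (t d : R) (N : nat) : continuous u -> 0 <= d ->
  ivl t (t + N%:R * d) u = \sum_(k < N) ivl (t + k%:R * d) (t + k%:R * d + d) u.
Proof.
move=> cu d0; elim: N => [|N IH].
  by rewrite big_ord0 mul0r addr0 /ivl set_itv1 Rintegral_set1.
have N0 : 0 <= N%:R * d by rewrite mulr_ge0.
have -> : t + N.+1%:R * d = t + N%:R * d + d by rewrite -natr1; ring.
rewrite big_ord_recr/= -IH; apply: ivl_split; [lra|lra|].
by move=> x _; exact: cu.
Qed.

(** A Riemann sum with N equal steps over a period beginning at t; by periodicity
    the choice of N is uniform in t. *)
Lemma riemann_sum_le u (T e : R) : continuous u -> (forall t, u (t + T) = u t) ->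
  0 < T -> 0 < e -> exists2 N : nat, (0 < N)%N & forall t, 0 <= t <= T ->
    \sum_(k < N) u (t + k%:R * (T / N%:R)) <= N%:R * (T^-1 * ivl 0 T u + e).
Proof.
move=> cu per T0 e0.
have [d d0 Hd] := @unif_cont_segment R 0 (2 * T) u e e0 (fun x _ => cu x).
exists (Num.bound (T / d)).+1 => // t /andP[t0 tT]; set N := _.+1.
have N0 : 0 < N%:R :> R by rewrite ltr0n.
have NT : N%:R * (T / N%:R) = T by rewrite mulrC divfK// gt_eqF.
have dN0 : 0 < T / N%:R by rewrite divr_gt0.
have dNd : T / N%:R < d.
  rewrite ltr_pdivrMr// mulrC -ltr_pdivrMr//.
  apply: (lt_le_trans (archi_boundP _)); first by rewrite divr_ge0// ltW.
  by rewrite ler_nat.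
have piece (k : 'I_N) : (u (t + k%:R * (T / N%:R)) - e) * (T / N%:R) <=
    ivl (t + k%:R * (T / N%:R)) (t + k%:R * (T / N%:R) + T / N%:R) u.
  set a := t + _; have aE : a + T / N%:R - a = T / N%:R by ring.
  have ka : k%:R * (T / N%:R) + T / N%:R <= T.
    have : k.+1%:R * (T / N%:R) <= N%:R * (T / N%:R).
      by apply: ler_wpM2r; [exact: ltW|rewrite ler_nat].
    by rewrite NT -natr1 mulrDl mul1r.
  have k0 : 0 <= k%:R * (T / N%:R) by rewrite mulr_ge0// ltW.
  have -> : (u a - e) * (T / N%:R) = ivl a (a + T / N%:R) (fun=> u a - e).
    by rewrite ivl_cst ?aE// lerDl ltW.
  apply: le_ivl => [x _|x _|x]; [exact: cvg_cst|exact: cu|].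
  rewrite in_itv/= => /andP[ax xa].
  have aT : 0 <= a <= 2 * T by rewrite /a; apply/andP; split; lra.
  have xad : `|x - a| < d by rewrite ger0_norm; lra.
  by have := Hd a x aT xad; rewrite ler_norml => /andP[]; lra.
have := ivl_riemann t N cu (ltW dN0); rewrite NT.
rewrite (ivl_shift cu per t0 (ltW T0)) => ivE.
have : \sum_(k < N) (u (t + k%:R * (T / N%:R)) - e) * (T / N%:R) <= ivl 0 T u.
  by rewrite ivE; exact: ler_sum.
rewrite -mulr_suml sumrB sumr_const card_ord -[e *+ _]mulr_natl.
set S := \sum_(_ < _) _ => h.
have NT0 : 0 < N%:R / T by rewrite divr_gt0.
have := ler_wpM2r (ltW NT0) h; rewrite -mulrA.
have -> : T / N%:R * (N%:R / T) = 1 by field; rewrite !gt_eqF.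
rewrite mulr1 lerBlDr => /le_trans; apply.
by rewrite mulrDr lerD2r mulrA mulrC.
Qed.

Lemma differentiable_prodC (N : nat) (F : nat -> C -> C) z :
  (forall k, differentiable (F k) z) ->
  differentiable (fun w => \prod_(k < N) F k w) z.
Proof.
move=> dF; elim: N => [|N IH].
  rewrite (_ : (fun _ => _) = cst 1); first exact: differentiable_cst.
  by apply/funext => w; rewrite big_ord0.
rewrite (_ : (fun _ => _) = (fun w => (\prod_(k < N) F k w) * F N w)).
  exact: differentiableM.
by apply/funext => w; rewrite big_ord_recr.
Qed.

Lemma normc_prod (N : nat) (F : 'I_N -> C) :
  normc (\prod_(k < N) F k) = \prod_(k < N) normc (F k).
Proof.
exact: (big_morph _ (@normcM R) (@normc1 R)).
Qed.

(** The product of G over N equidistant rotations of its argument is G(0)^N at the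
    centre, and on the circle its modulus is at most the exponential of a Riemann
    sum of u, that is of N times (mean of u + e). The maximum principle and an N-th
    root give the claim up to e. Only products of values of G occur, so that the
    argument is the same when G has zeros. *)
Lemma sub_mean G u : (forall z, normc z <= 1 -> differentiable G z) ->
  continuous u -> (forall t, u (t + 2 * pi) = u t) ->
  (forall t, normc (G (cis t)) <= expR (u t)) ->
  normc (G 0) <= expR ((2 * pi)^-1 * ivl 0 (2 * pi) u).
Proof.
move=> dG cu per Gu; have pi0 : 0 < 2 * pi :> R by rewrite mulr_gt0// pi_gt0.
set A := _ * _.
have [->|G0] := eqVneq (G 0) 0; first by rewrite normc0 expR_ge0.
have nG0 : 0 < normc (G 0) by rewrite normc_gt0.
rewrite -[leLHS]lnK// ler_expR; apply/ler_addgt0Pr => e e0.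
have [N N0 HN] := riemann_sum_le cu per pi0 e0.
rewrite -ler_expR lnK//.
pose a (k : nat) : R := k%:R * (2 * pi / N%:R).
(* A finite product stands in for the mean of log|G| over the rotations. *)
pose H z := \prod_(k < N) G (z * cis (a k)).
have HM : normc (H 0) <= expR (N%:R * (A + e)).
  apply: max_modulus_center => [z z1|t tT].
    apply: (@differentiable_prodC N (fun k z => G (z * cis (a k)))) => k.
    apply: (@differentiable_comp _ _ _ _ (fun z => z * cis (a k)) G).
      by apply: differentiableM => //; exact: differentiable_cst.
    by apply: dG; rewrite normcM normc_cis mulr1.
  rewrite /H normc_prod; apply: le_trans (_ : expR (\sum_(k < N) u (t + a k)) <= _).
    rewrite expR_sum; apply: ler_prod => k _; rewrite normc_ge0/=.
    by rewrite -cisD Gu.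
  by rewrite ler_expR; exact: HN.
move: HM; rewrite /H; under eq_bigr do rewrite mul0r.
rewrite normc_prod big_const card_ord iter_mulr_1 expRM_natl.
by rewrite ler_pXn2r// nnegrE ?normc_ge0// expR_ge0.
Qed.

End SubMean.

(** * Continuity of log+|f| *)

Section ContinuityC.
Context {R : realType}.
Notation C := R[i].
Import Normc.

Lemma cvg_Complex {T : Type} (F : set_system T) (FF : Filter F) (f g : T -> R) (a b : R) :
  f @ F --> a -> g @ F --> b -> (fun t => f t +i* g t) @ F --> (a +i* b : C).
Proof.
move=> fa gb; apply/cvgrPdist_lt => _ /gt0_real_complex[e e0 ->].
have e20 : 0 < e / 2 by rewrite divr_gt0.
near=> t; rewrite normCE ltcR; apply: (le_lt_trans (normc_le _)) => /=.
have : `|a - f t| < e / 2 by near: t; move/cvgrPdist_lt : fa; apply.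
have : `|b - g t| < e / 2 by near: t; move/cvgrPdist_lt : gb; apply.
lra.
Unshelve. all: by end_near. Qed.

Lemma continuous_normc : continuous (@normc R : C -> R).
Proof.
move=> z; apply/(@cvgrPdist_lt _ _ _ _ (nbhs_filter z)) => e e0; apply/nearC_P; exists e => // w wz.
apply: le_lt_trans wz; rewrite normcB.
have := normcD (z - w) w; have := normcD (w - z) z; rewrite !subrK normcB => h1 h2.
by rewrite ler_norml; apply/andP; split; rewrite normcB in h1 h2 *; lra.
Qed.

Lemma continuous_Re : continuous (@complex.Re R : C -> R).
Proof.
move=> z; apply/(@cvgrPdist_lt _ _ _ _ (nbhs_filter z)) => e e0; apply/nearC_P; exists e => // w wz.
apply: le_lt_trans wz; rewrite normcB; apply: le_trans (Re_le_normc _).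
by case: z w => [a b] [c d].
Qed.

Lemma continuous_cis : continuous (@cis R).
Proof.
move=> t; rewrite (_ : @cis R = fun t => cos t +i* sin t); last first.
  by apply/funext => s; exact: cisE.
by apply: cvg_Complex; [exact: continuous_cos|exact: continuous_sin].
Qed.

Lemma logpE (x : R) : logp x = ln (Num.max 1 x).
Proof.
rewrite /logp; have [x1|x1] := leP x 1.
  by rewrite ln1; apply/max_idPl; exact: ln_le0.
by apply/max_idPr; exact/ltW/ln_gt0.
Qed.

Lemma continuous_logp : continuous (@logp R).
Proof.
move=> x; rewrite (_ : @logp R = @ln R \o (fun x => Num.max 1 x)); last first.
  by apply/funext => y; exact: logpE.
apply: continuous_comp; last by apply: continuous_ln; rewrite lt_max ltr01.
by apply: (@continuous_max R R (cst 1) id) => //; exact: cvg_cst.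
Qed.

Lemma logp_ge0 (x : R) : 0 <= logp x.
Proof. by rewrite /logp le_max lexx. Qed.

Lemma le_expR_logp (x : R) : x <= expR (logp x).
Proof.
by rewrite logpE lnK ?posrE ?lt_max ?ltr01// le_max lexx orbT.
Qed.

Lemma logp_le (x y : R) : 0 <= y -> x <= expR y -> logp x <= y.
Proof.
move=> y0 xy; rewrite logpE -ler_expR lnK ?posrE ?lt_max ?ltr01//.
by rewrite ge_max xy andbT -expR0 ler_expR.
Qed.

Lemma cvg_logp_normc {T : Type} (F : set_system T) (FF : Filter F) (f : T -> C) (a : C) :
  f @ F --> a -> (fun t => logp (normc (f t))) @ F --> logp (normc a).
Proof.
move=> fa; apply: (@continuous_cvg T C R F FF f (@logp R \o @normc R) a) fa.
by apply: continuous_comp; [exact: continuous_normc|exact: continuous_logp].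
Qed.

End ContinuityC.

(** * The Poisson inequality *)

Section Poisson.
Context {R : realType}.
Notation C := R[i].
Implicit Types (z w b : C) (G : C -> C) (u U : R -> R).
Import Normc.

(** The automorphism of the unit disc that sends 0 to b. *)
Definition mobius b z : C := (z + b) / (1 + conjc b * z).

Lemma normcN z : normc (- z) = normc z.
Proof. by case: z => x y /=; rewrite !sqrrN. Qed.

Lemma normc_conj z : normc (conjc z) = normc z.
Proof. by case: z => x y /=; rewrite sqrrN. Qed.

Lemma mobius_den b z : normc b < 1 -> normc z <= 1 -> 1 + conjc b * z != 0.
Proof.
move=> b1 z1; rewrite addr_eq0; apply/eqP => h.
have := congr1 (@normc R) h; rewrite normc1 normcN normcM normc_conj.
move=> /esym/eqP; rewrite lt_eqF//.
by apply: le_lt_trans b1; rewrite -[leRHS]mulr1 ler_wpM2l// normc_ge0.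
Qed.

Lemma normc_mobius b z : normc b < 1 -> normc z <= 1 -> normc (mobius b z) <= 1.
Proof.
move=> b1 z1; have d0 := mobius_den b1 z1.
rewrite /mobius normcM normcV ler_pdivrMr ?normc_gt0// mul1r.
rewrite -ler_sqr ?nnegrE ?normc_ge0//.
have hb : normc b ^+ 2 <= 1 by rewrite expr_le1 ?normc_ge0 ?ltW.
have hz : normc z ^+ 2 <= 1 by rewrite expr_le1 ?normc_ge0.
(* This product is |1 + conj b z|^2 - |z + b|^2. *)
have : 0 <= (1 - normc b ^+ 2) * (1 - normc z ^+ 2) by rewrite mulr_ge0 ?subr_ge0.
rewrite !normc_sqr; case: z {z1 d0 hz} => x y; case: b {b1 hb} => p q /=; nra.
Qed.

Lemma differentiable_mobius b z : normc b < 1 -> normc z <= 1 ->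
  differentiable (mobius b) z.
Proof.
move=> b1 z1; apply: differentiableM; first by apply: differentiableD.
apply: differentiableV; last exact: mobius_den.
by apply: differentiableD => //; apply: differentiableM => //; exact: differentiable_cst.
Qed.

(** 1 + conj b * cis t = poissX b t - i * poissY b t. *)
Definition poissX b (t : R) := 1 + complex.Re b * cos t + complex.Im b * sin t.
Definition poissY b (t : R) := complex.Im b * cos t - complex.Re b * sin t.
(** A lift of the argument of [mobius b (cis t)]: this number is
    cis t * (X + i Y) / (X - i Y) with X = poissX b t > 0 and Y = poissY b t, and the
    argument of the quotient is 2 atan (Y / X). The summand 2 pi makes the lift
    positive for t >= 0. *)
Definition poiss_arg b (t : R) := t + 2 * pi + 2 * atan (poissY b t / poissX b t).
Definition poissD b t := poissX b t ^+ 2 + poissY b t ^+ 2.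

(** The point X - i Y lies on the circle of radius |b| around 1. *)
Lemma poiss_disk b t : (poissX b t - 1) ^+ 2 + poissY b t ^+ 2 = normc b ^+ 2.
Proof.
rewrite normc_sqr /poissX /poissY.
have := cos2Dsin2 t; nra.
Qed.

Lemma poissX_gt0 b t : normc b < 1 -> 0 < poissX b t.
Proof.
move=> b1; have := poiss_disk b t => h.
have : `|poissX b t - 1| <= normc b.
  rewrite -ler_sqr ?nnegrE ?normc_ge0// real_normK ?num_real// -h.
  by rewrite lerDl sqr_ge0.
rewrite ler_norml => /andP[]; lra.
Qed.

Lemma poissD_le b t : normc b < 1 -> poissD b t <= (1 + normc b) ^+ 2.
Proof.
move=> b1; have h := poiss_disk b t.
have : `|poissX b t - 1| <= normc b.
  rewrite -ler_sqr ?nnegrE ?normc_ge0// real_normK ?num_real// -h.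
  by rewrite lerDl sqr_ge0.
rewrite ler_norml => /andP[_]; rewrite /poissD; nra.
Qed.

Lemma mobius_cis b t : normc b < 1 -> mobius b (cis t) = cis (poiss_arg b t).
Proof.
move=> b1; have X0 := poissX_gt0 t b1.
set X := poissX b t in X0; set Y := poissY b t.
have -> : cis (poiss_arg b t) = cis t * (cis (atan (Y / X)) * cis (atan (Y / X))).
  rewrite /poiss_arg cisD [cis (t + _)]cisD cis2pi mulr1; congr (_ * _).
  by rewrite -cisD; congr cis; rewrite -/X -/Y; ring.
have D0 : 0 < X ^+ 2 + Y ^+ 2 by rewrite ltr_wpDr ?sqr_ge0// exprn_gt0.
have -> : cis (atan (Y / X)) * cis (atan (Y / X)) =
    ((X ^+ 2 - Y ^+ 2) / (X ^+ 2 + Y ^+ 2)) +i* (2 * X * Y / (X ^+ 2 + Y ^+ 2)).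
  set q := Y / X; have q1 : 0 < 1 + q ^+ 2 by rewrite ltr_pwDl// sqr_ge0.
  have sE : sin (atan q) = q * cos (atan q).
    have tq : sin (atan q) / cos (atan q) = q by exact: atanK.
    by apply: (canRL (divfK _)) tq; rewrite cos_atan invr_eq0 gt_eqF// sqrtr_gt0.
  have c2 : cos (atan q) ^+ 2 = (1 + q ^+ 2)^-1.
    by rewrite cos_atan exprVn sqr_sqrtr// ltW.
  have -> : cis (atan q) * cis (atan q) =
      ((1 - q ^+ 2) * cos (atan q) ^+ 2) +i* (2 * q * cos (atan q) ^+ 2).
    by rewrite cisE sE; simpc; congr (_ +i* _); ring.
  have q0 := q1; rewrite /q in q0.
  by rewrite c2 /q; congr (_ +i* _); field; rewrite ?gt_eqF//=.
rewrite /mobius; apply: (canLR (mulfK _)); first by apply: mobius_den => //; rewrite normc_cis.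
rewrite cisE.
have c2 := cos2Dsin2 t.
have -> : 1 + conjc b * (cos t +i* sin t) = X -i* Y.
  rewrite /X /Y /poissX /poissY; case: (b) => p q; rewrite -[1 : C]/(1 +i* 0).
  by simpc; congr (_ +i* _); rewrite /=; ring.
have -> : cos t +i* sin t + b = (cos t +i* sin t) * (X +i* Y).
  rewrite /X /Y /poissX /poissY; case: (b) => p q.
  simpc; rewrite /= -[p in LHS]mulr1 -[q in LHS]mulr1 -[in LHS]c2.
  by congr (_ +i* _); ring.
rewrite -[RHS]mulrA; congr (_ * _); move: X Y D0 {X0} => X Y D0.
by apply/eqP; rewrite eq_complex/=; apply/andP; split; apply/eqP; field; rewrite gt_eqF.
Qed.

(** The derivative is a Poisson kernel, which is how the change of variable on the
    circle turns mean values at 0 into mean values at b. *)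
Lemma is_derive_poiss_arg b (t : R) : normc b < 1 ->
  is_derive t 1 (poiss_arg b) ((1 - normc b ^+ 2) / poissD b t).
Proof.
move=> b1; have X0 := poissX_gt0 t b1.
have dX : is_derive t 1 (poissX b) (poissY b t).
  rewrite /poissX /poissY; apply: is_derive_eq.
  by rewrite /GRing.scale/=; ring.
have dY : is_derive t 1 (poissY b) (1 - poissX b t).
  rewrite /poissX /poissY; apply: is_derive_eq.
  by rewrite /GRing.scale/=; ring.
have D0 : 0 < poissD b t by rewrite ltr_wpDr ?sqr_ge0// exprn_gt0.
have Xn0 : poissX b t != 0 by rewrite gt_eqF.
have dq : is_derive t 1 (fun t => poissY b t / poissX b t)
    (((1 - poissX b t) * poissX b t - poissY b t ^+ 2) / poissX b t ^+ 2).
  have dV := is_deriveV Xn0 dX.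
  have := @is_deriveM R R (poissY b) (fun y => (poissX b y)^-1) t 1 _ _ dY dV.
  by move/is_derive_eq; apply; rewrite /GRing.scale/=; field.
have dA := @is_derive1_comp R atan (fun t => poissY b t / poissX b t) t _ _
  (is_derive1_atan _) dq.
apply: is_derive_eq.
have := poiss_disk b t; rewrite /GRing.scale/= /poissD => <-.
field.
rewrite Xn0 gt_eqF//.
Qed.

Definition circ_avg U : R := (2 * pi)^-1 * ivl 0 (2 * pi) U.

(** The maximum over the unit circle of the Poisson kernel of the point b, and
    also of its reciprocal. *)
Definition harnack b : R := (1 + normc b) / (1 - normc b).

Lemma cos_per (t : R) : cos (t + 2 * pi) = cos t.
Proof. by rewrite cosD mulr_natl cos2pi sin2pi mulr1 mulr0 subr0. Qed.

Lemma sin_per (t : R) : sin (t + 2 * pi) = sin t.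
Proof. by rewrite sinD mulr_natl cos2pi sin2pi mulr1 mulr0 addr0. Qed.

Lemma poiss_arg_per b t : poiss_arg b (t + 2 * pi) = poiss_arg b t + 2 * pi.
Proof.
rewrite /poiss_arg /poissX /poissY cos_per sin_per; ring.
Qed.

Lemma poiss_arg_gt0 b t : 0 <= t -> 0 < poiss_arg b t.
Proof.
move=> t0; rewrite /poiss_arg; have := atan_gtNpi2 (poissY b t / poissX b t).
have := pi_gt0 R; lra.
Qed.

Lemma continuous_poiss_arg b : normc b < 1 -> continuous (poiss_arg b).
Proof.
move=> b1 t; apply: differentiable_continuous; apply/derivable1_diffP.
by have [] := is_derive_poiss_arg t b1.
Qed.

(** Substitution of [poiss_arg b], whose derivative is at least 1 / harnack b. *)
Lemma circ_avg_mobius b U : normc b < 1 -> continuous U ->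
  (forall t, U (t + 2 * pi) = U t) -> (forall t, 0 <= U t) ->
  circ_avg (U \o poiss_arg b) <= harnack b * circ_avg U.
Proof.
move=> b1 cU per U0; have pi0 : 0 < 2 * pi :> R by rewrite mulr_gt0// pi_gt0.
rewrite /circ_avg mulrCA ler_pM2l ?invr_gt0//.
have nb := normc_ge0 b.
have D0 t : 0 < poissD b t by rewrite ltr_wpDr ?sqr_ge0// exprn_gt0// poissX_gt0.
have [W WE] := primitive_exists cU (-1).
pose P t := (1 - normc b ^+ 2) / poissD b t.
have cP : continuous P.
  move=> t; apply: cvgM; first exact: cvg_cst.
  have cX : {for t, continuous (poissX b)}.
    apply: cvgD; last by apply: cvgM; [exact: cvg_cst|exact: continuous_sin].
    apply: cvgD; first exact: cvg_cst.
    by apply: cvgM; [exact: cvg_cst|exact: continuous_cos].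
  have cY : {for t, continuous (poissY b)}.
    by apply: cvgB; apply: cvgM;
      [exact: cvg_cst|exact: continuous_cos|exact: cvg_cst|exact: continuous_sin].
  apply: cvgV; first by rewrite gt_eqF.
  by apply: cvgD; rewrite expr2; apply: cvgM.
have cUp : continuous (U \o poiss_arg b).
  by move=> t; apply: continuous_comp; [exact: continuous_poiss_arg|exact: cU].
have cUpP : continuous (fun t => U (poiss_arg b t) * P t).
  by move=> t; apply: cvgM; [exact: cUp|exact: cP].
have -> : ivl 0 (2 * pi) U = ivl 0 (2 * pi) (fun t => U (poiss_arg b t) * P t).
  transitivity (W (poiss_arg b (2 * pi)) - W (poiss_arg b 0)).
    have g0 := poiss_arg_gt0 b (lexx 0).
    have -> : poiss_arg b (2 * pi) = poiss_arg b 0 + 2 * pi.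
      by rewrite -poiss_arg_per add0r.
    rewrite -(ivl_shift cU per (ltW g0) (ltW pi0)).
    apply: ivl_FTC => [|x _|x]; [lra|exact: cU|].
    by rewrite in_itv/= => /andP[gx _]; apply: WE; lra.
  apply/esym; apply: (@ivl_FTC _ _ _ _ (W \o poiss_arg b)); first exact: ltW.
    by move=> x _; exact: cUpP.
  move=> x; rewrite in_itv/= => /andP[x0 _].
  apply: is_derive1_comp; last exact: is_derive_poiss_arg.
  by apply: WE; have := poiss_arg_gt0 b x0; lra.
rewrite -ivlZ => [|t _]; last exact: cUpP.
apply: le_ivl => [t _|t _|t _]; first exact: cUp.
  by apply: cvgM; [exact: cvg_cst|exact: cUpP].
rewrite mulrCA /= ler_peMr//.
rewrite /harnack /P mulrA ler_pdivlMr// mul1r.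
apply: (le_trans (poissD_le t b1)); rewrite le_eqVlt; apply/orP; left; apply/eqP.
by field; rewrite gt_eqF// subr_gt0.
Qed.

(** [sub_mean] for the composition of G with the automorphism that sends 0 to b. *)
Lemma poisson_sub_mean G b U : normc b < 1 ->
  (forall z, normc z <= 1 -> differentiable G z) ->
  continuous U -> (forall t, U (t + 2 * pi) = U t) -> (forall t, 0 <= U t) ->
  (forall t, normc (G (cis t)) <= expR (U t)) ->
  normc (G b) <= expR (harnack b * circ_avg U).
Proof.
move=> b1 dG cU per U0 GU.
have -> : G b = (G \o mobius b) 0 by rewrite /= /mobius mulr0 addr0 add0r divr1.
have dGm z : normc z <= 1 -> differentiable (G \o mobius b) z.
  move=> z1; apply: differentiable_comp; first exact: differentiable_mobius.
  by apply: dG; exact: normc_mobius.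
apply: le_trans (_ : expR (circ_avg (U \o poiss_arg b)) <= _).
  apply: sub_mean => // t.
  - by apply: continuous_comp; [exact: continuous_poiss_arg|exact: cU].
  - by rewrite /= poiss_arg_per per.
  - by rewrite /= mobius_cis.
by rewrite ler_expR; exact: circ_avg_mobius.
Qed.

Lemma cis_per t : cis (t + 2 * pi) = cis t :> C.
Proof. by rewrite cisD cis2pi mulr1. Qed.

Lemma differentiable_scale G (rho z : C) : (forall z, differentiable G z) ->
  differentiable (fun z => G (rho * z)) z.
Proof.
move=> dG; apply: (@differentiable_comp _ _ _ _ (fun z => rho * z) G); last exact: dG.
by apply: (@differentiableM _ _ (cst rho) id) => //; exact: differentiable_cst.
Qed.

Lemma continuous_on_circle G (rho : C) : (forall z, differentiable G z) ->
  continuous (fun t => G (rho * cis t)).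
Proof.
move=> dG t; apply: (@continuous_cvg R C C _ _ (fun t => rho * cis t) G).
  exact: differentiable_continuous.
by apply: cvgM; [exact: cvg_cst|exact: continuous_cis].
Qed.

(** log+|G| bounds log|G| from above and is nonnegative, as [poisson_sub_mean] asks
    of the majorant on the circle. *)
Lemma logp_poisson G (rho : R) b : normc b < 1 -> (forall z, differentiable G z) ->
  logp (normc (G (rho%:C * b))) <=
  harnack b * circ_avg (fun t => logp (normc (G (rho%:C * cis t)))).
Proof.
move=> b1 dG; pose U t := logp (normc (G (rho%:C * cis t))).
have H0 : 0 <= harnack b by apply: divr_ge0; have := normc_ge0 b; lra.
have pi0 : 0 < 2 * pi :> R by rewrite mulr_gt0// pi_gt0.
apply: logp_le.
  apply: mulr_ge0 => //; apply: mulr_ge0; first by rewrite invr_ge0 ltW.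
  by apply: ivl_ge0 => t _; exact: logp_ge0.
apply: (@poisson_sub_mean (fun z => G (rho%:C * z)) b U) => //.
- by move=> z _; exact: differentiable_scale.
- by move=> t; apply: cvg_logp_normc; exact: continuous_on_circle.
- by move=> t; rewrite /U cis_per.
- by move=> t; exact: logp_ge0.
- by move=> t; exact: le_expR_logp.
Qed.

End Poisson.

(** * The theorems of Liouville and Borel-Caratheodory *)

Section EntireLine.
Context {R : realType}.
Notation C := R[i].
Implicit Types (z w b : C) (G : C -> C) (u U : R -> R).
Import Normc.

(** The modulus of exp G is the exponential of Re G, so that the Poisson inequality
    for exp G is an inequality between values of Re G; the mean on its right is
    Re (G 0). *)
Lemma harnack_le G (rho : R) b : normc b < 1 -> (forall z, differentiable G z) ->
  (forall z, 0 <= complex.Re (G z)) ->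
  complex.Re (G (rho%:C * b)) <= harnack b * complex.Re (G 0).
Proof.
move=> b1 dG G0; pose U t := complex.Re (G (rho%:C * cis t)).
have pi0 : 0 < 2 * pi :> R by rewrite mulr_gt0// pi_gt0.
have dGr z : differentiable (fun z => G (rho%:C * z)) z by exact: differentiable_scale.
have UE : circ_avg U = complex.Re (G 0).
  have := @mean_value R (fun z => G (rho%:C * z)) (fun z _ => dGr z).
  by rewrite mulr0 /circ_avg -/U => <-; rewrite mulKf// gt_eqF.
rewrite -UE -ler_expR -normc_cexp.
apply: (@poisson_sub_mean R (fun z => cexp (G (rho%:C * z))) b U) => [//|z _|t|t|t|t].
- apply: (@differentiable_comp _ _ _ _ (fun z => G (rho%:C * z)) (@cexp R)) => //.
  exact: differentiable_cexp.
- apply: (@continuous_cvg R C R _ _ (fun t => G (rho%:C * cis t)) (@complex.Re R)).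
    exact: continuous_Re.
  exact: continuous_on_circle.
- by rewrite /U cis_per.
- exact: G0.
- by rewrite normc_cexp.
Qed.

(** Harnack's inequality on the discs of radius rho, where the constant for the
    point w tends to 1 as rho grows. *)
Lemma entire_Re_ge0_le G w : (forall z, differentiable G z) ->
  (forall z, 0 <= complex.Re (G z)) -> complex.Re (G w) <= complex.Re (G 0).
Proof.
move=> dG G0; apply/ler_addgt0Pr => e e0.
set A := complex.Re (G 0); have A0 : 0 <= A by exact: G0.
set n := normc w; have n0 : 0 <= n by exact: normc_ge0.
(* This rho makes 2 n A / (rho - n), the excess of the bound over A, at most e. *)
pose rho := 2 * n + 1 + 4 * n * A / e.
have q0 : 0 <= 4 * n * A / e by rewrite divr_ge0 ?mulr_ge0// ltW.
have rho0 : 0 < rho by rewrite /rho; lra.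
have nb : normc (w / rho%:C) = n / rho.
  by rewrite normcM normcV normc_real gtr0_norm.
have b1 : normc (w / rho%:C) < 1.
  by rewrite nb ltr_pdivrMr// mul1r /rho; lra.
have := harnack_le rho b1 dG G0; rewrite mulrC divfK; last first.
  by rewrite (inj_eq (@complexI R) _ 0) gt_eqF.
move=> /le_trans; apply; rewrite /harnack nb -/A.
have -> : (1 + n / rho) / (1 - n / rho) = 1 + 2 * n / (rho - n).
  by field; apply/andP; split; rewrite gt_eqF// ?subr_gt0// /rho; lra.
rewrite mulrDl mul1r lerD2l.
have rn : 0 < rho - n by rewrite /rho; lra.
rewrite mulrAC ler_pdivrMr//.
have : e * (4 * n * A / e) = 4 * n * A by field; rewrite gt_eqF.
rewrite /rho; have := mulr_ge0 (ltW e0) n0; have := mulr_ge0 n0 A0.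
move: (4 * n * A / e) => q h1 h2 h3; rewrite -[4 * n * A]mulrA in h3.
by rewrite -[2 * n * A]mulrA !mulrDr !mulrN; lra.
Qed.

(** If |G| <= B then Re (B + c G) >= 0 whenever |c| = 1, so that
    Re (c G w) <= Re (c G 0). The four cases c = 1, -1, i, -i give equality. *)
Lemma liouville G B : (forall z, differentiable G z) ->
  (forall z, normc (G z) <= B) -> forall w, G w = G 0.
Proof.
move=> dG GB w.
have key (c : C) : normc c = 1 -> complex.Re (c * G w) <= complex.Re (c * G 0).
  move=> c1; have := @entire_Re_ge0_le (fun z => B%:C + c * G z) w.
  rewrite /= !raddfD /= lerD2l; apply => z.
    apply: differentiableD; first exact: differentiable_cst.
    by apply: (@differentiableM _ _ (cst c) G) => //; exact: differentiable_cst.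
  rewrite raddfD/=; have := Re_le_normc (c * G z); rewrite normcM c1 mul1r => /le_trans /(_ (GB z)).
  by rewrite ler_norml => /andP[]; lra.
have := key 1 (normc1 _); have := key (- 1); rewrite normcN normc1 => /(_ erefl).
have n_i : normc (0 +i* 1 : C) = 1 by rewrite /= expr0n expr1n add0r sqrtr1.
have := key (0 +i* 1) n_i; have := key (- (0 +i* 1)); rewrite normcN n_i => /(_ erefl).
case: (G w) (G 0) => a b [c d]; rewrite !mulNr !mul1r; simpc => /= h1 h2 h3 h4.
by apply/eqP; rewrite eq_complex/= !eq_le; apply/andP; split; apply/andP; split; lra.
Qed.

Lemma harnack_half b : normc b <= 1 / 2 -> harnack b <= 3.
Proof.
move=> b2; rewrite /harnack ler_pdivrMr; have := normc_ge0 b; lra.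
Qed.

(** H = A + 1 - G has modulus at least 1 on the disc, hence log+|H| = log|H| there.
    The sub-mean value property of 1/H bounds the mean of log|H| over the circle by
    log|H 0|, and the Poisson inequality for H then gives |H| <= |H 0|^3 at the points
    of the disc of half the radius. The classical bound is linear in A; a power is as
    good here, since only the logarithm of the bound enters the characteristic. *)
Lemma borel_caratheodory G (A rho : R) b : (forall z, differentiable G z) ->
  0 <= A -> 0 < rho -> (forall z, normc z <= rho -> complex.Re (G z) <= A) ->
  normc b <= 1 / 2 ->
  normc (G (rho%:C * b)) <= 2 * (A + 1 + normc (G 0)) ^+ 3.
Proof.
move=> dG A0 rho0 GA b2; pose H z := (A + 1)%:C - G z.
have pi0 : 0 < 2 * pi :> R by rewrite mulr_gt0// pi_gt0.
have dH z : differentiable H z.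
  by apply: differentiableB => //; exact: differentiable_cst.
have H1 z : normc z <= 1 -> 1 <= normc (H (rho%:C * z)).
  move=> z1; apply: le_trans (le_trans (ler_norm _) (Re_le_normc _)).
  have : complex.Re (G (rho%:C * z)) <= A.
    by apply: GA; rewrite normcM normc_real gtr0_norm// ger_pMr.
  by rewrite /H; case: (G _) => p q /=; lra.
have H0n z : normc z <= 1 -> H (rho%:C * z) != 0.
  by move=> /H1; rewrite -normc_gt0; apply: lt_le_trans.
pose U t := logp (normc (H (rho%:C * cis t))).
have cU : continuous U.
  by move=> t; apply: cvg_logp_normc; exact: (continuous_on_circle dH).
have avg : circ_avg U <= ln (normc (H 0)).
  have H01 : 0 < normc (H 0).
    by have := H1 0; rewrite normc0 mulr0 ler01 => /(_ isT); apply: lt_le_trans.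
  have := @sub_mean R (fun z => (H (rho%:C * z))^-1) (fun t => - U t).
  rewrite mulr0 normcV.
  have -> : (2 * pi)^-1 * ivl 0 (2 * pi) (fun t => - U t) = - circ_avg U.
    have -> : ivl 0 (2 * pi) (fun t => - U t) = - ivl 0 (2 * pi) U.
      rewrite -[RHS]mulN1r -ivlZ => [|t _]; last exact: cU.
      by apply: eq_ivl => t _; rewrite mulN1r.
    by rewrite mulrN.
  rewrite expRN lef_pV2 ?posrE ?expR_gt0// => h.
  rewrite -ler_expR lnK//; apply: h => [z z1|t|t|t].
  - by apply: differentiableV; [exact: differentiable_scale|exact: H0n].
  - by apply: cvgN; exact: cU.
  - by rewrite /U cis_per.
  - have h1 : 1 <= normc (H (rho%:C * cis t)) by apply: H1; rewrite normc_cis.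
    rewrite normcV expRN /U logpE; have -> : Num.max 1 (normc (H (rho%:C * cis t))) =
      normc (H (rho%:C * cis t)) by apply/max_idPr.
    by rewrite lnK// posrE (lt_le_trans _ h1).
have b1 : normc b < 1 by lra.
have avg0 : 0 <= circ_avg U.
  apply: mulr_ge0; first by rewrite invr_ge0 ltW.
  by apply: ivl_ge0 => t _; exact: logp_ge0.
have h3 : logp (normc (H (rho%:C * b))) <= 3 * ln (normc (H 0)).
  apply: (le_trans (logp_poisson rho b1 dH)); apply: ler_pM => //.
    by apply: divr_ge0; have := normc_ge0 b; lra.
  exact: harnack_half.
have H0le : normc (H 0) <= A + 1 + normc (G 0).
  apply: (le_trans (normcD _ _)); rewrite normcN normc_real ger0_norm//; lra.
have H01 : 1 <= normc (H 0) by have := H1 0; rewrite normc0 mulr0; apply.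
(* The exponent 3 is the bound of Harnack's constant on the half disc. *)
have Hb : normc (H (rho%:C * b)) <= (A + 1 + normc (G 0)) ^+ 3.
  apply: (le_trans (le_expR_logp _)); apply: le_trans (_ : normc (H 0) ^+ 3 <= _).
    rewrite -[normc (H 0) in leRHS]lnK ?posrE ?(lt_le_trans _ H01)//.
    by rewrite -expRM_natl ler_expR.
  by rewrite lerXn2r// nnegrE// ?(le_trans _ H01)// (le_trans _ H0le)// (le_trans _ H01).
have -> : G (rho%:C * b) = (A + 1)%:C - H (rho%:C * b) by rewrite /H opprB addrC subrK.
apply: (le_trans (normcD _ _)); rewrite normcN normc_real ger0_norm; last by lra.
have g0 := normc_ge0 (G 0).
set s := A + 1 + normc (G 0) in Hb *.
have s1 : 1 <= s by rewrite /s; lra.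
have : s <= s ^+ 3 by rewrite ler_eXnr.
have sA : A + 1 <= s by rewrite /s; lra.
by move=> h4; apply: (le_trans (lerD sA Hb)); lra.
Qed.

End EntireLine.

(** * The forms d^c log tau and omega in coordinates *)

Section FubiniStudy.
Context {R : realType} (m : nat).
Notation C := R[i].
Notation V := 'rV[C]_m.
Implicit Types (z v a b : V) (t : R).

(** The real and imaginary parts of the Hermitian product of a and b. *)
Definition reip a b : R := \sum_j (complex.Re (a ord0 j) * complex.Re (b ord0 j) +
                                   complex.Im (a ord0 j) * complex.Im (b ord0 j)).
Definition imip a b : R := \sum_j (complex.Im (a ord0 j) * complex.Re (b ord0 j) -
                                   complex.Re (a ord0 j) * complex.Im (b ord0 j)).

Lemma tauE z : tau z = reip z z.
Proof.
apply: eq_bigr => j _; case: (z ord0 j) => x y /=.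
by rewrite sqr_sqrtr ?addr_ge0 ?sqr_ge0// !expr2.
Qed.

Lemma tau_line z v t : tau (z + t%:C *: v) = tau z + (2 * reip v z) * t + tau v * t ^+ 2.
Proof.
rewrite !tauE /reip mulr_sumr !mulr_suml -!big_split/=; apply: eq_bigr => j _.
rewrite !mxE; case: (z ord0 j) (v ord0 j) => x y [p q]; simpc => /=; ring.
Qed.

Lemma imip_line a z v t : imip a (z + t%:C *: v) = imip a z + imip a v * t.
Proof.
rewrite /imip mulr_suml -!big_split/=; apply: eq_bigr => j _.
rewrite !mxE; case: (z ord0 j) (v ord0 j) (a ord0 j) => x y [p q] [c d]; simpc => /=; ring.
Qed.

Lemma reip_i v z : reip ((0 +i* 1) *: v) z = - imip v z.
Proof.
rewrite /reip /imip -sumrN; apply: eq_bigr => j _.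
by rewrite !mxE; case: (z ord0 j) (v ord0 j) => x y [p q]; simpc => /=; ring.
Qed.

Lemma imip_antisym a b : imip b a = - imip a b.
Proof. by rewrite /imip -sumrN; apply: eq_bigr => j _; ring. Qed.

Lemma is_derive_tau_line z v : is_derive (0 : R) 1 (fun t => tau (z + t%:C *: v)) (2 * reip v z).
Proof.
rewrite (_ : (fun t => _) = (fun t => tau z + (2 * reip v z) * t + tau v * t ^+ 2)); last first.
  by apply/funext => t; exact: tau_line.
apply: is_derive_eq; rewrite /GRing.scale/=; ring.
Qed.

(** The derivative of tau in the direction i v is - 2 Im <v, z>. *)
Lemma dc_log_tau z (v : 'I_1 -> V) : 0 < tau z ->
  dc (@log_tau R m) z v = imip (v ord0) z / (2 * pi * tau z).
Proof.
move=> z0; rewrite /dc /dirD /log_tau.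
have dt := is_derive_tau_line z ((0 +i* 1) *: v ord0).
have z0' : 0 < tau (z + (0 : R)%:C *: ((0 +i* 1) *: v ord0)).
  by rewrite tau_line mulr0 expr0n/= mulr0 !addr0.
have dl := @is_derive1_comp R (@ln R) _ 0 _ _ (is_derive1_ln z0') dt.
rewrite derive1E; have -> := @derive_val _ _ _ _ _ _ _ dl.
rewrite tau_line mulr0 expr0n/= mulr0 !addr0 reip_i.
by move: (@pi R) (pi_gt0 R) => p p0; field; rewrite !gt_eqF.
Qed.

(** Differentiating the formula for d^c log tau in a direction orthogonal to z leaves
    the denominator constant to first order, so that only the bilinear form [imip]
    is differentiated. *)
Lemma omega_tangent z (v : 'I_2 -> V) : 0 < tau z ->
  (forall i, reip (v i) z = 0) ->
  omega z v = imip (v (lift ord0 ord0)) (v ord0) / (pi * tau z).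
Proof.
move=> z0 tg; rewrite /omega /extd big_ord_recl big_ord1.
have key (a : 'I_1 -> V) (u : V) : reip u z = 0 ->
    dirD (fun w => dc (@log_tau R m) w a) z u = imip (a ord0) u / (2 * pi * tau z).
  move=> uz; rewrite /dirD.
  pose g (t : R) := (2 * pi)^-1 * ((imip (a ord0) z + imip (a ord0) u * t) *
    (tau (z + t%:C *: u))^-1).
  have dt := is_derive_tau_line z u.
  have z0' : tau (z + (0 : R)%:C *: u) != 0.
    by rewrite tau_line mulr0 expr0n/= mulr0 !addr0 gt_eqF.
  have dg : is_derive (0 : R) 1 g (imip (a ord0) u / (2 * pi * tau z)).
    have dV := is_deriveV z0' dt.
    apply: is_derive_eq; rewrite /GRing.scale/= uz tau_line mulr0 expr0n/= !mulr0 !addr0.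
    by move: (@pi R) (pi_gt0 R) => p p0; field; rewrite !gt_eqF.
  have ct : {for (0 : R), continuous (fun t : R => tau (z + t%:C *: u))}.
    by apply: differentiable_continuous; apply/derivable1_diffP; have [] := dt.
  have t0 : \forall t \near (0 : R), 0 < tau (z + t%:C *: u).
    by apply: (cvgr_gt _ ct); rewrite tau_line mulr0 expr0n/= mulr0 !addr0.
  rewrite derive1E.
  have -> : 'D_1 (fun t : R => dc (@log_tau R m) (z + t%:C *: u) a) 0 = 'D_1 g 0.
    apply: near_eq_derive; near=> t.
    have t0' : 0 < tau (z + t%:C *: u) by near: t.
    rewrite dc_log_tau// imip_line /g.
    by move: (@pi R) (pi_gt0 R) => p p0; field; rewrite !gt_eqF.
  exact: derive_val.
have k0 := key (fun j => v (lift ord0 j)) _ (tg ord0).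
have k1 := key (fun j => v (lift (lift ord0 ord0) j)) _ (tg (lift ord0 ord0)).
transitivity ((-1) ^+ (ord0 : 'I_2) * (imip (v (lift ord0 ord0)) (v ord0) / (2 * pi * tau z)) +
  (-1) ^+ (lift ord0 ord0 : 'I_2) *
  (imip (v (lift (lift ord0 ord0) ord0)) (v (lift ord0 ord0)) / (2 * pi * tau z))).
  by congr (_ * _ + _ * _); [exact: k0|exact: k1].
have -> : lift (lift ord0 ord0) ord0 = ord0 :> 'I_2 by apply/val_inj.
rewrite expr0 expr1 mul1r mulN1r [imip (v ord0) _]imip_antisym.
by move: (@pi R) (pi_gt0 R) => p p0; field; rewrite !gt_eqF.
Unshelve. all: by end_near. Qed.

End FubiniStudy.

(** * Wedge products as alternating sums *)

Section WedgeAlt.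
Context {R : realType} (m : nat).
Notation C := R[i].
Notation V := 'rV[C]_m.

(** The alternating sum over all permutations of the arguments, without the factor
    1 / k! of the projection onto alternating functions. *)
Definition alt {T : Type} (k : nat) (f : ('I_k -> T) -> R) (g : 'I_k -> T) : R :=
  \sum_(s : 'S_k) (-1) ^+ s * f (g \o s).

Section BlockPerm.
Context (k l : nat) (p : 'S_k) (q : 'S_l).

Definition block_fun (x : 'I_(k + l)) : 'I_(k + l) :=
  match fintype.split x with inl i => lshift l (p i) | inr j => rshift k (q j) end.

Lemma block_fun_inj : injective block_fun.
Proof.
move=> x y; rewrite /block_fun.
case: (splitP x) => i xi; case: (splitP y) => j yj /(congr1 val)/= h; apply/val_inj => /=.
- by rewrite xi yj; congr (val _); apply: (@perm_inj _ p); exact/val_inj.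
- by have := ltn_ord (p i); rewrite h ltnNge leq_addr.
- by have := ltn_ord (p j); rewrite -h ltnNge leq_addr.
- rewrite xi yj; congr (_ + val _)%N; apply: (@perm_inj _ q); apply/val_inj.
  exact: addnI h.
Qed.

Definition block_perm : 'S_(k + l) := perm block_fun_inj.

Lemma block_perm_lshift i : block_perm (lshift l i) = lshift l (p i).
Proof. by rewrite permE /block_fun -[lshift l i]/(unsplit (inl i)) unsplitK. Qed.

Lemma block_perm_rshift j : block_perm (rshift k j) = rshift k (q j).
Proof. by rewrite permE /block_fun -[rshift k j]/(unsplit (inr j)) unsplitK. Qed.

(** The permutation matrix is block diagonal. *)
Lemma sign_block_perm : (-1) ^+ block_perm = (-1) ^+ p * (-1) ^+ q :> R.
Proof.
rewrite -!det_perm -(@det_ublock _ _ _ _ 0); congr (\det _).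
apply/matrixP => x y; rewrite !mxE.
case: (splitP x) => i xi; rewrite !mxE;
  case: (splitP y) => j yj; rewrite !mxE.
- have -> : x = lshift l i by exact/val_inj.
  have -> : y = lshift l j by exact/val_inj.
  by rewrite block_perm_lshift (inj_eq (@lshift_inj _ _)).
- have -> : x = lshift l i by exact/val_inj.
  have -> : y = rshift k j by exact/val_inj.
  by rewrite block_perm_lshift eq_lrshift.
- have -> : x = rshift k i by exact/val_inj.
  have -> : y = lshift l j by exact/val_inj.
  by rewrite block_perm_rshift eq_rlshift.
- have -> : x = rshift k i by exact/val_inj.
  have -> : y = rshift k j by exact/val_inj.
  by rewrite block_perm_rshift (inj_eq (@rshift_inj _ _)).
Qed.

End BlockPerm.

(** The tangent vectors are given by a family v over an index type, so that the forms
    become functions of indices. Permuting the arguments inside the two blocks turns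
    each term of the alternating sum of f * h into terms of the products of the
    alternating sums; each term is met k! l! times, which the factor in the wedge
    product removes. *)
Lemma wedge_alt {T : Type} (k l : nat) (a : Defs.form R m k) (c : Defs.form R m l) z (v : T -> V)
    (f : ('I_k -> T) -> R) (h : ('I_l -> T) -> R) :
  (forall g, a z (v \o g) = alt f g) -> (forall g, c z (v \o g) = alt h g) ->
  forall g, wedge a c z (v \o g) =
    alt (fun u : 'I_(k + l) -> T => f (u \o @lshift k l) * h (u \o @rshift k l)) g.
Proof.
move=> af ch g; rewrite /wedge.
pose F (s : 'S_(k + l)) := (-1) ^+ s * (f (g \o s \o @lshift k l) * h (g \o s \o @rshift k l)) : R.
(* All block permutations give the same alternating sum, by reindexing. *)
have -> : \sum_(s : 'S_(k + l)) (-1) ^+ s * a z (fun i => (v \o g) (s (lshift l i))) *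
     c z (fun j => (v \o g) (s (rshift k j))) =
   \sum_(p : 'S_k) \sum_(q : 'S_l) \sum_(s : 'S_(k + l)) F (block_perm p q * s)%g.
  transitivity (\sum_(s : 'S_(k + l)) \sum_(p : 'S_k) \sum_(q : 'S_l) F (block_perm p q * s)%g).
    apply: eq_bigr => s _.
    rewrite [a z _](af (fun i => g (s (lshift l i)))) [c z _](ch (fun j => g (s (rshift k j)))).
    rewrite /alt -mulrA big_distrlr mulr_sumr/=; apply: eq_bigr => p _.
    rewrite mulr_sumr; apply: eq_bigr => q _.
    rewrite /F odd_permM signr_addb sign_block_perm.
    have -> : g \o (block_perm p q * s)%g \o @lshift k l = (fun i => g (s (lshift l i))) \o p.
      by apply/funext => i /=; rewrite permM block_perm_lshift.
    have -> : g \o (block_perm p q * s)%g \o @rshift k l = (fun i => g (s (rshift k i))) \o q.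
      by apply/funext => i /=; rewrite permM block_perm_rshift.
    move: (f _) (h _) ((-1) ^+ p : R) ((-1) ^+ q : R) ((-1) ^+ s : R) => A B x y w; ring.
  rewrite exchange_big; apply: eq_bigr => p _; exact: exchange_big.
rewrite (eq_bigr (fun=> (\sum_s F s) *+ l`!)); last first.
  move=> p _; rewrite (eq_bigr (fun=> \sum_s F s)); last first.
    move=> q _; rewrite [RHS](reindex_inj (mulgI (block_perm p q))).
    by apply: eq_bigr.
  by rewrite sumr_const card_Sn.
rewrite sumr_const card_Sn -mulrnA -[X in _ * X]mulr_natl [(l`! * _)%N]mulnC mulKf//.
Qed.

End WedgeAlt.

Section Pairs.

Lemma pidx_subproof (n : nat) (i : 'I_n) (e : bool) : (i * 2 + e < n * 2)%N.
Proof. by case: i e => i hi [] /=; lia. Qed.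

Definition pidx (n : nat) (i : 'I_n) (e : bool) : 'I_(n * 2) :=
  Ordinal (pidx_subproof i e).

Lemma half_subproof (n : nat) (x : 'I_(n * 2)) : (x./2 < n)%N.
Proof. by case: x => x /= hx; rewrite -divn2 ltn_divLR. Qed.

Definition hidx (n : nat) (x : 'I_(n * 2)) : 'I_n := Ordinal (half_subproof x).

Lemma pidxK n (i : 'I_n) e : hidx (pidx i e) = i.
Proof. by apply/val_inj => /=; case: e; rewrite muln2 ?addn0 ?addn1 /= ?uphalf_double ?doubleK. Qed.

Lemma odd_pidx n (i : 'I_n) (e : bool) : odd (pidx i e) = e.
Proof. by rewrite /= oddD oddM andbF; case: e. Qed.

Lemma hidxK n (x : 'I_(n * 2)) : pidx (hidx x) (odd x) = x.
Proof. by apply/val_inj => /=; rewrite addnC [(_ * 2)%N in X in (_ + X)%N]muln2 odd_double_half. Qed.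

Lemma big_pairs {T : Type} (idx : T) (op : Monoid.com_law idx) n (F : 'I_(n * 2) -> T) :
  \big[op/idx]_(x < n * 2) F x = \big[op/idx]_(i < n) op (F (pidx i false)) (F (pidx i true)).
Proof.
rewrite (eq_bigr (fun i => \big[op/idx]_(e : bool) F (pidx i e))); last first.
  by move=> i _; rewrite big_bool/= Monoid.mulmC.
rewrite pair_bigA/= (reindex (fun p : 'I_n * bool => pidx p.1 p.2))//=.
exists (fun x => (hidx x, odd x)) => [[i e] _|x _] /=; last exact: hidxK.
by rewrite pidxK; congr (_, _); exact: odd_pidx.
Qed.

End Pairs.

Section WedgePow.
Context {R : realType} (m : nat).
Notation V := 'rV[R[i]]_m.

Lemma wedge_pow_alt {T : Type} (b : Defs.form R m 2) z (v : T -> V) (w : T -> T -> R) :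
  (forall g : 'I_2 -> T, b z (v \o g) =
     alt (fun u : 'I_2 -> T => w (u ord0) (u ord_max)) g) ->
  forall q (g : 'I_(q * 2) -> T), @wedge_pow R m b q z (v \o g) =
    alt (fun u => \prod_(i < q) w (u (pidx i false)) (u (pidx i true))) g.
Proof.
move=> bE; elim=> [|q IH] g /=.
  rewrite /alt (eq_bigr (fun=> 1)); last first.
    move=> s _; rewrite big_ord0 mulr1; have -> : s = 1%g by apply/permP => -[].
    by rewrite odd_perm1.
  by rewrite sumr_const card_Sn.
rewrite (wedge_alt bE IH) /alt; apply: eq_bigr => s _; congr (_ * _).
rewrite big_ord_recl; congr (w _ _ * _) => /=.
- by congr (g (s _)); apply/val_inj.
- by congr (g (s _)); apply/val_inj.
- by apply: eq_bigr => i _; congr (w (g (s _)) (g (s _))); apply/val_inj => /=;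
    rewrite /bump/=; lia.
Qed.

End WedgePow.

(** * A form of top degree as a determinant *)

Section TopDegree.
Context {R : realType} (n : nat).
Variables (Th : 'I_(1 + n * 2) -> R) (al be : 'I_n -> 'I_(1 + n * 2) -> R).

Definition top_mx : 'M[R]_(1 + n * 2) :=
  col_mx (\row_y Th y) (\matrix_(x, y) if odd x then be (hidx x) y else al (hidx x) y).

(** The square of this map sends the pair i of indices to the pair k i. It is the
    reason why regrouping pairs of factors of degree 1 costs no sign: the determinant
    of a square is the square of a determinant, also when k is not injective. *)
Definition half_turn (k : {ffun 'I_n -> 'I_n}) (x : 'I_(1 + n * 2)) : 'I_(1 + n * 2) :=
  match fintype.split x with
  | inl i => lshift _ i
  | inr y => rshift 1 (if odd y then pidx (k (hidx y)) false else pidx (hidx y) true)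
  end.

Definition half_turn_det (k : {ffun 'I_n -> 'I_n}) : R := \det (rowsub (half_turn k) 1%:M).

Lemma half_turn_pairs k (e : bool) i :
  half_turn k (half_turn k (rshift 1 (pidx i e))) = rshift 1 (pidx (k i) e).
Proof.
rewrite /half_turn -[rshift 1 (pidx i e)]/(unsplit (inr (pidx i e))) unsplitK odd_pidx pidxK.
case: e.
  rewrite -[rshift 1 (pidx (k i) _)]/(unsplit (inr (pidx (k i) false))) unsplitK.
  by rewrite odd_pidx pidxK.
rewrite -[rshift 1 (pidx i _)]/(unsplit (inr (pidx i true))) unsplitK.
by rewrite odd_pidx pidxK.
Qed.

Lemma half_turn0 k : half_turn k (lshift _ ord0) = lshift _ ord0.
Proof. by rewrite /half_turn -[lshift _ ord0]/(unsplit (inl ord0)) unsplitK. Qed.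

(** Expanding the product of the sums gives one term for every k : [n] -> [n], and
    its alternating sum is the determinant of [top_mx] with the pairs of rows
    rearranged by k, that is by the square of [half_turn k]. *)
Lemma alt_prod_det :
  alt (fun u : 'I_(1 + n * 2) -> 'I_(1 + n * 2) =>
    Th (u (lshift _ ord0)) *
    \prod_(i < n) \sum_(k < n) al k (u (rshift 1 (pidx i false))) * be k (u (rshift 1 (pidx i true)))) id
  = (\sum_(k : {ffun 'I_n -> 'I_n}) half_turn_det k ^+ 2) * \det top_mx.
Proof.
rewrite /alt.
pose pt (k : {ffun 'I_n -> 'I_n}) (s : 'S_(1 + n * 2)) :=
  \prod_x top_mx (half_turn k (half_turn k x)) (s x).
have ptE (k : {ffun 'I_n -> 'I_n}) (s : 'S_(1 + n * 2)) : Th (s (lshift _ ord0)) *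
    \prod_(i < n) (al (k i) (s (rshift 1 (pidx i false))) * be (k i) (s (rshift 1 (pidx i true))))
    = pt k s.
  rewrite /pt big_split_ord big_ord1 !half_turn0 /top_mx col_mxEu mxE; congr (_ * _).
  rewrite big_pairs; apply: eq_bigr => i _.
  by rewrite !half_turn_pairs !col_mxEd !mxE !odd_pidx !pidxK.
under eq_bigr => s _ do rewrite /= bigA_distr_bigA/= mulr_sumr mulr_sumr.
rewrite exchange_big mulr_suml/=; apply: eq_bigr => k _.
rewrite /half_turn_det expr2 -!det_mulmx.
rewrite -mulmxA -!rowsubE /determinant; apply: eq_bigr => s _.
by rewrite ptE; congr (_ * _); apply: eq_bigr => x _; rewrite !mxE.
Qed.

(** The term of k = id is 1. (The sum is n!, the other permutations contributing 1
    and the other maps 0.) *)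
Lemma half_turn_det_sum_gt0 : 0 < \sum_(k : {ffun 'I_n -> 'I_n}) half_turn_det k ^+ 2.
Proof.
rewrite (bigD1 [ffun i => i])//= ltr_pwDl//; last by apply: sumr_ge0 => k _; exact: sqr_ge0.
suff -> : half_turn_det [ffun i => i] ^+ 2 = 1 by [].
rewrite /half_turn_det expr2 -det_mulmx -rowsubE.
have hx x : half_turn [ffun i => i] (half_turn [ffun i => i] x) = x.
  rewrite -[x]splitK; case: (fintype.split x) => [i|i]; first by rewrite ord1 !half_turn0.
  by rewrite /= -{1}(hidxK i) half_turn_pairs ffunE hidxK.
set M := rowsub _ _; suff -> : M = 1%:M by rewrite det1.
by apply/matrixP => x y; rewrite /M !mxE hx.
Qed.

End TopDegree.

(** * The frame of the toric chart of the sphere *)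

Section SphereFrame.
Context {R : realType} (n : nat).
Notation C := R[i].
Notation V := 'rV[C]_n.+1.
Notation P := 'rV[R]_(1 + n * 2).
Implicit Types (x d : P) (j : 'I_n.+1) (r t : R).

(** The linear part of the affine function [wgt]. *)
Definition dwgt d j : R :=
  if j == ord0 then - \sum_(k < n.+1 | k != ord0) wgt_pos d k else wgt_pos d j.

Lemma ang_line x d t j : ang (x + t *: d) j = ang x j + t * ang d j.
Proof. by rewrite /ang !mxE. Qed.

Lemma wgt_line x d t j : wgt (x + t *: d) j = wgt x j + t * dwgt d j.
Proof.
rewrite /wgt /dwgt; have E k : wgt_pos (x + t *: d) k = wgt_pos x k + t * wgt_pos d k.
  by rewrite /wgt_pos !mxE.
case: ifP => _; last exact: E.
by rewrite (eq_bigr _ (fun k _ => E k)) big_split/= -mulr_sumr mulrN opprD addrA.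
Qed.

Lemma sum_wgt x : \sum_j wgt x j = 1.
Proof.
rewrite (bigD1 ord0)//= /wgt eqxx.
rewrite [X in _ + X](eq_bigr (wgt_pos x)) ?subrK// => j /negbTE.
by rewrite /wgt => ->.
Qed.

Lemma sum_dwgt d : \sum_j dwgt d j = 0.
Proof.
rewrite (bigD1 ord0)//= /dwgt eqxx.
rewrite [X in _ + X](eq_bigr (wgt_pos d)) ?addNr// => j /negbTE.
by rewrite /dwgt => ->.
Qed.

Lemma sphere_chartE r x j : sphere_chart r x ord0 j =
  (r * Num.sqrt (wgt x j) * cos (ang x j)) +i* (r * Num.sqrt (wgt x j) * sin (ang x j)).
Proof. by rewrite mxE; simpc. Qed.

(** In the j-th complex coordinate the i-th frame vector is a radial velocity [rad]
    and a velocity [ar] along the circle, turned by the angle of the point. *)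
Lemma sphere_frameE r x i j : (forall k, 0 < wgt x k) ->
  let d := delta_mx ord0 i : P in
  let rad := r * (dwgt d j / (2 * Num.sqrt (wgt x j))) in
  let ar := r * Num.sqrt (wgt x j) * ang d j in
  sphere_frame r x i ord0 j =
    (rad * cos (ang x j) - ar * sin (ang x j)) +i* (rad * sin (ang x j) + ar * cos (ang x j)).
Proof.
move=> w0 d rad ar; rewrite mxE.
have dw : is_derive (0 : R) 1 (fun t => wgt x j + t * dwgt d j) (dwgt d j).
  by apply: is_derive_eq; rewrite /GRing.scale/=; ring.
have da : is_derive (0 : R) 1 (fun t => ang x j + t * ang d j) (ang d j).
  by apply: is_derive_eq; rewrite /GRing.scale/=; ring.
have w00 : 0 < wgt x j + 0 * dwgt d j by rewrite mul0r addr0.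
have ds := @is_derive1_comp R (@Num.sqrt R) (fun t => wgt x j + t * dwgt d j) 0 _ _
  (is_derive1_sqrt w00) dw.
have dc := @is_derive1_comp R cos (fun t => ang x j + t * ang d j) 0 _ _ (is_derive_cos _) da.
have dsn := @is_derive1_comp R sin (fun t => ang x j + t * ang d j) 0 _ _ (is_derive_sin _) da.
have s0 : Num.sqrt (wgt x j) != 0 by rewrite gt_eqF// sqrtr_gt0.
congr (_ +i* _).
  rewrite (_ : (fun t => _) = (fun t => r * Num.sqrt (wgt x j + t * dwgt d j) *
      cos (ang x j + t * ang d j))); last first.
    by apply/funext => t; rewrite sphere_chartE/= wgt_line ang_line.
  rewrite derive1E.
  have dr := @is_deriveM R R _ _ 0 1 _ _
    (@is_deriveM R R (cst r) _ 0 1 _ _ (@is_derive_cst _ _ _ _ _ _) ds) dc.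
  have -> := @derive_val _ _ _ _ _ _ _ dr.
  rewrite /GRing.scale/= -[(cst r * _) 0]/(r * Num.sqrt (wgt x j + 0 * dwgt d j)).
  rewrite !mul0r !addr0 /rad /ar; field.
  by rewrite s0.
rewrite (_ : (fun t => _) = (fun t => r * Num.sqrt (wgt x j + t * dwgt d j) *
    sin (ang x j + t * ang d j))); last first.
  by apply/funext => t; rewrite sphere_chartE/= wgt_line ang_line.
rewrite derive1E.
have dr := @is_deriveM R R _ _ 0 1 _ _
  (@is_deriveM R R (cst r) _ 0 1 _ _ (@is_derive_cst _ _ _ _ _ _) ds) dsn.
have -> := @derive_val _ _ _ _ _ _ _ dr.
rewrite /GRing.scale/= -[(cst r * _) 0]/(r * Num.sqrt (wgt x j + 0 * dwgt d j)).
  rewrite !mul0r !addr0 /rad /ar; field.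
by rewrite s0.
Qed.

Lemma tau_chart r x : (forall k, 0 < wgt x k) -> tau (sphere_chart r x) = r ^+ 2.
Proof.
move=> w0; rewrite tauE /reip -[RHS]mulr1 -(sum_wgt x) mulr_sumr; apply: eq_bigr => j _.
rewrite sphere_chartE/=; set s := Num.sqrt _.
have s2 : s ^+ 2 = wgt x j by rewrite sqr_sqrtr// ltW.
have c2 := cos2Dsin2 (ang x j); rewrite -s2.
rewrite -[RHS]mulr1 -[X in _ = _ * X]c2; ring.
Qed.

(** The weights add up to 1, so their derivatives add up to 0. *)
Lemma reip_frame_chart r x i : (forall k, 0 < wgt x k) ->
  reip (sphere_frame r x i) (sphere_chart r x) = 0.
Proof.
move=> w0; pose d := delta_mx ord0 i : P.
transitivity (\sum_j (r ^+ 2 / 2) * dwgt d j); last by rewrite -mulr_sumr sum_dwgt mulr0.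
apply: eq_bigr => j _; rewrite sphere_frameE// sphere_chartE/= -/d.
set s := Num.sqrt _; have s0 : s != 0 by rewrite gt_eqF// sqrtr_gt0.
have c2 := cos2Dsin2 (ang x j).
by rewrite -[RHS]mulr1 -[X in _ = _ * X]c2; field.
Qed.

Lemma imip_frame_chart r x i : (forall k, 0 < wgt x k) ->
  imip (sphere_frame r x i) (sphere_chart r x) =
  r ^+ 2 * \sum_j wgt x j * ang (delta_mx ord0 i) j.
Proof.
move=> w0; pose d := delta_mx ord0 i : P.
rewrite mulr_sumr; apply: eq_bigr => j _; rewrite sphere_frameE// sphere_chartE/= -/d.
set s := Num.sqrt _; have s0 : s != 0 by rewrite gt_eqF// sqrtr_gt0.
have s2 : s ^+ 2 = wgt x j by rewrite sqr_sqrtr// ltW.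
have c2 := cos2Dsin2 (ang x j).
by rewrite -s2 -[RHS]mulr1 -[X in _ = _ * X]c2; field.
Qed.

Lemma imip_frame_frame r x a b : (forall k, 0 < wgt x k) ->
  imip (sphere_frame r x b) (sphere_frame r x a) =
  r ^+ 2 / 2 * \sum_j (dwgt (delta_mx ord0 a) j * ang (delta_mx ord0 b) j -
                       dwgt (delta_mx ord0 b) j * ang (delta_mx ord0 a) j).
Proof.
move=> w0; pose d := delta_mx ord0 a : P; pose e := delta_mx ord0 b : P.
rewrite mulr_sumr; apply: eq_bigr => j _; rewrite !sphere_frameE//= -/d -/e.
set s := Num.sqrt _; have s0 : s != 0 by rewrite gt_eqF// sqrtr_gt0.
have c2 := cos2Dsin2 (ang x j).
by rewrite -[RHS]mulr1 -[X in _ = _ * X]c2; field.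
Qed.

End SphereFrame.

(** * The form sigma in the toric chart *)

Lemma alt2 {R : realType} {T : Type} (w : T -> T -> R) (g : 'I_2 -> T) :
  alt (fun u : 'I_2 -> T => w (u ord0) (u ord_max)) g =
  w (g ord0) (g ord_max) - w (g ord_max) (g ord0).
Proof.
have o01 : (ord0 : 'I_2) != ord_max by [].
have I2 (i : 'I_2) : i = ord0 \/ i = ord_max.
  by case: i => [[|[|//]] hi]; [left|right]; apply/val_inj.
rewrite /alt (bigD1 1%g)//= (bigD1 (tperm ord0 ord_max))/=; last first.
  by apply/eqP => /permP/(_ ord0); rewrite tpermL perm1.
rewrite big1 ?addr0 => [|s /andP[s1 st]]; last first.
  have sn : s ord_max <> s ord0 by move=> /perm_inj h; move: o01; rewrite h eqxx.
  exfalso; case: (I2 (s ord0)) => h0; case: (I2 (s ord_max)) => h1.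
  - by apply: sn; rewrite h0 h1.
  - by case/eqP: s1; apply/permP => i; rewrite perm1; case: (I2 i) => ->.
  - by case/eqP: st; apply/permP => i; case: (I2 i) => ->; rewrite ?tpermL ?tpermR.
  - by apply: sn; rewrite h0 h1.
by rewrite odd_perm1 odd_tperm o01 /= expr0 expr1 mul1r mulN1r !perm1 tpermL tpermR.
Qed.

(** The Schur complement of the block 1. *)
Lemma det_block_unit {R : comNzRingType} (k l : nat) (a : 'M[R]_k) (r : 'M[R]_(k, l)) (c : 'M[R]_(l, k)) :
  \det (block_mx a r c 1%:M) = \det (a - r *m c).
Proof.
have -> : block_mx a r c 1%:M = block_mx 1%:M r 0 1%:M *m block_mx (a - r *m c) 0 c 1%:M.
  by rewrite mulmx_block !mul1mx !mul0mx ?mulmx0 ?mulmx1 !add0r subrK.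
by rewrite det_mulmx det_ublock det_lblock !det1 !mul1r mulr1.
Qed.

Section SigmaConst.
Context {R : realType} (n : nat).
Notation P := 'rV[R]_(1 + n * 2).
Notation I := 'I_(1 + n * 2).

(** In the chart, d^c log tau is (2 pi)^-1 (s_0 dt_0 + ... + s_n dt_n), and omega is
    (2 pi)^-1 times the sum over k >= 1 of ds_k /\ (dt_k - dt_0). The three families of
    covectors, evaluated on the coordinate vector y, are [cov_theta], [cov_ds] and
    [cov_dt], with k shifted by one. *)
Definition cov_theta (x : P) (y : I) : R :=
  (2 * pi)^-1 * \sum_j wgt x j * ang (delta_mx ord0 y) j.
Definition cov_ds (k : 'I_n) (y : I) : R := wgt_pos (delta_mx ord0 y : P) (lift ord0 k).
Definition cov_dt (k : 'I_n) (y : I) : R :=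
  ang (delta_mx ord0 y : P) (lift ord0 k) - ang (delta_mx ord0 y : P) ord0.

Lemma ang_delta (y : I) (j : 'I_n.+1) : ang (delta_mx ord0 y : P) j = (j * 2 == y)%N%:R.
Proof.
rewrite /ang mxE eqxx/=; congr (_%:R); congr nat_of_bool.
have hj : (j * 2 < (n * 2).+1)%N by have := ltn_ord j; lia.
by rewrite -(inj_eq val_inj); congr (_ == _); exact: inordK.
Qed.

Lemma wgt_pos_delta (y : I) (k : 'I_n) :
  wgt_pos (delta_mx ord0 y : P) (lift ord0 k) = ((k * 2).+1 == y)%N%:R.
Proof.
rewrite /wgt_pos mxE eqxx andTb; congr (_%:R); congr nat_of_bool.
have hj : ((k * 2).+1 < (n * 2).+1)%N by have := ltn_ord k; lia.
have hE : (lift ord0 k * 2).-1 = (k * 2).+1 by rewrite /= /bump/=; lia.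
rewrite -(inj_eq val_inj); congr (_ == _).
by have := @inordK (n * 2) _ hj; rewrite -hE.
Qed.

(** Clearing the first row with the others replaces the coefficient s_0 of dt_0 by
    s_0 + ... + s_n = 1. *)
Lemma det_cov (x : P) : \det (top_mx (cov_theta x) cov_ds cov_dt) = (2 * pi)^-1.
Proof.
pose a : 'M[R]_1 := (cov_theta x (lshift _ ord0))%:M.
pose r : 'M[R]_(1, n * 2) := \row_y cov_theta x (rshift 1 y).
pose c : 'M[R]_(n * 2, 1) := \matrix_(y, _) (- (odd y)%:R).
have -> : top_mx (cov_theta x) cov_ds cov_dt = block_mx a r c 1%:M.
  apply/matrixP => k j; rewrite -[k]splitK -[j]splitK.
  case: (fintype.split k) => i'; case: (fintype.split j) => j' /=.
  - by rewrite col_mxEu block_mxEul !mxE !ord1 eqxx.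
  - by rewrite col_mxEu block_mxEur !mxE.
  - rewrite col_mxEd block_mxEdl !mxE ord1 /cov_ds /cov_dt !ang_delta wgt_pos_delta.
    by case: (odd i'); rewrite /= ?sub0r// oppr0.
  - rewrite col_mxEd block_mxEdr !mxE /cov_ds /cov_dt !ang_delta wgt_pos_delta.
    rewrite -[in RHS](inj_eq val_inj) /= -[in RHS](odd_double_half i').
    case: (odd i') => /=; rewrite ?subr0 /bump /=; congr (_%:R); congr nat_of_bool; lia.
rewrite det_block_unit det_mx11 !mxE eqxx mulr1n.
rewrite (eq_bigr (fun y : 'I_(n * 2) => - ((odd y)%:R * cov_theta x (rshift 1 y)))); last first.
  by move=> y _; rewrite !mxE mulrN mulrC.
rewrite sumrN opprK big_pairs.
rewrite (eq_bigr (fun k : 'I_n => (2 * pi)^-1 * wgt x (lift ord0 k))) => [|k _]; last first.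
  rewrite !odd_pidx /= mul0r add0r mul1r /cov_theta; congr (_ * _).
  rewrite (bigD1 (lift ord0 k))//= big1 ?addr0 => [|j jk].
    by rewrite ang_delta /= /bump/= (_ : _ == _ = true) ?mulr1//; apply/eqP; lia.
  rewrite ang_delta /= (_ : _ == _ = false) ?mulr0//; apply/negbTE.
  by apply: contra jk => /eqP h; apply/eqP/val_inj; rewrite /= /bump/=; lia.
rewrite /cov_theta (bigD1 ord0)//= big1 ?addr0 => [|j j0]; last first.
  rewrite ang_delta /= (_ : _ == _ = false) ?mulr0//; apply/negbTE.
  by apply: contra j0 => /eqP h; apply/eqP/val_inj; rewrite /=; lia.
rewrite ang_delta mul0n eqxx mulr1 -mulr_sumr -mulrDr.
by have := sum_wgt x; rewrite big_ord_recl => ->; rewrite mulr1.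
Qed.

(** ds_0 = - (ds_1 + ... + ds_n) eliminates the weight s_0. *)
Lemma sum_dwgt_ang (a b : I) :
  \sum_j dwgt (delta_mx ord0 a : P) j * ang (delta_mx ord0 b : P) j =
  \sum_(k < n) cov_ds k a * cov_dt k b.
Proof.
rewrite big_ord_recl /=.
have -> : dwgt (delta_mx ord0 a : P) ord0 = - \sum_(k < n) cov_ds k a.
  have := sum_dwgt (delta_mx ord0 a : P); rewrite big_ord_recl => /eqP.
  by rewrite addr_eq0 => /eqP ->; congr (- _); apply: eq_bigr.
rewrite mulNr mulr_suml -sumrN -big_split/=; apply: eq_bigr => k _.
rewrite /cov_dt mulrBr addrC; congr (_ - _).
Qed.

(** Weights and angles are action-angle coordinates: omega has constant coefficients
    in them, and d^c log tau is constant up to multiples of the dt_k - dt_0, which the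
    power of omega kills. So the top form is a constant multiple of the volume form
    of the chart, whatever r is. *)
Lemma sigma_chart : exists2 c : R, 0 < c & forall (r : R) (x : P), 0 < r ->
  (forall k, 0 < wgt x k) -> sigma (sphere_chart r x) (sphere_frame r x) = c.
Proof.
exists ((2 * pi)^-1 ^+ n * ((\sum_(k : {ffun 'I_n -> 'I_n}) (half_turn_det k : R) ^+ 2) * (2 * pi)^-1)).
  have p0 : 0 < (2 * pi)^-1 :> R by rewrite invr_gt0 mulr_gt0// pi_gt0.
  by rewrite mulr_gt0 ?exprn_gt0// mulr_gt0// half_turn_det_sum_gt0.
move=> r x r0 w0; set z := sphere_chart r x; set v := sphere_frame r x.
have tz : tau z = r ^+ 2 by exact: tau_chart.
have tz0 : 0 < tau z by rewrite tz exprn_gt0.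
have rn : r != 0 by rewrite gt_eqF.
pose w (a b : I) : R := (2 * pi)^-1 * \sum_(k < n) cov_ds k a * cov_dt k b.
have thE (g : 'I_1 -> I) : dc (@log_tau R n.+1) z (v \o g) =
    alt (fun u : 'I_1 -> I => cov_theta x (u ord0)) g.
  rewrite /alt (big_pred1 1%g) => [|s]; last first.
    by apply/esym/eqP/permP => i; rewrite !ord1.
  rewrite odd_perm1 mul1r /= perm1 dc_log_tau// tz imip_frame_chart// /cov_theta.
  by move: (@pi R) (pi_gt0 R) => p p0; field; rewrite rn gt_eqF.
have omE (g : 'I_2 -> I) : omega z (v \o g) =
    alt (fun u : 'I_2 -> I => w (u ord0) (u ord_max)) g.
  rewrite alt2 omega_tangent//; last by move=> i; exact: reip_frame_chart.
  have -> : lift ord0 ord0 = ord_max :> 'I_2 by apply/val_inj.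
  rewrite tz /= imip_frame_frame// sumrB !sum_dwgt_ang /w.
  by move: (@pi R) (pi_gt0 R) => p p0; field; rewrite rn gt_eqF.
have powE := wedge_pow_alt omE.
rewrite /sigma -[v]/(v \o id) (wedge_alt thE (@powE n)).
rewrite -[X in _ = _ * (_ * X)](det_cov x) -alt_prod_det /alt mulr_sumr; apply: eq_bigr => s _.
rewrite /w /= big_split/= prodr_const card_ord.
by rewrite [cov_theta _ _ * (_ * _)]mulrCA [LHS]mulrCA.
Qed.

End SigmaConst.

(** * Integrals depending on a parameter *)

Section MatrixContinuity.

Lemma cvg_mx {T : topologicalType} (S : Type) (F : set_system S) (FF : Filter F) (k l : nat)
    (f : S -> 'M[T]_(k, l)) (M : 'M[T]_(k, l)) :
  (forall i j, (fun t => f t i j) @ F --> M i j) -> f @ F --> M.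
Proof.
move=> fM A [P nP PA]; apply: (filterS (fun t => PA (f t))).
apply: filter_forall => i; apply: filter_forall => j.
exact: (fM i j _ (nP i j)).
Qed.

Lemma cvg_pairT {S : Type} {T U : topologicalType} (F : set_system S) (FF : Filter F)
    (f : S -> T) (g : S -> U) (a : T) (b : U) : f @ F --> a -> g @ F --> b ->
  (fun t => (f t, g t)) @ F --> (a, b).
Proof.
move=> fa gb A [[P Q] /= [aP bQ] PQ].
have fP : F (f @^-1` P) := fa _ aP.
have gQ : F (g @^-1` Q) := gb _ bQ.
by apply: (@filterS _ F _ _ _ _ (filterI fP gQ)) => t [? ?]; exact: PQ.
Qed.

Lemma continuous_fst {T U : topologicalType} : continuous (@fst T U).
Proof. by move=> [x y]; exact: cvg_fst. Qed.

Lemma continuous_snd {T U : topologicalType} : continuous (@snd T U).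
Proof. by move=> [x y]; exact: cvg_snd. Qed.

End MatrixContinuity.

Section ParamIntegral.
Context {R : realType}.

(** Compactness of the segment: the tube lemma. *)
Lemma near_param_unif {T : topologicalType} (a b e : R) (g : T * R -> R) (t : T) :
  continuous g -> 0 < e ->
  \forall t' \near t, forall x, a <= x <= b -> `|g (t', x) - g (t, x)| <= e.
Proof.
move=> cg e0; have := @segment_compact R a b; move/compact_near_coveringP.
move=> /(_ T (nbhs t) (fun t' x => `|g (t', x) - g (t, x)| <= e)).
have -> : [set` `[a, b]] = [set x | a <= x <= b].
  by apply/seteqP; split => x /=; rewrite in_itv.
apply => x _.
have e20 : 0 < e / 2 by rewrite divr_gt0.
have : \forall p \near (t, x), `|g (t, x) - g p| < e / 2.
  by move/cvgrPdist_lt : (cg (t, x)); apply.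
move=> [[A B] /= [tA xB] AB].
exists (B, A) => //= -[x' t'] /= [Bx' At'].
have h1 := AB (t', x') (conj At' Bx').
have h2 := AB (t, x') (conj (nbhs_singleton tA) Bx').
rewrite /= in h1 h2; rewrite -[_ - _](subrKA (g (t, x))).
by apply: (le_trans (ler_normD _ _)); rewrite [`|_ - g (t, x)|]distrC; lra.
Qed.

Lemma slice_continuous {T : topologicalType} (g : T * R -> R) (t : T) :
  continuous g -> continuous (fun x => g (t, x)).
Proof.
move=> cg x; apply: (@continuous_comp R _ _ (fun x => (t, x)) g); last exact: cg.
by apply: cvg_pairT; [exact: cvg_cst|exact: cvg_id].
Qed.

Lemma ivl_param_continuous {T : topologicalType} (a b : R) (g : T * R -> R) : a <= b ->
  continuous g -> continuous (fun t => ivl a b (fun x => g (t, x))).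
Proof.
move=> ab cg t; apply/(@cvgrPdist_le _ _ _ _ (nbhs_filter t)) => e e0.
have ba : 0 < b - a + 1 by rewrite ltr_wpDl// subr_ge0.
have := near_param_unif a b t cg (divr_gt0 e0 ba).
apply: filterS => t' H; rewrite -ivlB => [|x _|x _]; try exact: slice_continuous.
have cd : {in `[a, b], continuous (fun x => g (t, x) - g (t', x))}.
  by move=> x _; apply: cvgB; exact: slice_continuous.
have := @ivl_near_cst R a b _ 0 (e / (b - a + 1)) ab cd.
rewrite mul0r subr0 => /(_ _)/le_trans; apply => [x|].
  by rewrite in_itv/= subr0 distrC; exact: H.
by rewrite mulrAC ler_pdivrMr// ler_wpM2l ?ltW//; lra.
Qed.

(** The difference D of the two iterated integrals is additive in the x-interval, and
    by uniform continuity |D| is at most h times a constant that can be taken small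
    when the x-interval has a small length h. Cutting [a, b] into short intervals
    gives D = 0. *)
Lemma ivl_swap (a b c d : R) (g : R * R -> R) : a <= b -> c <= d -> continuous g ->
  ivl a b (fun x => ivl c d (fun y => g (x, y))) =
  ivl c d (fun y => ivl a b (fun x => g (x, y))).
Proof.
move=> ab cd cg.
pose g' (p : R * R) := g (p.2, p.1).
have cg' : continuous g'.
  move=> p; apply: (@continuous_comp _ _ _ (fun p : R * R => (p.2, p.1)) g); last exact: cg.
  by apply: cvg_pairT; [exact: continuous_snd|exact: continuous_fst].
pose G x := ivl c d (fun y => g (x, y)).
have cG : continuous G by exact: ivl_param_continuous.
have cH s s' : s <= s' -> continuous (fun y => ivl s s' (fun x => g (x, y))).
  by move=> ss'; exact: (@ivl_param_continuous R s s' g').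
have cs x : continuous (fun y => g (x, y)) by exact: slice_continuous.
have cs' y : continuous (fun x => g (x, y)) by exact: (@slice_continuous R g' y).
pose D s s' := ivl s s' G - ivl c d (fun y => ivl s s' (fun x => g (x, y))).
apply/eqP; rewrite -subr_eq0 -/(D a b) -normr_le0; apply/ler_addgt0Pr => e e0; rewrite add0r.
pose e1 := e / (2 * (d - c) * (b - a) + 1).
have dc0 : 0 <= d - c by rewrite subr_ge0.
have ba0 : 0 <= b - a by rewrite subr_ge0.
have den0 : 0 < 2 * (d - c) * (b - a) + 1 by rewrite ltr_wpDl// !mulr_ge0.
have e10 : 0 < e1 by exact: divr_gt0.
have [dl dl0 Hd] : exists2 dl, 0 < dl & forall u v, a <= u <= b -> `|v - u| < dl ->
    forall y, c <= y <= d -> `|g (v, y) - g (u, y)| <= e1.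
  apply: (@segment_lebesgue_number R a b (fun u v => forall y, c <= y <= d ->
    `|g (v, y) - g (u, y)| <= e1)) => x _.
  have e20 : 0 < e1 / 2 by rewrite divr_gt0.
  have /nbhs_ballP[dl dl0 H] := near_param_unif c d x cg e20.
  exists dl => // u v ux vx y ycd; rewrite -[_ - _](subrKA (g (x, y))).
  have h1 := H u (_ : ball x dl u) y ycd; have h2 := H v (_ : ball x dl v) y ycd.
  apply: (le_trans (ler_normD _ _)); rewrite [`|g (x, y) - _|]distrC.
  have {}h1 : `|g (u, y) - g (x, y)| <= e1 / 2 by apply: h1; rewrite /ball/= distrC.
  have {}h2 : `|g (v, y) - g (x, y)| <= e1 / 2 by apply: h2; rewrite /ball/= distrC.
  lra.
(* On a short interval both integrals are close to G s * h. *)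
have step s h : a <= s -> s <= b -> 0 <= h -> h < dl -> `|D s (s + h)| <= 2 * (e1 * (d - c) * h).
  move=> as' sb h0 hdl.
  have hs : s <= s + h by rewrite lerDl.
  have close x : s <= x <= s + h -> `|x - s| < dl.
    by move=> /andP[sx xs]; rewrite ger0_norm; lra.
  have k1 : `|ivl s (s + h) G - G s * h| <= e1 * (d - c) * h.
    have := @ivl_near_cst R s (s + h) G (G s) (e1 * (d - c)) hs (fun x _ => cG x).
    rewrite [s + h - s]addrC addKr; apply => x; rewrite in_itv/= => xs.
    rewrite /G -ivlB => [|y _|y _]; [|exact: cs|exact: cs].
    have cc : {in `[c, d], continuous (fun y => g (x, y) - g (s, y))}.
      by move=> y _; apply: cvgB; exact: cs.
    have := @ivl_near_cst R c d _ 0 e1 cd cc.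
    rewrite mul0r subr0; apply => y; rewrite in_itv/= subr0 => ycd.
    by apply: Hd => //; [rewrite as'|exact: close].
  have k2 : `|ivl c d (fun y => ivl s (s + h) (fun x => g (x, y))) - G s * h| <= e1 * (d - c) * h.
    have -> : G s * h = ivl c d (fun y => h * g (s, y)).
      by rewrite ivlZ => [|y _]; [rewrite mulrC|exact: cs].
    have chs : continuous (fun y => h * g (s, y)).
      by move=> y; apply: cvgM; [exact: cvg_cst|exact: cs].
    rewrite -ivlB => [|y _|y _]; [|exact: cH|exact: chs].
    have cc : {in `[c, d], continuous (fun y => ivl s (s + h) (fun x => g (x, y)) - h * g (s, y))}.
      by move=> y _; apply: cvgB; [exact: cH|exact: chs].
    have := @ivl_near_cst R c d _ 0 (e1 * h) cd cc.
    rewrite mul0r subr0 [e1 * h * _]mulrAC; apply => y; rewrite in_itv/= subr0 => ycd.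
    have := @ivl_near_cst R s (s + h) _ (g (s, y)) e1 hs (fun x _ => cs' y x).
    rewrite [s + h - s]addrC addKr [g (s, y) * h]mulrC; apply => x; rewrite in_itv/= => xs.
    by apply: Hd => //; [rewrite as'|exact: close].
  rewrite /D -[_ - _](subrKA (G s * h)); apply: (le_trans (ler_normD _ _)).
  by rewrite [`|G s * h - _|]distrC; lra.
have Dadd s h k : 0 <= h -> 0 <= k -> D s (s + h + k) = D s (s + h) + D (s + h) (s + h + k).
  move=> h0 k0; have sh : s <= s + h by rewrite lerDl.
  have shk : s + h <= s + h + k by rewrite lerDl.
  rewrite /D (ivl_split sh shk (fun x _ => cG x)).
  have -> : ivl c d (fun y => ivl s (s + h + k) (fun x => g (x, y))) =
     ivl c d (fun y => ivl s (s + h) (fun x => g (x, y)) + ivl (s + h) (s + h + k) (fun x => g (x, y))).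
    by apply: eq_ivl => y _; apply: ivl_split => // x _; exact: cs'.
  rewrite ivlD => [|y _|y _]; [ring|exact: cH|exact: cH].
pose N := (Num.bound ((b - a) / dl)).+1.
pose h := (b - a) / N%:R.
have N0 : 0 < N%:R :> R by rewrite ltr0n.
have h0 : 0 <= h by rewrite divr_ge0.
have hdl : h < dl.
  rewrite ltr_pdivrMr// mulrC -ltr_pdivrMr//.
  by apply: (lt_le_trans (archi_boundP _)); [exact: divr_ge0 (ltW dl0)|rewrite ler_nat].
have Nh : N%:R * h = b - a by rewrite mulrC divfK// gt_eqF.
have : forall k : nat, (k <= N)%N -> `|D a (a + k%:R * h)| <= k%:R * (2 * (e1 * (d - c) * h)).
  elim=> [|k IH] kN.
    rewrite !mul0r addr0 /D /ivl set_itv1 !Rintegral_set1 sub0r normrN.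
    have -> : (fun y => \int[lebesgue_measure]_(x in [set a]) g (x, y)) = (fun=> 0).
      by apply/funext => y; rewrite Rintegral_set1.
    by rewrite -/(ivl c d (fun=> 0)) ivl_cst// mul0r normr0.
  have kh0 : 0 <= k%:R * h by rewrite mulr_ge0.
  have -> : a + k.+1%:R * h = a + k%:R * h + h by rewrite -natr1; ring.
  rewrite Dadd//; apply: (le_trans (ler_normD _ _)).
  rewrite -natr1 [X in _ <= X]mulrDl mul1r; apply: lerD; first exact/IH/ltnW.
  apply: step => //; first by rewrite lerDl.
  have : k%:R * h <= N%:R * h by rewrite ler_wpM2r// ler_nat ltnW.
  by rewrite Nh; lra.
move=> /(_ N (leqnn N)); rewrite Nh addrC subrK => /le_trans; apply.
have -> : N%:R * (2 * (e1 * (d - c) * h)) = 2 * e1 * (d - c) * (N%:R * h) by ring.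
rewrite Nh /e1.
have -> : 2 * (e / (2 * (d - c) * (b - a) + 1)) * (d - c) * (b - a) =
  e * ((2 * (d - c) * (b - a)) / (2 * (d - c) * (b - a) + 1)) by field; rewrite gt_eqF.
by rewrite ger_pMr// ler_pdivrMr// mul1r lerDl.
Qed.

End ParamIntegral.

(** * Splitting off the first coordinate *)

Section RowMx.
Context {K : numFieldType}.

Lemma row_mx0 l (x : K) (y : 'rV[K]_l) :
  (row_mx x%:M y : 'rV_(1 + l)) ord0 (ord0 : 'I_l.+1) = x.
Proof.
have -> : (ord0 : 'I_l.+1) = lshift l (ord0 : 'I_1) by apply/val_inj.
by rewrite row_mxEl mxE.
Qed.

Lemma row_mxS l (x : K) (y : 'rV[K]_l) (i : 'I_l) :
  (row_mx x%:M y : 'rV_(1 + l)) ord0 (lift ord0 i : 'I_l.+1) = y ord0 i.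
Proof.
have -> : (lift ord0 i : 'I_l.+1) = rshift 1 i by apply/val_inj.
by rewrite row_mxEr.
Qed.

Lemma row_mx_head l (x : 'rV[K]_(1 + l)) :
  x = row_mx (x ord0 (ord0 : 'I_l.+1))%:M (\row_j x ord0 (lift ord0 j : 'I_l.+1)).
Proof.
apply/rowP => j; case: (unliftP (ord0 : 'I_l.+1) j) => [i|] ->.
  by rewrite row_mxS mxE.
by rewrite row_mx0.
Qed.

Lemma cvg_row_mx {S : Type} (F : set_system S) (FF : Filter F) l (f : S -> K)
    (g : S -> 'rV[K]_l) (x : K) (y : 'rV[K]_l) : f @ F --> x -> g @ F --> y ->
  (fun t => row_mx (f t)%:M (g t) : 'rV_(1 + l)) @ F --> (row_mx x%:M y : 'rV_(1 + l)).
Proof.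
move=> fx gy; apply: cvg_mx => i j; rewrite ord1.
case: (unliftP (ord0 : 'I_l.+1) j) => [k|] ->.
  rewrite row_mxS (_ : (fun t => _) = fun t => g t ord0 k); last first.
    by apply/funext => t; rewrite row_mxS.
  apply: (@continuous_cvg S 'rV[K]_l K F FF g (fun M : 'rV[K]_l => M ord0 k) y _ gy).
  exact: coord_continuous.
rewrite row_mx0 (_ : (fun t => _) = f)//.
by apply/funext => t; rewrite row_mx0.
Qed.

End RowMx.

(** * Iterated integrals of continuous functions over boxes *)

Section BoxIntegral.
Context {R : realType}.
Implicit Types (lo hi : nat -> R).

(** The bounds are indexed by natural numbers, so that passing to the remaining
    coordinates is a shift of the bounds. *)
Fixpoint box_int (k : nat) lo hi : ('rV[R]_k -> R) -> R :=
  match k with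
  | 0 => fun v => v 0
  | l.+1 => fun v => ivl (lo 0%N) (hi 0%N) (fun x =>
      @box_int l (lo \o S) (hi \o S) (fun y => v (row_mx x%:M y : 'rV_(1 + l))))
  end.
Arguments box_int : clear implicits.

Definition in_box (k : nat) lo hi (y : 'rV[R]_k) := forall i : 'I_k, lo i <= y ord0 i <= hi i.
Definition in_obox (k : nat) lo hi (y : 'rV[R]_k) := forall i : 'I_k, lo i < y ord0 i < hi i.

Lemma in_box_row l lo hi (x : R) (y : 'rV[R]_l) : lo 0%N <= x <= hi 0%N ->
  in_box (lo \o S) (hi \o S) y -> in_box lo hi (row_mx x%:M y : 'rV_(1 + l)).
Proof.
move=> hx hy i; case: (unliftP ord0 i) => [j|] ->; last by rewrite row_mx0.
by rewrite row_mxS; exact: hy.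
Qed.

(** Moves the first coordinate into the parameter, the induction step for integrals
    over boxes with a parameter. *)
Lemma uncurry_row_continuous {T : topologicalType} l (v : T * 'rV[R]_(1 + l) -> R) :
  continuous v -> continuous (fun p : (T * R) * 'rV[R]_l => v (p.1.1, row_mx p.1.2%:M p.2)).
Proof.
move=> cv p; apply: (@continuous_comp _ _ _ (fun p : (T * R) * 'rV[R]_l =>
  (p.1.1, row_mx p.1.2%:M p.2 : 'rV_(1 + l))) v); last exact: cv.
have c1 : (fun p : (T * R) * 'rV[R]_l => p.1) @ p --> p.1 by exact: continuous_fst.
apply: cvg_pairT.
  by apply: (continuous_cvg _ _ c1); exact: continuous_fst.
apply: cvg_row_mx; last exact: continuous_snd.
by apply: (continuous_cvg _ _ c1); exact: continuous_snd.
Qed.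

Lemma box_int_param_continuous (k : nat) lo hi : (forall i, lo i <= hi i) ->
  forall (T : topologicalType) (v : T * 'rV[R]_k -> R), continuous v ->
  continuous (fun t => box_int k lo hi (fun y => v (t, y))).
Proof.
elim: k lo hi => [|l IH] lo hi lohi T v cv /=.
  move=> t; apply: (@continuous_comp T (T * 'rV[R]_0)%type R (fun t => (t, 0)) v); last exact: cv.
  by apply: cvg_pairT; [exact: cvg_id|exact: cvg_cst].
have := IH (lo \o S) (hi \o S) (fun i => lohi i.+1) _ _ (uncurry_row_continuous cv).
by move/(ivl_param_continuous (lohi 0%N)).
Qed.

Section Slices.
Context (l : nat) (v : 'rV[R]_(1 + l) -> R) (cv : continuous v).

Lemma row_slice_continuous : continuous (fun p : R * 'rV[R]_l => v (row_mx p.1%:M p.2)).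
Proof.
move=> p; apply: (@continuous_comp _ _ _ (fun p : R * 'rV[R]_l =>
  row_mx p.1%:M p.2 : 'rV_(1 + l)) v); last exact: cv.
by apply: cvg_row_mx; [exact: continuous_fst|exact: continuous_snd].
Qed.

Lemma tail_continuous x : continuous (fun y : 'rV[R]_l => v (row_mx x%:M y)).
Proof.
move=> y; apply: (@continuous_comp _ _ _ (fun y : 'rV[R]_l =>
  row_mx x%:M y : 'rV_(1 + l)) v); last exact: cv.
by apply: (@cvg_row_mx R _ (nbhs y) (nbhs_filter y) _ (fun=> x) id); [exact: cvg_cst|exact: cvg_id].
Qed.

Lemma box_slice_continuous lo hi : (forall i, lo i <= hi i) ->
  continuous (fun x => box_int l lo hi (fun y => v (row_mx x%:M y))).
Proof.
move=> lohi.
exact: (box_int_param_continuous lohi row_slice_continuous).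
Qed.

End Slices.

Lemma le_box_int (k : nat) lo hi (v w : 'rV[R]_k -> R) : (forall i, lo i <= hi i) ->
  continuous v -> continuous w -> (forall y, in_box lo hi y -> v y <= w y) ->
  box_int k lo hi v <= box_int k lo hi w.
Proof.
elim: k lo hi v w => [|l IH] lo hi v w lohi cv cw vw /=; first by apply: vw => -[].
apply: le_ivl => [x _|x _|x].
- exact: (box_slice_continuous cv (fun i => lohi i.+1)).
- exact: (box_slice_continuous cw (fun i => lohi i.+1)).
- rewrite in_itv/= => hx; apply: IH => [i|||y hy]; first exact: lohi.
  + exact: (tail_continuous cv).
  + exact: (tail_continuous cw).
  + by apply: vw; exact: in_box_row.
Qed.

Lemma box_intZ (k : nat) lo hi (v : 'rV[R]_k -> R) (c : R) : (forall i, lo i <= hi i) ->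
  continuous v -> box_int k lo hi (fun y => c * v y) = c * box_int k lo hi v.
Proof.
elim: k lo hi v => [|l IH] lo hi v lohi cv //=.
rewrite -ivlZ => [|x _]; last exact: (box_slice_continuous cv (fun i => lohi i.+1)).
apply: eq_ivl => x _; apply: IH => [i|]; first exact: lohi.
exact: (tail_continuous cv).
Qed.

Definition box_vol (k : nat) lo hi : R := \prod_(i < k) (hi i - lo i).

Lemma box_int_cst (k : nat) lo hi (c : R) : (forall i, lo i <= hi i) ->
  box_int k lo hi (fun=> c) = c * box_vol k lo hi.
Proof.
elim: k lo hi => [|l IH] lo hi lohi /=; first by rewrite /box_vol big_ord0 mulr1.
rewrite (eq_ivl (g := fun=> c * box_vol l (lo \o S) (hi \o S))) => [|x _]; last first.
  by apply: IH => i; exact: lohi.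
by rewrite ivl_cst// /box_vol big_ord_recl/= mulrAC mulrA.
Qed.

Lemma box_int_swap (k : nat) lo hi (a b : R) (v : R * 'rV[R]_k -> R) : a <= b ->
  (forall i, lo i <= hi i) -> continuous v ->
  ivl a b (fun t => box_int k lo hi (fun y => v (t, y))) =
  box_int k lo hi (fun y => ivl a b (fun t => v (t, y))).
Proof.
elim: k lo hi v => [|l IH] lo hi v ab lohi cv //=.
pose v' (p : (R * R) * 'rV[R]_l) := v (p.1.1, row_mx p.1.2%:M p.2 : 'rV_(1 + l)).
have cv' : continuous v' by exact: uncurry_row_continuous.
have lohi' i : (lo \o S) i <= (hi \o S) i by exact: lohi.
rewrite (ivl_swap ab (lohi 0%N) (box_int_param_continuous lohi' cv')).
apply: eq_ivl => x _.
apply: (IH _ _ (fun p : R * 'rV[R]_l => v' ((p.1, x), p.2))) => // p.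
apply: (@continuous_comp _ _ _ (fun p : R * 'rV[R]_l => ((p.1, x), p.2)) v'); last exact: cv'.
apply: cvg_pairT; last exact: continuous_snd.
by apply: cvg_pairT; [exact: continuous_fst|exact: cvg_cst].
Qed.

End BoxIntegral.
Arguments box_int {R} k lo hi v.

(** * Iterated Lebesgue integrals *)

Section IterIntegral.
Context {R : realType}.
Implicit Types (lo hi : nat -> R).
Local Open Scope ereal_scope.

(** The integral of a nonnegative function is a supremum over the simple functions
    below it, which makes it monotone on arbitrary nonnegative functions. *)
Lemma ge0_le_integral_nonmeas (f g : R -> \bar R) : (forall x, 0 <= f x) ->
  (forall x, f x <= g x) ->
  \int[@lebesgue_measure R]_x f x <= \int[@lebesgue_measure R]_x g x.
Proof.
move=> f0 fg; rewrite !ge0_integralTE => [|x|x]; last 2 first.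
- exact: le_trans (f0 x) (fg x).
- exact: f0.
apply: ereal_sup_le => _ [h hf <-]; exists h => // x.
exact: le_trans (hf x) (fg x).
Qed.

Lemma iter_integral_ge0 k (F : 'rV[R]_k -> \bar R) : (forall x, 0 <= F x) ->
  0 <= iter_integral F.
Proof.
elim: k F => [|l IH] F F0 /=; first exact: F0.
by apply: integral_ge0 => x _; apply: IH.
Qed.

Lemma le_iter_integral k (F G : 'rV[R]_k -> \bar R) : (forall x, 0 <= F x) ->
  (forall x, F x <= G x) -> iter_integral F <= iter_integral G.
Proof.
elim: k F G => [|l IH] F G F0 FG /=; first exact: FG.
apply: ge0_le_integral_nonmeas => x; first exact: iter_integral_ge0.
exact: IH.
Qed.

Lemma iter_integral0 k : iter_integral (fun _ : 'rV[R]_k => 0) = 0.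
Proof.
elim: k => [//|l IH] /=.
by rewrite (eq_integral (cst 0)) ?integral0// => x _; exact: IH.
Qed.

(** An open and a closed interval have the same integral, and the integral over the
    remaining coordinates is a continuous function of the first one. *)
Lemma iter_integral_box k lo hi (v : 'rV[R]_k -> R) : (forall i, (lo i <= hi i)%R) ->
  continuous v ->
  iter_integral ((EFin \o v) \_ [set y | in_obox lo hi y]) = (box_int k lo hi v)%:E.
Proof.
elim: k lo hi v => [|l IH] lo hi v lohi cv /=.
  by rewrite patchE mem_set// => -[].
have lohi' i : ((lo \o S) i <= (hi \o S) i)%R by exact: lohi.
pose w x := box_int l (lo \o S) (hi \o S) (fun y => v (row_mx x%:M y)).
have cw : continuous w by exact: box_slice_continuous.
transitivity (\int[@lebesgue_measure R]_x ((EFin \o w) \_ `]lo 0%N, hi 0%N[) x).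
  apply: eq_integral => x _; rewrite [RHS]patchE.
  have [xin|xout] := boolP (x \in [set` `]lo 0%N, hi 0%N[]).
    rewrite /= -(IH _ _ _ lohi' (tail_continuous cv (x := x))).
    congr iter_integral; apply/funext => y; rewrite !patchE.
    suff -> : (row_mx x%:M y \in [set y | in_obox lo hi y]) =
              (y \in [set y | in_obox (lo \o S) (hi \o S) y]) by [].
    apply/idP/idP; rewrite !inE => H.
      by move=> i; have := H (lift ord0 i); rewrite row_mxS.
    move=> i; case: (unliftP ord0 i) => [j|] ->; first by rewrite row_mxS; exact: H.
    by rewrite row_mx0; move: xin; rewrite inE /= in_itv.
  rewrite -[RHS](iter_integral0 l); congr iter_integral; apply/funext => y.
  rewrite patchE memNset// => H; move/negP: xout; apply.
  by rewrite inE /= in_itv/=; have := H ord0; rewrite row_mx0.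
rewrite -integral_mkcond -(@integral_itv_bndoo _ _ _ _ true false).
  rewrite /ivl /Rintegral fineK//; apply: integrable_fin_num => //.
  by apply: cont_integrable => x _; exact: cw.
apply/measurable_realfun.measurable_EFinP; apply: measurable_funTS.
exact: measurable_realfun.continuous_measurable_fun.
Qed.

End IterIntegral.

(** * Holomorphy along complex lines *)

Section Linewise.
Context {R : realType}.
Notation C := R[i].
Import Normc.

(** What is used of an entire function of several variables: this property is kept
    when some variables are fixed and under composition with the exponential. *)
Definition linewise (m : nat) (f : 'rV[C]_m -> C) :=
  continuous f /\ forall z v (s : C), differentiable (fun s : C => f (z + s *: v)) s.

Lemma entire_linewise m (f : 'rV[C]_m -> C) : entire f -> linewise f.
Proof.
move=> ef; split=> [z|z v s]; first exact: differentiable_continuous.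
apply: (@differentiable_comp _ _ _ _ (fun s : C => z + s *: v) f); last exact: ef.
apply: differentiableD; first exact: differentiable_cst.
exact: (@differentiableZl _ _ _ id v).
Qed.

Lemma linewise_ray m (f : 'rV[C]_m -> C) (z : 'rV[C]_m) : linewise f ->
  forall s : C, differentiable (fun s : C => f (s *: z)) s.
Proof.
move=> [_ lf] s; have := lf 0 z s.
by rewrite (_ : (fun s => _) = (fun s => f (s *: z)))//; apply/funext => t; rewrite add0r.
Qed.

Lemma continuous_cexp : continuous (@cexp R).
Proof. by move=> z; apply: differentiable_continuous; exact: differentiable_cexp. Qed.

Lemma cexp_linewise m (f : 'rV[C]_m -> C) : linewise f -> linewise (fun z => cexp (f z)).
Proof.
move=> [cf lf]; split=> [z|z v s].
  by apply: (@continuous_comp _ _ _ f (@cexp R)); [exact: cf|exact: continuous_cexp].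
apply: (@differentiable_comp _ _ _ _ (fun s : C => f (z + s *: v)) (@cexp R)).
  exact: lf.
exact: differentiable_cexp.
Qed.

Lemma linewise_tail l (f : 'rV[C]_(1 + l) -> C) (a : C) : linewise f ->
  linewise (fun w : 'rV[C]_l => f (row_mx a%:M w)).
Proof.
move=> [cf lf]; split=> [z|z v s].
  apply: (@continuous_comp _ _ _ (fun w : 'rV[C]_l => row_mx a%:M w : 'rV_(1 + l)) f);
    last exact: cf.
  by apply: (@cvg_row_mx C _ (nbhs z) (nbhs_filter z) _ (fun=> a) id); [exact: cvg_cst|exact: cvg_id].
rewrite (_ : (fun s : C => _) = (fun s : C => f (row_mx a%:M z + s *: row_mx 0 v))).
  exact: lf.
by apply/funext => t; rewrite scale_row_mx scaler0 add_row_mx addr0.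
Qed.

Lemma linewise_head l (f : 'rV[C]_(1 + l) -> C) (w : 'rV[C]_l) : linewise f ->
  forall s : C, differentiable (fun s : C => f (row_mx s%:M w)) s.
Proof.
move=> [cf lf] s.
rewrite (_ : (fun s : C => _) = (fun s : C => f (row_mx 0 w + s *: row_mx 1%:M 0))).
  exact: lf.
by apply/funext => t; rewrite scale_row_mx scaler0 add_row_mx add0r addr0 scale_scalar_mx mulr1.
Qed.

End Linewise.

(** * The Poisson inequality on tori *)

Section PolydiscMean.
Context {R : realType}.
Notation C := R[i].
Import Normc.

(** The bounds for a row of pairs (s, t) of a weight between al and be and an angle
    between 0 and 2 pi. *)
Definition pair_lo (al : R) (j : nat) : R := if odd j then 0 else al.
Definition pair_hi (be : R) (j : nat) : R := if odd j then 2 * pi else be.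

Lemma pair_lo2 al : (pair_lo al \o S) \o S = pair_lo al.
Proof. by apply/funext => j; rewrite /pair_lo /= negbK. Qed.
Lemma pair_hi2 be : (pair_hi be \o S) \o S = pair_hi be.
Proof. by apply/funext => j; rewrite /pair_hi /= negbK. Qed.

Definition polar_row (r : R) (k : nat) (y : 'rV[R]_(k * 2)) : 'rV[C]_k :=
  \row_i ((r * Num.sqrt (y ord0 (pidx i false)))%:C * cis (y ord0 (pidx i true))).

Lemma polar_rowS r k s t (y : 'rV[R]_(k * 2)) :
  polar_row r (row_mx s%:M (row_mx t%:M y : 'rV_(1 + k * 2)) : 'rV_(k.+1 * 2)) =
  row_mx ((r * Num.sqrt s)%:C * cis t)%:M (polar_row r y) :> 'rV_(1 + k).
Proof.
apply/rowP => i; rewrite mxE.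
case: (unliftP (ord0 : 'I_k.+1) i) => [j|] ->.
  rewrite row_mxS [RHS]mxE.
  have E e : (row_mx s%:M (row_mx t%:M y : 'rV_(1 + k * 2)) : 'rV_(1 + (1 + k * 2))) ord0
      (@pidx k.+1 (lift ord0 j) e) = y ord0 (pidx j e).
    rewrite (_ : @pidx k.+1 _ e = lift ord0 (lift ord0 (pidx j e)) :> 'I_(k * 2).+2).
      by rewrite !row_mxS.
    by apply/val_inj; rewrite /= /bump/=; lia.
  by rewrite !E.
rewrite row_mx0.
have -> : @pidx k.+1 ord0 false = ord0 :> 'I_(k * 2).+2 by apply/val_inj.
have -> : @pidx k.+1 ord0 true = lift ord0 ord0 :> 'I_(k * 2).+2 by apply/val_inj.
by rewrite row_mx0 row_mxS row_mx0.
Qed.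

Lemma continuous_polar (r : R) : continuous (fun p : R * R => (r * Num.sqrt p.1)%:C * cis p.2).
Proof.
move=> p; apply: cvgM.
  rewrite (_ : (fun p : R * R => _) = (fun p : R * R => (r * Num.sqrt p.1) +i* 0))//.
  apply: cvg_Complex; last exact: cvg_cst.
  apply: cvgM; first exact: cvg_cst.
  apply: (@continuous_comp _ _ _ (fst : R * R -> R) (@Num.sqrt R)); first exact: continuous_fst.
  exact: sqrt_continuous.
apply: (@continuous_comp _ _ _ (snd : R * R -> R) (@cis R)); first exact: continuous_snd.
exact: continuous_cis.
Qed.

Lemma continuous_polar_row r k : continuous (@polar_row r k).
Proof.
move=> y; apply: (@cvg_mx C _ (nbhs y) (nbhs_filter y)) => i j; rewrite ord1 mxE.
rewrite (_ : (fun t => _) = (fun t : 'rV[R]_(k * 2) => (r * Num.sqrt (t ord0 (pidx j false)))%:C * cis (t ord0 (pidx j true)))).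
  apply: (@continuous_comp _ _ _ (fun t : 'rV[R]_(k * 2) => (t ord0 (pidx j false), t ord0 (pidx j true)))
    (fun p : R * R => (r * Num.sqrt p.1)%:C * cis p.2)); last exact: continuous_polar.
  by apply: (@cvg_pairT _ R R (nbhs y) (nbhs_filter y)); exact: coord_continuous.
by apply/funext => t; rewrite mxE.
Qed.

(** At the points of the disc of half the radius Harnack's constant is at most 3. *)
Lemma circle_lower_bound (G : C -> C) (rho : R) (w : C) : (forall s, differentiable G s) ->
  0 < rho -> normc w <= rho / 2 ->
  (2 * pi / 3) * logp (normc (G w)) <=
  ivl 0 (2 * pi) (fun t => logp (normc (G (rho%:C * cis t)))).
Proof.
move=> dG rho0 w2; have pi0 : 0 < 2 * pi :> R by rewrite mulr_gt0// pi_gt0.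
have rn : rho%:C != 0 :> C by rewrite (inj_eq (@complexI R) _ 0) gt_eqF.
have b2 : normc (w / rho%:C) <= 1 / 2.
  by rewrite normcM normcV normc_real gtr0_norm// ler_pdivrMr// mulrC mul1r -[X in _ <= X]/(rho / 2).
have b1 : normc (w / rho%:C) < 1 by lra.
have := logp_poisson rho b1 dG; rewrite [rho%:C * (w / _)]mulrC divfK// => h.
set I := ivl _ _ _; have I0 : 0 <= I by apply: ivl_ge0 => t _; exact: logp_ge0.
have : logp (normc (G w)) <= 3 * ((2 * pi)^-1 * I).
  apply: (le_trans h); apply: ler_wpM2r; last exact: harnack_half.
  by rewrite mulr_ge0// invr_ge0 ltW.
rewrite mulrCA ler_pdivlMl// => k.
by rewrite -(ler_pM2l (x := 3))// mulrA; apply: le_trans k; rewrite [3 * _]mulrC divfK.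
Qed.

(** Induction on the number of variables. For each radius r sqrt s the inequality on
    a circle in the first variable bounds log+|f w| by the mean of log+|f| over the
    points that differ from w in the first variable, and the induction hypothesis
    applies to these. The weights s >= al keep w inside the half discs. *)
Lemma polydisc_lower_bound (r al be : R) k (f : 'rV[C]_k -> C) (w : 'rV[C]_k) :
  0 < r -> 0 < al -> al <= be -> linewise f ->
  (forall j, normc (w ord0 j) <= r * Num.sqrt al / 2) ->
  ((be - al) * (2 * pi / 3)) ^+ k * logp (normc (f w)) <=
  box_int (k * 2) (pair_lo al) (pair_hi be) (fun y => logp (normc (f (polar_row r y)))).
Proof.
move=> r0 al0 albe; elim: k f w => [|k IH] f w lf hw.
  rewrite expr0 mul1r /=; have -> : polar_row r (0 : 'rV[R]_(0 * 2)) = w by apply/rowP => -[].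
  by [].
have pi0 : 0 < 2 * pi :> R by rewrite mulr_gt0// pi_gt0.
pose K := (be - al) * (2 * pi / 3).
have K0 : 0 <= K by rewrite mulr_ge0 ?subr_ge0// divr_ge0// ltW.
pose w' : 'rV[C]_k := \row_j w ord0 (lift ord0 j).
have wE : w = row_mx (w ord0 ord0)%:M w' :> 'rV_(1 + k) by exact: row_mx_head.
have lohi i : pair_lo al i <= pair_hi be i by rewrite /pair_lo /pair_hi; case: odd => //; exact: ltW.
pose V (y : 'rV[R]_(k.+1 * 2)) := logp (normc (f (polar_row r y))).
have cV : continuous V.
  move=> y; apply: (@cvg_logp_normc R _ (nbhs y) (nbhs_filter y)).
  apply: (@continuous_cvg _ 'rV[C]_k.+1 C (nbhs y) (nbhs_filter y) (@polar_row r k.+1) f).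
    by case: lf => cf _; exact: cf.
  exact: continuous_polar_row.
change (K ^+ k.+1 * logp (normc (f w)) <= ivl al be (fun s => ivl 0 (2 * pi) (fun t =>
  box_int (k * 2) ((pair_lo al \o S) \o S) ((pair_hi be \o S) \o S) (fun y =>
    V (row_mx s%:M (row_mx t%:M y : 'rV_(1 + k * 2))))))).
rewrite pair_lo2 pair_hi2.
pose c := K ^+ k * ((2 * pi / 3) * logp (normc (f w))).
have -> : K ^+ k.+1 * logp (normc (f w)) = c * (be - al).
  by rewrite /c exprS /K; ring.
rewrite -ivl_cst//.
have cV2 s : continuous (fun u : 'rV[R]_(1 + k * 2) => V (row_mx s%:M u)).
  exact: (@tail_continuous R _ V cV).
apply: le_ivl => [s _|s _|s]; first exact: cvg_cst.
  have := @box_slice_continuous R _ V cV (pair_lo al \o S) (pair_hi be \o S) (fun i => lohi i.+1).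
  by rewrite /= pair_lo2 pair_hi2 => /(_ s).
rewrite in_itv/= => /andP[als sbe].
have s0 : 0 < s by exact: lt_le_trans als.
have rs0 : 0 < r * Num.sqrt s by rewrite mulr_gt0// sqrtr_gt0.
pose g t := logp (normc (f (row_mx ((r * Num.sqrt s)%:C * cis t)%:M w'))).
have dhead := linewise_head w' lf.
have cg : continuous g.
  move=> t; apply: cvg_logp_normc.
  exact: (continuous_on_circle (G := fun z => f (row_mx z%:M w')) dhead).
apply: le_trans (_ : ivl 0 (2 * pi) (fun t => K ^+ k * g t) <= _).
  rewrite ivlZ => [|t _]; last exact: cg.
  rewrite ler_wpM2l ?exprn_ge0//.
  have := @circle_lower_bound (fun z => f (row_mx z%:M w')) _ (w ord0 ord0) dhead rs0.
  rewrite -wE; apply; apply: le_trans (hw ord0) _.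
  by apply: ler_wpM2r => //; apply: ler_wpM2l; [exact: ltW|exact: ler_wsqrtr].
apply: le_ivl => [t _|t _|t _].
- by apply: cvgM; [exact: cvg_cst|exact: cg].
- exact: (box_slice_continuous (cV2 s) lohi).
- have := IH (fun u : 'rV[C]_k => f (row_mx ((r * Num.sqrt s)%:C * cis t)%:M u)) w'
    (linewise_tail _ lf).
  rewrite -/K => /(_ _)/le_trans; apply => [j|]; first by rewrite mxE.
  rewrite le_eqVlt; apply/orP; left; apply/eqP; congr box_int; apply/funext => y.
  by rewrite /V polar_rowS.
Qed.

End PolydiscMean.

(** * Two-sided bounds for the characteristic function *)

Section Characteristic.
Context {R : realType} (n : nat).
Notation C := R[i].
Notation V := 'rV[C]_n.+1.
Notation P := 'rV[R]_(1 + n * 2).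
Import Normc.

Implicit Types (y : 'rV[R]_(n * 2)).

Lemma wgt_pos_row (t : R) y (k : 'I_n) :
  wgt_pos (row_mx t%:M y) (lift ord0 k) = y ord0 (pidx k false).
Proof.
rewrite /wgt_pos (_ : inord _ = lift ord0 (pidx k false) :> 'I_(n * 2).+1) ?row_mxS//.
have hk := ltn_ord k.
by apply/val_inj; rewrite /= inordK /= /bump/=; lia.
Qed.

Lemma ang_row (t : R) y (k : 'I_n) : ang (row_mx t%:M y) (lift ord0 k) = y ord0 (pidx k true).
Proof.
rewrite /ang (_ : inord _ = lift ord0 (pidx k true) :> 'I_(n * 2).+1) ?row_mxS//.
have hk := ltn_ord k.
by apply/val_inj; rewrite /= inordK /= /bump/=; lia.
Qed.

Lemma ang_row0 (t : R) y : ang (row_mx t%:M y) ord0 = t.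
Proof.
rewrite /ang (_ : inord _ = ord0 :> 'I_(n * 2).+1) ?row_mx0//.
by apply/val_inj; rewrite /= inordK.
Qed.

Lemma wgt_row (t : R) y (k : 'I_n) : wgt (row_mx t%:M y) (lift ord0 k) = y ord0 (pidx k false).
Proof. exact: wgt_pos_row. Qed.

Lemma wgt_row0 (t : R) y : wgt (row_mx t%:M y) ord0 = 1 - \sum_(k < n) y ord0 (pidx k false).
Proof.
rewrite /wgt eqxx; congr (_ - _); rewrite big_mkcond big_ord_recl/= add0r.
by apply: eq_bigr => k _; rewrite wgt_pos_row.
Qed.

Lemma sphere_chart_row r (t : R) y :
  sphere_chart r (row_mx t%:M y) =
  row_mx ((r * Num.sqrt (1 - \sum_(k < n) y ord0 (pidx k false)))%:C * cis t)%:M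
    (polar_row r y) :> 'rV_(1 + n).
Proof.
apply/rowP => j; rewrite mxE.
case: (unliftP (ord0 : 'I_n.+1) j) => [k|] ->.
  by rewrite row_mxS [RHS]mxE cisE wgt_row ang_row.
by rewrite row_mx0 cisE wgt_row0 ang_row0.
Qed.

Lemma continuous_sumR {T : topologicalType} (k : nat) (F : 'I_k -> T -> R) :
  (forall i, continuous (F i)) -> continuous (fun t => \sum_i F i t).
Proof.
elim: k F => [|k IH] F cF t.
  rewrite (_ : (fun t => _) = fun=> 0); first exact: cvg_cst.
  by apply/funext => s; rewrite big_ord0.
rewrite (_ : (fun t => _) = fun t => F ord0 t + \sum_i F (lift ord0 i) t).
  by apply: cvgD; [exact: cF|apply: IH => i; exact: cF].
by apply/funext => s; rewrite big_ord_recl.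
Qed.

Lemma continuous_sphere_chart (r : R) : continuous (@sphere_chart R n r).
Proof.
move=> x; apply: (@cvg_mx C _ (nbhs x) (nbhs_filter x)) => i j; rewrite ord1 mxE.
rewrite (_ : (fun t => _) = (fun x : P => (r * Num.sqrt (wgt x j))%:C * cis (ang x j))); last first.
  by apply/funext => t; rewrite mxE cisE.
rewrite -cisE.
apply: (@continuous_comp _ _ _ (fun x : P => (wgt x j, ang x j))
    (fun p : R * R => (r * Num.sqrt p.1)%:C * cis p.2)); last exact: continuous_polar.
have cpos k : continuous (fun x : P => wgt_pos x k) by move=> y; exact: coord_continuous.
apply: (@cvg_pairT _ R R (nbhs x) (nbhs_filter x)); last exact: coord_continuous.
rewrite /wgt; case: (j == ord0); last exact: cpos.
apply: cvgB; first exact: cvg_cst.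
rewrite (_ : (fun x : P => _) = (fun x : P => \sum_(k < n.+1) (if k != ord0 then wgt_pos x k else 0))).
  rewrite big_mkcond/=.
  apply: continuous_sumR => k; case: (k != ord0); [exact: cpos|exact: cst_continuous].
by apply/funext => y; rewrite big_mkcond.
Qed.

Lemma continuous_logp_chart (f : V -> C) (r : R) : continuous f ->
  continuous (fun x : P => logp (normc (f (sphere_chart r x)))).
Proof.
move=> cf x; apply: (@cvg_logp_normc R _ (nbhs x) (nbhs_filter x)).
apply: (@continuous_cvg _ V C (nbhs x) (nbhs_filter x) (@sphere_chart R n r) f).
  exact: cf.
exact: continuous_sphere_chart.
Qed.

Lemma continuous_mulc {T : topologicalType} (c : R) (f : T -> R) :
  continuous f -> continuous (fun x => c * f x).
Proof. by move=> cf x; apply: cvgM; [exact: cvg_cst|exact: cf]. Qed.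

(** If the n weights s_1, ..., s_n are between these bounds, then s_0 is at least the
    upper one, and all the radii r sqrt (s_j) are comparable to r. *)
Definition wgt_lo : R := (2 * n.+1%:R)^-1.
Definition wgt_hi : R := n.+1%:R^-1.

Lemma wgt_lo_gt0 : 0 < wgt_lo. Proof. by rewrite invr_gt0 mulr_gt0. Qed.
Lemma wgt_lo_lt_hi : wgt_lo < wgt_hi.
Proof. by rewrite ltf_pV2 ?posrE ?mulr_gt0// ltr_pMl// ltr1n. Qed.

Definition polydisc (r : R) : set V := [set z | forall j, normc (z ord0 j) <= r].

(** By [sigma_chart] the characteristic function is at least c times the integral of
    log+|f| over the box of the chart where the weights s_1, ..., s_n are between
    [wgt_lo] and [wgt_hi]. Over this box the integrals over tori dominate log+|f w|.
    The angle t_0 is integrated first, by Fubini: the radius of its circle depends on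
    the other weights, which are then fixed, and the bound that remains no longer
    depends on the first coordinate of the sphere. *)
Lemma char_lower_bound : exists c k : R, [/\ 0 < c, 0 < k &
  forall (f : V -> C), linewise f -> forall r, 0 < r -> forall w, polydisc (k * r) w ->
  ((c * logp (normc (f w)))%:E <= charT r f)%E].
Proof.
have [c c0 sc] := @sigma_chart R n.
have pi0 : 0 < 2 * pi :> R by rewrite mulr_gt0// pi_gt0.
have ab0 := wgt_lo_lt_hi; have a0 := wgt_lo_gt0.
pose c1 := (2 * pi / 3) * ((wgt_hi - wgt_lo) * (2 * pi / 3)) ^+ n.
have p3 : 0 < 2 * pi / 3 :> R by rewrite divr_gt0.
have c10 : 0 < c1.
  by apply: mulr_gt0 => //; apply: exprn_gt0; apply: mulr_gt0; rewrite ?subr_gt0.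
exists (c * c1), (Num.sqrt wgt_lo / 2); split; [exact: mulr_gt0|by rewrite divr_gt0// sqrtr_gt0|].
move=> f lf r r0 w hw; have cf : continuous f by case: lf.
pose LO (j : nat) : R := if j is j'.+1 then pair_lo wgt_lo j' else 0.
pose HI (j : nat) : R := if j is j'.+1 then pair_hi wgt_hi j' else 2 * pi.
have plohi i : pair_lo wgt_lo i <= pair_hi wgt_hi i.
  by rewrite /pair_lo /pair_hi; case: odd; exact: ltW.
have lohi i : LO i <= HI i by case: i => [|i] /=; [exact: ltW|exact: plohi].
pose Vx (x : P) := logp (normc (f (sphere_chart r x))).
have cV : continuous Vx by exact: continuous_logp_chart.
have ccV : continuous (fun x => c * Vx x) by exact: continuous_mulc.
have sumbe (y : 'rV[R]_(n * 2)) : (forall k, y ord0 (pidx k false) <= wgt_hi) ->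
    wgt_lo <= 1 - \sum_(k < n) y ord0 (pidx k false).
  move=> yb; apply: le_trans (ltW ab0) _.
  have : \sum_(k < n) y ord0 (pidx k false) <= \sum_(k < n) wgt_hi by apply: ler_sum.
  rewrite sumr_const card_ord -[wgt_hi *+ n]mulr_natl.
  have : wgt_hi + n%:R * wgt_hi = 1.
    by rewrite /wgt_hi -{1}[n.+1%:R^-1]mul1r -mulrDl addrC natr1 mulfV// pnatr_eq0.
  lra.
apply: le_trans (_ : (c * box_int (1 + n * 2) LO HI Vx)%:E <= _)%E.
  rewrite lee_fin -mulrA; apply: ler_wpM2l; first exact: ltW.
  have swap := box_int_swap (ltW pi0) plohi (row_slice_continuous cV).
  rewrite /= in swap.
  have -> : box_int (1 + n * 2) LO HI Vx =
     ivl 0 (2 * pi) (fun t => box_int (n * 2) (pair_lo wgt_lo) (pair_hi wgt_hi) (fun y => Vx (row_mx t%:M y))) by [].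
  have c1E z : c1 * z = (2 * pi / 3) * (((wgt_hi - wgt_lo) * (2 * pi / 3)) ^+ n * z).
    by rewrite /c1 -[LHS]mulrA.
  (* From here on t_0 is the innermost variable of integration. *)
  rewrite swap c1E.
  pose w' : 'rV[C]_n := \row_j w ord0 (lift ord0 j).
  have wE : w = row_mx (w ord0 ord0)%:M w' :> 'rV_(1 + n) by exact: row_mx_head.
  have hw' j : normc (w ord0 j) <= r * Num.sqrt wgt_lo / 2.
    by rewrite (le_trans (hw j))// mulrC mulrA.
  have := @polydisc_lower_bound R r wgt_lo wgt_hi n (fun u => f (row_mx (w ord0 ord0)%:M u)) w' r0 a0
    (ltW ab0) (linewise_tail _ lf).
  rewrite -wE => h1.
  have hw1 (j : 'I_n) : normc (w' ord0 j) <= r * Num.sqrt wgt_lo / 2 by rewrite mxE; exact: hw'.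
    apply: le_trans (ler_wpM2l (ltW p3) (h1 hw1)) _.
  have ctail : linewise (fun u : 'rV[C]_n => f (row_mx (w ord0 ord0)%:M u)) by exact: linewise_tail.
  have cW : continuous (fun y : 'rV[R]_(n * 2) => logp (normc (f (row_mx (w ord0 ord0)%:M (polar_row r y))))).
    move=> y; apply: (@cvg_logp_normc R _ (nbhs y) (nbhs_filter y)).
    apply: (@continuous_cvg _ 'rV[C]_n C (nbhs y) (nbhs_filter y) (@polar_row R r n)
      (fun u => f (row_mx (w ord0 ord0)%:M u))); first by case: ctail => cu _; exact: cu.
    exact: continuous_polar_row.
  rewrite -box_intZ//; apply: le_box_int => //.
  - exact: continuous_mulc.
  - apply: (@ivl_param_continuous R _ 0 (2 * pi) (fun p : 'rV[R]_(n * 2) * R => Vx (row_mx p.2%:M p.1))).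
      exact: ltW.
    move=> p; apply: (@continuous_comp _ _ _ (fun p : 'rV[R]_(n * 2) * R => (p.2, p.1))
      (fun p : R * 'rV[R]_(n * 2) => Vx (row_mx p.1%:M p.2))); last exact: row_slice_continuous.
    by apply: cvg_pairT; [exact: continuous_snd|exact: continuous_fst].
  - move=> y ybox; have s0 := sumbe y _.
    have ys k : y ord0 (pidx k false) <= wgt_hi.
      by have := ybox (pidx k false); rewrite /pair_lo /pair_hi odd_pidx => /andP[].
    have {}s0 := s0 ys; set s := 1 - _ in s0.
    have rs : 0 < r * Num.sqrt s by rewrite mulr_gt0// sqrtr_gt0 (lt_le_trans a0).
    have := @circle_lower_bound R (fun z => f (row_mx z%:M (polar_row r y))) _ (w ord0 ord0)
      (linewise_head _ lf) rs.
    have E : (fun t => Vx (row_mx t%:M y)) =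
        (fun t => logp (normc (f (row_mx ((r * Num.sqrt s)%:C * cis t)%:M (polar_row r y))))).
      by apply/funext => t; rewrite /Vx sphere_chart_row.
    rewrite E; apply; apply: le_trans (hw' ord0) _.
    by apply: ler_wpM2r => //; apply: ler_wpM2l; [exact: ltW|exact: ler_wsqrtr].
rewrite -box_intZ// -iter_integral_box// /charT /sphere_integral.
apply: le_iter_integral => x; rewrite !patchE.
  by case: ifP => _//; rewrite lee_fin mulr_ge0 ?logp_ge0// ltW.
case: ifPn => [xbox|_]; last first.
  case: ifPn => // xdom; rewrite lee_fin sc//; last first.
    by move: xdom; rewrite inE => xd k; case: (xd k).
  by rewrite mulr_ge0 ?logp_ge0// ltW.
rewrite inE in xbox.
have xdom : sphere_dom x.
  move=> j; move: xbox; rewrite (row_mx_head x); set y := \row_j _ => xbox.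
  have hy (k : 'I_n) e : pair_lo wgt_lo (pidx k e) < y ord0 (pidx k e) < pair_hi wgt_hi (pidx k e).
    by have := xbox (lift ord0 (pidx k e)); rewrite row_mxS.
  case: (unliftP ord0 j) => [k|] ->.
    rewrite wgt_row ang_row; have := hy k true; have := hy k false.
    rewrite /pair_lo /pair_hi !odd_pidx => /andP[h _] hang; split => //.
    exact: lt_trans h.
  have h0 := xbox ord0; rewrite row_mx0 /= in h0.
  rewrite wgt_row0 ang_row0; split => //; apply: lt_le_trans a0 _; apply: sumbe => k.
  by have := hy k false; rewrite /pair_lo /pair_hi odd_pidx => /andP[_ /ltW].
rewrite mem_set// sc//; last by move=> k; case: (xdom k).
by rewrite lee_fin mulrC.
Qed.

(** The sphere of radius r lies in the polydisc of radius r, and the domain of the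
    chart in a box of finite volume. *)
Lemma char_upper_bound : exists2 c : R, 0 < c &
  forall (f : V -> C) (r B : R), 0 < r -> 0 <= B ->
  (forall z, polydisc r z -> logp (normc (f z)) <= B) -> (charT r f <= (c * B)%:E)%E.
Proof.
have [c c0 sc] := @sigma_chart R n.
have pi0 : 0 < 2 * pi :> R by rewrite mulr_gt0// pi_gt0.
pose LO (j : nat) : R := -1; pose HI (j : nat) : R := 2 * pi + 1.
have lohi i : LO i <= HI i by rewrite /LO /HI; lra.
have vol0 : 0 < box_vol (1 + n * 2) LO HI.
  by apply: prodr_gt0 => i _; rewrite /LO /HI; lra.
exists (c * box_vol (1 + n * 2) LO HI) => [|f r B r0 B0 fB]; first exact: mulr_gt0.
rewrite mulrAC -(@box_int_cst R (1 + n * 2) LO HI _ lohi) -iter_integral_box//; last exact: cst_continuous.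
rewrite /charT /sphere_integral; apply: le_iter_integral => x; rewrite !patchE.
  case: ifPn => // xdom; rewrite lee_fin sc//; last first.
    by move: xdom; rewrite inE => xd k; case: (xd k).
  by rewrite mulr_ge0 ?logp_ge0// ltW.
case: ifPn => [xdom|_]; last by case: ifP => _ //=; rewrite lee_fin mulr_ge0// ltW.
rewrite inE in xdom; have w0 k : 0 < wgt x k by case: (xdom k).
have w1 k : wgt x k <= 1.
  rewrite -(sum_wgt x) (bigD1 k)//= lerDl; apply: sumr_ge0 => i _; exact: ltW.
rewrite mem_set.
  rewrite /= lee_fin sc// mulrC ler_pM2l//; apply: fB => j.
  rewrite mxE -cisE normcM normc_cis mulr1 normc_real ger0_norm; last by rewrite mulr_ge0// ltW.
  by rewrite -[X in _ <= X]mulr1 ler_pM2l// -[X in _ <= X]sqrtr1 ler_wsqrtr.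
rewrite /= => i; rewrite /LO /HI; move: xdom w0 w1; rewrite (row_mx_head x); set y := \row_j _.
move=> xdom w0 w1; case: (unliftP (ord0 : 'I_(n * 2).+1) i) => [i'|] ->; last first.
  by have [_] := xdom ord0; rewrite ang_row0 row_mx0 => /andP[? ?]; apply/andP; split; lra.
rewrite row_mxS -(hidxK i'); case: (odd i').
  have [_] := xdom (lift ord0 (hidx i')); rewrite ang_row => /andP[? ?].
  by apply/andP; split; lra.
have := w0 (lift ord0 (hidx i')); have := w1 (lift ord0 (hidx i')); rewrite wgt_row => ? ?.
by apply/andP; split; lra.
Qed.

End Characteristic.

(** * Comparison of limits superior of logarithmic growth *)

Section LogGrowth.
Context {R : realType}.

Lemma near_pinfty_scale (K : R) (Q : R -> Prop) : 0 < K ->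
  (\forall r \near +oo, Q r) -> \forall r \near +oo, Q (K * r).
Proof.
move=> K0 [M [_ MQ]]; exists (M / K); split; first exact: num_real.
by move=> r Mr; apply: MQ; rewrite mulrC -ltr_pdivrMr.
Qed.

(** ln (K r) - ln r is constant and ln r tends to infinity, so neither the dilation
    nor the additive constant changes the limit superior. *)
Lemma limf_esup_log_le (p q : R -> \bar R) (K C : R) : 0 < K ->
  (\forall r \near +oo, (p r <= C%:E + q (K * r)%R)%E) ->
  (limf_esup (fun r => p r * ((ln r)^-1)%:E) (pinfty_nbhs R) <=
   limf_esup (fun r => q r * ((ln r)^-1)%:E) (pinfty_nbhs R))%E.
Proof.
move=> K0 pq; rewrite !limf_esupE; apply: le_ereal_inf_tmp => _ [A FA <-].
set L := ereal_inf _; set S := ereal_sup _.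
suff key (x : R) : (S <= x%:E -> forall e : R, (0 < e)%R -> L <= (x + e)%:E)%E.
  case SE : S => [s| |].
  - by apply/lee_addgt0Pr => e e0; rewrite -EFinD; apply: key => //; rewrite SE.
  - exact: leey.
  - rewrite leeNy_eq; apply/eqP/eq_ninfty => x.
    by have := key (x - 1) _ 1 ltr01; rewrite subrK SE leNye; apply.
move=> Sx e e0.
have [M [_ MA]] := near_pinfty_scale K0 FA.
have [M' [_ Mpq]] := pq.
pose r0 := Num.max (Num.max M M') (Num.max (Num.max 1 K^-1) (expR ((C + x * ln K) / e))).
apply: (@le_trans _ _ (ereal_sup ((fun r => p r * ((ln r)^-1)%:E)%E @` [set r | r0 < r]))).
  apply: ereal_inf_lbound; exists [set r | r0 < r] => //.
  by exists r0; split; [exact: num_real|].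
apply: ge_ereal_sup => _ [r /= + <-]; rewrite /r0 !gt_max.
move=> /andP[/andP[Mr M'r] /andP[/andP[r1 Kr] er]].
have r0' : 0 < r by exact: lt_trans ltr01 r1.
have lr : 0 < ln r by exact: ln_gt0.
have Kr1 : 1 < K * r by rewrite mulrC -ltr_pdivrMr// mul1r.
have lKr : 0 < ln (K * r) by exact: ln_gt0.
have qx : (q (K * r)%R <= (x * ln (K * r))%:E)%E.
  rewrite EFinM -lee_pdivrMr//; apply: le_trans Sx.
  by apply: ereal_sup_ubound; exists (K * r) => //; exact: MA.
rewrite lee_pdivrMr// -EFinM; apply: (le_trans (Mpq r M'r)).
apply: le_trans (leeD2l C%:E qx) _.
rewrite -EFinD lee_fin lnM ?posrE// !mulrDr mulrDl addrA [_ + x * ln K]addrC.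
have : (C + x * ln K) / e <= ln r by rewrite -ler_expR lnK// ltW.
rewrite ler_pdivrMr// => h; lra.
Qed.

End LogGrowth.

(** * Order and hyper-order *)

Section OrderHyperOrder.
Context {R : realType} (n : nat).
Notation C := R[i].
Notation V := 'rV[C]_n.+1.
Import Normc.
Variables (h : V -> C) (lh : linewise h).
Let f : V -> C := fun z => cexp (h z).
Variables (c k D : R).
Hypotheses (c0 : 0 < c) (k0 : 0 < k) (D0 : 0 < D).
Hypothesis lower : forall (g : V -> C), linewise g -> forall r, 0 < r ->
  forall w, polydisc (k * r) w -> ((c * logp (normc (g w)))%:E <= charT r g)%E.
Hypothesis upper : forall (g : V -> C) (r B : R), 0 < r -> 0 <= B ->
  (forall z, polydisc r z -> logp (normc (g z)) <= B) -> (charT r g <= (D * B)%:E)%E.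

(** log+|exp h| <= |h|, and [lower] bounds |h| on the polydisc of radius r by the
    exponential of the characteristic function of h. *)
Lemma char_exp_le r (t : R) : 0 < r -> (charT (k^-1 * r) h <= t%:E)%E ->
  (charT r f <= (D * expR (t / c))%:E)%E.
Proof.
move=> r0 ht; apply: upper => // z hz.
have kr0 : 0 < k^-1 * r by rewrite mulr_gt0// invr_gt0.
have hz' : polydisc (k * (k^-1 * r)) z by rewrite mulVKf// gt_eqF.
have := le_trans (lower lh kr0 hz') ht; rewrite lee_fin => hl.
have hzle : normc (h z) <= expR (t / c).
  apply: le_trans (le_expR_logp _) _.
  by rewrite ler_expR ler_pdivlMr// mulrC.
apply: le_trans hzle; apply: logp_le; first exact: normc_ge0.
rewrite normc_cexp ler_expR; apply: le_trans (Re_le_normc _); exact: ler_norm.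
Qed.

(** Here [lower] bounds log+|exp h|, hence Re h, on the polydisc of radius 2 r. The
    Borel-Caratheodory theorem on the complex lines through 0 turns this into a bound
    for |h| on the polydisc of radius r. *)
Lemma char_le_ln_exp r (t : R) : 0 < r -> 0 <= t -> (charT (2 / k * r) f <= t%:E)%E ->
  (charT r h <= (D * ln (2 * (t / c + 1 + normc (h 0)) ^+ 3))%:E)%E.
Proof.
move=> r0 t0 ft; have h0 := normc_ge0 (h 0).
have tc0 : 0 <= t / c by rewrite divr_ge0// ltW.
set s := t / c + 1 + normc (h 0).
have s1 : 1 <= s by rewrite /s; lra.
have s3 : 1 <= 2 * s ^+ 3.
  have : 1 <= s ^+ 3 by rewrite exprn_ege1.
  lra.
have s30 : 0 < 2 * s ^+ 3 by exact: lt_le_trans s3.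
apply: upper => //; [exact: ln_ge0|move=> z hz].
apply: logp_le; first exact: ln_ge0.
rewrite lnK//; pose G (u : C) := h (u *: z).
have dG : forall u, differentiable G u by exact: linewise_ray.
have GA u : normc u <= 2 -> complex.Re (G u) <= t / c.
  move=> u2; have kr0 : 0 < 2 / k * r by rewrite mulr_gt0// divr_gt0.
  have hz' : polydisc (k * (2 / k * r)) (u *: z).
    move=> j; rewrite mxE normcM.
    have -> : k * (2 / k * r) = 2 * r by field; rewrite gt_eqF.
    by apply: ler_pM => //; exact: normc_ge0.
  have := le_trans (lower (cexp_linewise lh) kr0 hz') ft; rewrite lee_fin => hl.
  rewrite ler_pdivlMr// mulrC; apply: le_trans hl; rewrite ler_pM2l//.
  by rewrite -ler_expR -normc_cexp; exact: le_expR_logp.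
have b2 : normc ((1 / 2)%:C : C) <= 1 / 2.
  by rewrite normc_real ger0_norm// divr_ge0.
have := borel_caratheodory dG tc0 (ltr0n _ 2 : 0 < 2) GA b2.
rewrite -rmorphM/= (_ : 2 * (1 / 2) = 1); last by field.
by rewrite /G scale1r scale0r.
Qed.

Hypothesis h_nonconst : ~ exists a : C, forall z : V, h z = a.

(** By Liouville's theorem on the complex lines through 0 the function h is unbounded. *)
Lemma char_unbounded (B : R) : \forall r \near +oo, (B%:E <= charT r h)%E.
Proof.
(* A point z where c log+|h z| > B lies in the polydisc for all large r. *)
have [z hz] : exists z, B / c < logp (normc (h z)).
  apply: contrapT => nz; apply: h_nonconst; exists (h 0) => z.
  have bd u : normc (h u) <= expR (B / c).
    apply: le_trans (le_expR_logp _) _; rewrite ler_expR leNgt; apply/negP => hu.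
    by apply: nz; exists u.
  by have := liouville (linewise_ray z lh) (fun u => bd (u *: z)) 1; rewrite scale1r scale0r.
pose M := \sum_j normc (z ord0 j).
have M0 : 0 <= M by apply: sumr_ge0 => j _; exact: normc_ge0.
exists (M / k); split; [exact: num_real|] => r Mr.
have r0 : 0 < r by apply: le_lt_trans Mr; rewrite divr_ge0// ltW.
apply: le_trans (lower lh r0 _).
  by rewrite lee_fin mulrC -ler_pdivrMr//; exact: ltW hz.
move=> j; apply: le_trans (_ : M <= _).
  by rewrite /M (bigD1 j)//= lerDl; apply: sumr_ge0 => i _; exact: normc_ge0.
by rewrite mulrC -ler_pdivrMr// ltW.
Qed.

Lemma char_exp_unbounded (B : R) : \forall r \near +oo, (B%:E <= charT (2 / k * r) f)%E.
Proof.
pose B' := Num.max B 0.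
have B0 : 0 <= B' by rewrite le_max lexx orbT.
have [M [_ HM]] := char_unbounded (D * ln (2 * (B' / c + 1 + normc (h 0)) ^+ 3) + 1).
exists (Num.max M 0); split; [exact: num_real|] => r; rewrite gt_max => /andP[Mr r0].
rewrite leNgt; apply/negP => fB.
have fB' : (charT (2 / k * r) f <= B'%:E)%E.
  by apply: (le_trans (ltW fB)); rewrite lee_fin le_max lexx.
have := le_trans (HM r Mr) (char_le_ln_exp r0 B0 fB').
by rewrite lee_fin gerDl ler10.
Qed.

(** By [char_exp_le], log T(r, f) <= log D + T(r / k, h) / c. *)
Lemma hyper_order_le_order : (hyper_order_of f <= order_of h)%E.
Proof.
(* For t >= 1 this gives ln (D exp (t / c)) <= C2 t. *)
pose C2 := `|ln D| + c^-1.
have C20 : 0 < C2 by rewrite ltr_wpDl// invr_gt0.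
apply: (@limf_esup_log_le R _ (fun r => lne (charT r h)) k^-1 (ln C2)); first by rewrite invr_gt0.
have kV0 : 0 < k^-1 by rewrite invr_gt0.
have [M1 [_ H1]] := near_pinfty_scale kV0 (char_unbounded 1).
have k20 : 0 < k / 2 by rewrite divr_gt0.
have [M2 [_ H2]] := near_pinfty_scale k20 (char_exp_unbounded (expR 1)).
exists (Num.max 0 (Num.max M1 M2)); split; [exact: num_real|] => r.
rewrite !gt_max => /andP[r0 /andP[/H1 {H1} t1 /H2 {H2}]].
have -> : 2 / k * (k / 2 * r) = r by field; rewrite gt_eqF.
case tE : (charT (k^-1 * r) h) t1 => [t| |] //; last by move=> _ _; rewrite /= addey// leey.
rewrite lee_fin => t1 f1.
have := char_exp_le r0 (_ : (charT (k^-1 * r) h <= t%:E)%E); rewrite tE => /(_ (lexx _)).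
case: (charT r f) f1 => [b| |]//; rewrite !lee_fin => b1 bD.
have e0 : 0 < expR 1 :> R by exact: expR_gt0.
have b0 : 0 < b by exact: lt_le_trans b1.
have lb1 : 1 <= ln b by rewrite -ler_expR lnK.
have t0 : 0 < t by exact: lt_le_trans t1.
rewrite lne_EFin// lne_EFin ?(lt_le_trans _ lb1)// lne_EFin// -EFinD lee_fin.
rewrite -lnM// ler_ln ?posrE ?mulr_gt0// ?(lt_le_trans _ lb1)//.
apply: le_trans (_ : ln D + t / c <= _).
  by rewrite -[t / c]expRK -lnM ?posrE ?expR_gt0// ler_ln ?posrE// mulr_gt0// expR_gt0.
rewrite /C2 mulrDl [c^-1 * t]mulrC lerD2r.
by apply: (le_trans (ler_norm _)); rewrite ler_peMr.
Qed.

(** By [char_le_ln_exp], T(r, h) is at most a multiple of log T(2 r / k, f). *)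
Lemma order_le_hyper_order : (order_of h <= hyper_order_of f)%E.
Proof.
have h0 := normc_ge0 (h 0).
(* For b >= e these give b / c + 1 + |h 0| <= C3 b and
   ln (2 (b / c + 1 + |h 0|)^3) <= C4 ln b. *)
pose C3 := c^-1 + 1 + normc (h 0).
have cV : 0 < c^-1 by rewrite invr_gt0.
have C31 : 1 <= C3 by rewrite /C3; lra.
pose C4 := ln 2 + 3 * ln C3 + 3.
have C40 : 0 < C4.
  have l2 : 0 <= ln (2 : R) by rewrite ln_ge0// ler1n.
  have l3 : 0 <= ln C3 by exact: ln_ge0.
  rewrite /C4; lra.
have DC0 : 0 < D * C4 by exact: mulr_gt0.
have k20 : 0 < 2 / k by rewrite divr_gt0.
apply: (@limf_esup_log_le R _ (fun r => lne (lne (charT r f))) (2 / k) (ln (D * C4))) => //.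
have [M1 [_ H1]] := char_unbounded 1.
(* Values at least e have a logarithm at least 1, where lne lne is ln ln. *)
have [M2 [_ H2]] := char_exp_unbounded (expR 1).
exists (Num.max 0 (Num.max M1 M2)); split; [exact: num_real|] => r.
rewrite !gt_max => /andP[r0 /andP[/H1 {H1} t1 /H2 {H2}]].
case fE : (charT (2 / k * r) f) => [b| |] //; last by move=> _; rewrite /= addey// leey.
rewrite lee_fin => b1.
have e0 : 0 < expR 1 :> R by exact: expR_gt0.
have b0 : 0 < b by exact: lt_le_trans b1.
have lb1 : 1 <= ln b by rewrite -ler_expR lnK.
have b1' : 1 <= b by apply: le_trans b1; apply/ltW; rewrite expR_gt1.
have := char_le_ln_exp r0 (ltW b0); rewrite fE => /(_ (lexx _)).
case: (charT r h) t1 => [a| |]//; rewrite !lee_fin => a1 aD.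
have a0 : 0 < a by exact: lt_le_trans a1.
have lb0 : 0 < ln b by exact: lt_le_trans lb1.
rewrite !lne_EFin// -EFinD lee_fin -lnM// ler_ln ?posrE ?mulr_gt0//.
apply: (le_trans aD); rewrite -mulrA ler_pM2l//.
have C30 : 0 < C3 by exact: lt_le_trans C31.
have sb : b / c + 1 + normc (h 0) <= C3 * b.
  rewrite /C3 mulrDl mulrDl mul1r [c^-1 * b]mulrC; apply: lerD; first by rewrite lerD2l.
  by rewrite ler_peMr.
have s0 : 0 < b / c + 1 + normc (h 0).
  have : 0 < b / c by rewrite divr_gt0.
  lra.
apply: le_trans (_ : ln (2 * (C3 * b) ^+ 3) <= _).
  rewrite ler_ln ?posrE ?mulr_gt0 ?exprn_gt0 ?mulr_gt0// ler_pM2l//.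
  by rewrite lerXn2r// nnegrE ltW// mulr_gt0.
rewrite lnM ?posrE ?exprn_gt0 ?mulr_gt0// lnXn ?mulr_gt0// lnM ?posrE// -[_ *+ 3]mulr_natl /C4.
have l2 : 0 <= ln (2 : R) by rewrite ln_ge0// ler1n.
have l3 : 0 <= ln C3 by exact: ln_ge0.
have : (ln 2 + 3 * ln C3) * 1 <= (ln 2 + 3 * ln C3) * ln b.
  by apply: ler_wpM2l => //; lra.
lra.
Qed.

End OrderHyperOrder.

Unset Implicit Arguments.

Theorem lemma2p8 (R : realType) (n : nat) (h : 'rV[R[i]]_n.+1 -> R[i])
    (h_entire : entire h)
    (h_nonconst : ~ exists c : R[i], forall z : 'rV[R[i]]_n.+1, h z = c) :
  order_of h = hyper_order_of (fun z => cexp (h z)).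
Proof.
have lh := entire_linewise h_entire.
have [c [k [c0 k0 lower]]] := @char_lower_bound R n.
have [D D0 upper] := @char_upper_bound R n.
apply/eqP; rewrite eq_le; apply/andP; split.
  exact: (order_le_hyper_order lh c0 k0 D0 lower upper h_nonconst).
exact: (hyper_order_le_order lh c0 k0 D0 lower upper h_nonconst).
Qed.
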